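(* Let $\Omega$ be a bounded symmetric slice domain in $\mathbb{H}$ and let $x_0\in\Omega\cap\mathbb{R}$. Let $\Omega_i=\Omega\cap\mathbb{C}$ (with $\mathbb{C}=\mathbb{R}+i\mathbb{R}\subset\mathbb{H}$) and let $\gamma^{\Omega_i}_{x_0}$ be the (complex) Green function of $\Omega_i$ with logarithmic pole at $x_0$. Set $$u(x+Iy):=\gamma^{\Omega_i}_{x_0}(x+iy)$$ for all $x,y\in\mathbb{R}$ and $I\in\mathbb{S}$ such that $x+Iy\in\Omega$. Then: (1) $u$ is a well-defined function on $\Omega$; (2) $u$ is $\mathbb{J}$-plurisubharmonic in $\Omega\setminus\mathbb{R}$ and it belongs to $\mathsf{wsh}_{x_0}(\Omega)$; (3) $u$ coincides with $g^\Omega_{x_0}$.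
   Context: $\mathbb{H}$ is the real algebra of quaternions with its Euclidean norm and topology; a domain is a nonempty connected open set. $\mathbb{S}=\{q\in\mathbb{H}:q^2=-1\}$; for $I\in\mathbb{S}$, $L_I=\mathbb{R}+I\mathbb{R}\cong\mathbb{C}$ and $\Omega_I=\Omega\cap L_I$. A domain $\Omega$ is a slice domain if it intersects $\mathbb{R}$ and $\Omega_I$ is connected for every $I\in\mathbb{S}$; it is symmetric if it is axially symmetric with respect to $\mathbb{R}$ ($x+Iy\in\Omega$ implies $x+y\mathbb{S}\subset\Omega$). Complex Green function: for a bounded domain $D\subset\mathbb{C}$ and $a\in D$, $\gamma^D_a(z)=\sup\{v(z)\}$ over all negative subharmonic functions $v$ on $D$ having a logarithmic pole at $a$, i.e. $v(z)-\log|z-a|$ is bounded above near $a$. $\mathbb{J}$-plurisubharmonic in $\Omega\setminus\mathbb{R}$ means plurisubharmonic with respect to the complex structure on $\mathbb{H}\setminus\mathbb{R}$ given by $\mathbb{J}_{q_0}v=\frac{\mathrm{Im}(q_0)}{|\mathrm{Im}(q_0)|}v$ (induced by the identification $x+Iy\leftrightarrow(I,x+iy)$ of $\mathbb{H}\setminus\mathbb{R}$ with $\mathbb{CP}^1\times\{x+iy:y>0\}$, $\mathbb{S}\cong\mathbb{CP}^1$). An upper semicontinuous $u:\Omega\to[-\infty,+\infty)$, $u\not\equiv-\infty$, is weakly subharmonic if for every $I\in\mathbb{S}$ the restriction $u|_{\Omega_I}$ is subharmonic on $\Omega_I\subseteq L_I\cong\mathbb{C}$. For $q_0\in\Omega$,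 $\mathsf{wsh}_{q_0}(\Omega)$ is the set of weakly subharmonic $u$ on $\Omega$ with $u<0$ and $\limsup_{q\to q_0}\big|u(q)-\log|q-q_0|\big|<\infty$. Let $w(q)=\sup\{u(q):u\in\mathsf{wsh}_{q_0}(\Omega)\}$ (and $w\equiv-\infty$ if this set is empty). The Green function $g^\Omega_{q_0}$ of $\Omega$ with logarithmic pole at $q_0$ is the upper semicontinuous regularization $w^*$ of $w$. *)

(* Defs.v *)
From HB Require Import structures.
From mathcomp Require Import all_boot all_order all_algebra.
From mathcomp Require Import all_classical all_reals all_analysis.
From mathcomp Require Import ring lra.
From mathcomp Require Export complex.

Set Implicit Arguments.
Unset Strict Implicit.
Unset Printing Implicit Defensive.

Import Order.TTheory GRing.Theory Num.Theory.
Import numFieldNormedType.Exports.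

Local Open Scope classical_set_scope.
Local Open Scope ring_scope.

(** The complex plane is [Rcomplex R], i.e. [R[i]] seen as a normed space over
    the reals: [`|z| : R] is the usual modulus.  MathComp provides the norm;
    the topology it induces is added here. *)
Section ComplexPlane.
Variable R : realType.

HB.instance Definition _ :=
  PseudoMetric.copy (Rcomplex R) (pseudoMetric_normed (Rcomplex R)).
HB.instance Definition _ := isPointed.Build (Rcomplex R) 0.
HB.instance Definition _ :=
  NormedZmod_PseudoMetric_eq.Build R (Rcomplex R) erefl.

Lemma Rcomplex_normrZ (l : R) (z : Rcomplex R) : `|l *: z| = `|l| * `|z|.
Proof.
case: z => x y; rewrite /Num.norm /= /Normc.normc /=.
rewrite -[(l * x) ^+ 2 + _](_ : l ^+ 2 * (x ^+ 2 + y ^+ 2) = _); last by ring.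
by rewrite sqrtrM ?sqr_ge0// sqrtr_sqr.
Qed.

HB.instance Definition _ :=
  PseudoMetricNormedZmod_Lmodule_isNormedModule.Build R (Rcomplex R)
    Rcomplex_normrZ.

End ComplexPlane.

(** [Quat a b c d] stands for a + bi + cj + dk. *)
Record quat (R : realType) : Type := Quat { qa : R; qb : R; qc : R; qd : R }.

Section Quaternions.
Variable R : realType.
Implicit Types p q : quat R.

Definition quat_tuple q : R * R * R * R := (qa q, qb q, qc q, qd q).
Definition tuple_quat (t : R * R * R * R) : quat R :=
  let: (a, b, c, d) := t in Quat a b c d.

Lemma quat_tupleK : cancel quat_tuple tuple_quat.
Proof. by case. Qed.

HB.instance Definition _ := Choice.copy (quat R) (can_type quat_tupleK).

Definition qzero : quat R := Quat 0 0 0 0.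
Definition qone : quat R := Quat 1 0 0 0.
Definition qopp q : quat R := Quat (- qa q) (- qb q) (- qc q) (- qd q).
Definition qadd p q : quat R :=
  Quat (qa p + qa q) (qb p + qb q) (qc p + qc q) (qd p + qd q).
Definition qscale (k : R) q : quat R :=
  Quat (k * qa q) (k * qb q) (k * qc q) (k * qd q).
Definition qmul p q : quat R :=
  Quat (qa p * qa q - qb p * qb q - qc p * qc q - qd p * qd q)
       (qa p * qb q + qb p * qa q + qc p * qd q - qd p * qc q)
       (qa p * qc q - qb p * qd q + qc p * qa q + qd p * qb q)
       (qa p * qd q + qb p * qc q - qc p * qb q + qd p * qa q).

Lemma quatP p q :
  qa p = qa q -> qb p = qb q -> qc p = qc q -> qd p = qd q -> p = q.
Proof. by case: p q => [????] [????] /= -> -> -> ->. Qed.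

Lemma qaddA : associative qadd.
Proof. by move=> p q r; apply: quatP => /=; ring. Qed.

Lemma qaddC : commutative qadd.
Proof. by move=> p q; apply: quatP => /=; ring. Qed.

Lemma qadd0q : left_id qzero qadd.
Proof. by move=> p; apply: quatP => /=; ring. Qed.

Lemma qaddNq : left_inverse qzero qopp qadd.
Proof. by move=> p; apply: quatP => /=; ring. Qed.

HB.instance Definition _ :=
  GRing.isZmodule.Build (quat R) qaddA qaddC qadd0q qaddNq.

Lemma qmulA : associative qmul.
Proof. by move=> p q r; apply: quatP => /=; ring. Qed.

Lemma qmul1q : left_id qone qmul.
Proof. by move=> p; apply: quatP => /=; ring. Qed.

Lemma qmulq1 : right_id qone qmul.
Proof. by move=> p; apply: quatP => /=; ring. Qed.

Lemma qmulDl : left_distributive qmul qadd.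
Proof. by move=> p q r; apply: quatP => /=; ring. Qed.

Lemma qmulDr : right_distributive qmul qadd.
Proof. by move=> p q r; apply: quatP => /=; ring. Qed.

Lemma qone_neq0 : qone != 0.
Proof. by apply/eqP => -[] /eqP; rewrite oner_eq0. Qed.

HB.instance Definition _ := GRing.Zmodule_isNzRing.Build (quat R)
  qmulA qmul1q qmulq1 qmulDl qmulDr qone_neq0.

Lemma qscaleA (k l : R) q : qscale k (qscale l q) = qscale (k * l) q.
Proof. by apply: quatP => /=; ring. Qed.

Lemma qscale1 : left_id 1 qscale.
Proof. by move=> q; apply: quatP => /=; ring. Qed.

Lemma qscaleDr : right_distributive qscale +%R.
Proof. by move=> k p q; apply: quatP => /=; ring. Qed.

Lemma qscaleDl q : {morph qscale^~ q : k l / k + l}.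
Proof. by move=> k l; apply: quatP => /=; ring. Qed.

HB.instance Definition _ := GRing.Zmodule_isLmodule.Build R (quat R)
  qscaleA qscale1 qscaleDr qscaleDl.

Lemma qscaleAl (k : R) p q : k *: (p * q) = k *: p * q.
Proof. by apply: quatP => /=; ring. Qed.

HB.instance Definition _ := GRing.Lmodule_isLalgebra.Build R (quat R) qscaleAl.

Lemma qscaleAr (k : R) p q : k *: (p * q) = p * (k *: q).
Proof. by apply: quatP => /=; ring. Qed.

HB.instance Definition _ := GRing.Lalgebra_isAlgebra.Build R (quat R) qscaleAr.

Definition qsq q : R := qa q ^+ 2 + qb q ^+ 2 + qc q ^+ 2 + qd q ^+ 2.

Definition qnorm q : R := Num.sqrt (qsq q).

Lemma qsq_ge0 q : 0 <= qsq q.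
Proof. by rewrite /qsq !addr_ge0 ?sqr_ge0. Qed.

Lemma qnormZ (k : R) q : qnorm (k *: q) = `|k| * qnorm q.
Proof.
rewrite /qnorm -sqrtr_sqr -sqrtrM ?sqr_ge0//; congr Num.sqrt.
by rewrite /qsq /=; ring.
Qed.

Lemma qnorm0_eq0 q : qnorm q = 0 -> q = 0.
Proof.
move=> /eqP; rewrite sqrtr_eq0 /qsq => h.
have := sqr_ge0 (qa q); have := sqr_ge0 (qb q).
have := sqr_ge0 (qc q); have := sqr_ge0 (qd q) => hd hc hb ha.
by apply: quatP; apply/eqP; rewrite -sqrf_eq0; apply/eqP; lra.
Qed.

Lemma ler_qnormD p q : qnorm (p + q) <= qnorm p + qnorm q.
Proof.
rewrite -(@ler_pXn2r _ 2)// ?nnegrE ?addr_ge0 ?sqrtr_ge0//.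
rewrite sqrrD !sqr_sqrtr ?qsq_ge0// -sqrtrM ?qsq_ge0//.
set s := qa p * qa q + qb p * qb q + qc p * qc q + qd p * qd q.
have -> : qsq (p + q) = qsq p + s *+ 2 + qsq q by rewrite /qsq /s /=; ring.
rewrite lerD2r lerD2l lerMn2r /=; apply: (le_trans (ler_norm _)).
rewrite -sqrtr_sqr ler_wsqrtr// -subr_ge0.
rewrite (_ : _ - _ =
  (qa p * qb q - qb p * qa q) ^+ 2 + (qa p * qc q - qc p * qa q) ^+ 2 +
  (qa p * qd q - qd p * qa q) ^+ 2 + (qb p * qc q - qc p * qb q) ^+ 2 +
  (qb p * qd q - qd p * qb q) ^+ 2 + (qc p * qd q - qd p * qc q) ^+ 2).
  by rewrite !addr_ge0 ?sqr_ge0.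
by rewrite /qsq /s; ring.
Qed.

HB.instance Definition _ :=
  @Lmodule_isNormed.Build R (quat R) qnorm ler_qnormD qnormZ qnorm0_eq0.

Definition qi : quat R := Quat 0 1 0 0.

Definition qIm q : quat R := Quat 0 (qb q) (qc q) (qd q).

Definition imag_units : set (quat R) := [set q | q ^+ 2 = -1].

Definition real_axis : set (quat R) := range (fun x : R => x%:A).

(** The identification of C with L_I, x + iy |-> x + yI. *)
Definition slice_emb (I : quat R) (z : Rcomplex R) : quat R :=
  (complex.Re z)%:A + complex.Im z *: I.

(** Omega_I, viewed in C through [slice_emb I]. *)
Definition slice (Omega : set (quat R)) (I : quat R) : set (Rcomplex R) :=
  slice_emb I @^-1` Omega.

Definition domain (T : topologicalType) (D : set T) : Prop :=
  [/\ D !=set0, open D & connected D].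

Definition slice_domain (Omega : set (quat R)) : Prop :=
  [/\ domain Omega, Omega `&` real_axis !=set0 &
      forall I, imag_units I -> connected (slice Omega I)].

Definition axially_symmetric (Omega : set (quat R)) : Prop :=
  forall (x y : R) I, imag_units I -> Omega (x%:A + y *: I) ->
  forall J, imag_units J -> Omega (x%:A + y *: J).

End Quaternions.

Arguments qi {R}.
Arguments imag_units {R}.
Arguments real_axis {R}.

Local Open Scope ereal_scope.

(** Functions with values in [-oo, +oo[ on a set [A] are represented by total
    functions into [\bar R]; only their values on [A] matter. *)
Definition usc_on (R : realType) (T : topologicalType) (A : set T)
    (f : T -> \bar R) : Prop :=
  (forall x, A x -> f x < +oo) /\
  (forall x (c : R), A x -> f x < c%:E ->
     \forall y \near within A (nbhs x), f y < c%:E).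

Definition usc_reg (R : realType) (T : topologicalType) (A : set T)
    (f : T -> \bar R) : T -> \bar R :=
  fun x => limf_esup f (within A (nbhs x)).

Section PotentialTheory.
Variable R : realType.
Implicit Types (D : set (Rcomplex R)) (v : Rcomplex R -> \bar R).
Implicit Types (Omega W : set (quat R)) (u : quat R -> \bar R).

Definition circle_pt (a : Rcomplex R) (r t : R) : Rcomplex R :=
  (a + r *: ((cos t +i* sin t)%C : Rcomplex R))%R.

(** Submean value property on all closed discs contained in [D]; the constant
    -oo is allowed. *)
Definition subharmonic D v : Prop :=
  usc_on D v /\
  forall (a : Rcomplex R) (r : R), (0 < r)%R ->
    [set z | (`|z - a| <= r)%R] `<=` D ->
    v a <= ((2 * pi)^-1)%:E *
           \int[@lebesgue_measure R]_(t in `[0%R, (2 * pi)%R])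
             v (circle_pt a r t).

(** The neighbourhood of the pole is punctured because [ln 0 = 0] in MathComp;
    the value at [a] is irrelevant for an upper bound, being -oo for a
    subharmonic function with such a pole. *)
Definition has_log_pole v (a : Rcomplex R) : Prop :=
  exists M : R, \forall z \near a^', v z <= (ln `|z - a| + M)%:E.

Definition complex_green D (a z : Rcomplex R) : \bar R :=
  ereal_sup [set v z | v in
    [set v | [/\ subharmonic D v, forall z, D z -> v z < 0 &
                 has_log_pole v a]]].

Definition Jstr (q v : quat R) : quat R := ((`|qIm q|^-1 *: qIm q) * v)%R.

Definition unit_disc : set (Rcomplex R) := [set z | (`|z| < 1)%R].

(** The real differential intertwines multiplication by i with J. *)
Definition J_holomorphic_disc (phi : Rcomplex R -> quat R) : Prop :=
  forall z, unit_disc z ->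
    differentiable phi z /\
    forall h : Rcomplex R,
      'd phi z (('i%C : Rcomplex R) * h)%R = Jstr (phi z) ('d phi z h).

(** Plurisubharmonicity on the complex manifold (H \ R, J), for [W] an open
    subset of H \ R: subharmonicity along every holomorphic disc. *)
Definition J_plurisubharmonic W u : Prop :=
  usc_on W u /\
  forall phi, J_holomorphic_disc phi -> phi @` unit_disc `<=` W ->
    subharmonic unit_disc (u \o phi).

Definition weakly_subharmonic Omega u : Prop :=
  [/\ usc_on Omega u,
      exists2 q, Omega q & u q != -oo &
      forall I, imag_units I ->
        subharmonic (slice Omega I) (u \o slice_emb I)].

Definition wsh Omega (q0 : quat R) : set (quat R -> \bar R) :=
  [set u | [/\ weakly_subharmonic Omega u,
               forall q, Omega q -> u q < 0 &
               limf_esup (fun q => `|u q - (ln `|q - q0|%R)%:E|) q0^' < +oo]].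

(** [ereal_sup set0 = -oo], as required when the class is empty. *)
Definition wsh_sup Omega (q0 q : quat R) : \bar R :=
  ereal_sup [set u q | u in wsh Omega q0].

Definition quat_green Omega (q0 : quat R) : quat R -> \bar R :=
  usc_reg Omega (wsh_sup Omega q0).

End PotentialTheory.

(* Main.v *)
(** On a symmetric domain the slices Omega_I all equal D := Omega_i, and
    u = gamma o h with gamma the Green function of D and
    h q = Re q + i |Im q|.  Since D is invariant under conjugation and the pole
    is real, gamma is too, so u restricts to gamma on every slice.  Any v in the
    quaternionic class restricts on slices to functions of the complex class,
    whence v <= u, and u itself is in the quaternionic class; as u is upper
    semicontinuous it is the Green function.  Along a J-holomorphic disc phi,
    h o phi is holomorphic, so u o phi is subharmonic.

    On the plane this needs: (a) gamma is subharmonic, negative, and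
    ln (|z - a| / q) <= gamma <= ln (|z - a| / r) for discs of radii r and q
    about a, inside D and containing D; here gamma equals its upper
    semicontinuous regularization, which is again in the class; (b) v o h is
    subharmonic for v subharmonic and h holomorphic.  For (b), approximate v by
    its sup-convolutions with n |.|^2, which are continuous; composed with h they
    satisfy a submean inequality up to o(r^2) on small circles, because the
    circular mean of a holomorphic function is its value at the centre.  A
    maximum principle turns this into the submean inequality on all discs. *)
Require Import Defs.
From HB Require Import structures.
From mathcomp Require Import all_boot all_order all_algebra.
From mathcomp Require Import all_classical all_reals all_analysis.
From mathcomp Require Import measurable_realfun.
From mathcomp Require Import ring lra.
Set Implicit Arguments.
Unset Strict Implicit.
Unset Printing Implicit Defensive.
Import Order.TTheory GRing.Theory Num.Theory.
Import numFieldNormedType.Exports.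
Local Open Scope classical_set_scope.
Local Open Scope ring_scope.

(** * Means over the circle *)

(** A J-holomorphic disc is only real-differentiable at each point, with no continuity of the
    differential, so the mean value property of holomorphic functions cannot come from Green's
    formula; it is obtained by Goursat's subdivision. Subharmonic functions may take the value -oo
    and their means are extended integrals; estimates are therefore made on bounded truncations, and
    monotone convergence gives back the original inequality. A holomorphic map does not send circles
    to circles, which the exact submean inequality cannot absorb; the version up to o(r^2) can, and
    r^2 is the critical order because it is the gain of |z|^2 on circles. The Green function is a
    supremum over an uncountable family with no monotone sequence at hand: the submean inequality of
    its regularization is proved along points approaching the centre, each with its own competitor,
    and Fatou's lemma. The regularization might still reach the value 0, which the class excludes;
    connectedness of the slice and the logarithmic bound near the pole rule this out. *)

Section CircleMean.
Variable R : realType.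
Implicit Types f g : R -> R.
Local Notation mu := (@lebesgue_measure R).
Local Notation I2pi := (`[0, 2 * pi]%classic : set R).

Definition cmean f : R := (2 * pi)^-1 * \int[mu]_(t in I2pi) f t.

(** Both conditions are asked on the whole line, so that shifting the angle stays in the class
    without side conditions. *)
Definition bounded_mfun f : Prop :=
  measurable_fun setT f /\ exists M, forall t, `|f t| <= M.

Lemma twopi_gt0 : 0 < 2 * pi :> R.
Proof. by rewrite mulr_gt0 ?pi_gt0. Qed.

Let aff (a b : R) := fun x : measurableTypeR R => a * x + b : measurableTypeR R.

Let measurable_aff a b : measurable_fun setT (aff a b).
Proof. by apply: measurable_funD => //; exact: measurable_funM. Qed.

HB.instance Definition _ a b :=
  isMeasurableFun.Build _ _ _ _ (aff a b) (measurable_aff a b).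

Let aff_mfun a b : {mfun (measurableTypeR R) >-> (measurableTypeR R)} := aff a b.

(** Lebesgue measure is determined by its values on the intervals ]c, d]; their preimages are
    intervals of the same length, closed at the other end when a = -1. *)
Lemma lebesgue_affine (a b : R) (A : set R) : `|a| = 1 -> measurable A ->
  pushforward mu (aff_mfun a b) A = mu A.
Proof.
move=> a1 mA; apply/esym.
apply: (@lebesgue_measure_unique _ (pushforward mu (aff_mfun a b))) => //= _ [[c d]] _ <-.
rewrite /pushforward /= /aff.
have [->|->] : a = 1 \/ a = -1.
  by case: (ltP a 0) a1 => h; rewrite ?(ltr0_norm h) ?(ger0_norm h) => <-; [right|left]; rewrite ?opprK.
- rewrite (_ : _ @^-1` _ = `]c - b, d - b]%classic); last first.
    by apply/seteqP; split => x /=; rewrite !in_itv /=; lra.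
  rewrite !lebesgue_measure_itv/= !lte_fin ltrD2r.
  by case: ifP => // _; rewrite -!EFinB; congr EFin; ring.
- rewrite (_ : _ @^-1` _ = `[b - d, b - c[%classic); last first.
    by apply/seteqP; split => x /=; rewrite !in_itv /=; lra.
  rewrite !lebesgue_measure_itv/= !lte_fin ltrD2l ltrN2.
  by case: ifP => // _; rewrite -!EFinB; congr EFin; ring.
Qed.

Lemma bmf_integrable f (A : set R) : bounded_mfun f -> measurable A ->
  (mu A < +oo)%E -> mu.-integrable A (EFin \o f).
Proof.
move=> [mf [M fM]] mA Afin; apply: measurable_bounded_integrable => //.
  exact: measurable_funS mf.
exists M; split; first exact: num_real.
by move=> x Mx t _ /=; rewrite (le_trans (fM t)) // ltW.
Qed.

Lemma mu_itv_fin b1 b2 (x y : R) :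
  (mu [set` Interval (BSide b1 x) (BSide b2 y)] < +oo)%E.
Proof. by rewrite lebesgue_measure_itv; case: ifP => //= _; rewrite -EFinB ltry. Qed.

Lemma bmf_int f b1 b2 (x y : R) : bounded_mfun f ->
  mu.-integrable [set` Interval (BSide b1 x) (BSide b2 y)] (EFin \o f).
Proof. by move=> hf; apply: bmf_integrable => //; exact: mu_itv_fin. Qed.

Lemma Rintegral_affine f (a b : R) (D : set R) : `|a| = 1 -> bounded_mfun f ->
  measurable D -> (mu D < +oo)%E ->
  \int[mu]_(t in [set t | D (a * t + b)]) f (a * t + b) = \int[mu]_(t in D) f t.
Proof.
move=> a1 hf mD Dfin; rewrite /Rintegral; congr fine.
have mphi := measurable_aff a b.
have mf : measurable_fun setT (EFin \o f : measurableTypeR R -> \bar R).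
  by apply/measurable_EFinP; case: hf.
have mff : measurable_fun setT ((EFin \o f : measurableTypeR R -> \bar R) \o aff a b) by exact: measurableT_comp mf mphi.
have mD' : measurable (aff a b @^-1` D) by rewrite -[_ @^-1` _]setTI; exact: mphi.
transitivity (\int[pushforward mu (aff_mfun a b)]_(y in D) (f y)%:E)%E; last first.
  by apply: eq_measure_integral => A mA _; exact: lebesgue_affine.
rewrite integral_pushforward //.
apply/integrableP; split.
  by apply: measurable_funS mff.
have [M fM] := hf.2.
apply: le_lt_trans.
  apply: (integral_le_bound (`|M|)%:E) => //.
    by apply: measurable_funS mff.
  by apply: aeW => z Az /=; rewrite lee_fin (le_trans (fM _)) ?ler_norm.
by rewrite lte_mul_pinfty // -[X in (X < _)%E]/(pushforward mu (aff_mfun a b) D) lebesgue_affine.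
Qed.

Lemma bmfD f g : bounded_mfun f -> bounded_mfun g -> bounded_mfun (fun t => f t + g t).
Proof.
move=> [mf [M fM]] [mg [N gN]]; split; first exact: measurable_funD.
by exists (M + N) => t; rewrite (le_trans (ler_normD _ _)) // lerD.
Qed.

Lemma bmfZ k f : bounded_mfun f -> bounded_mfun (fun t => k * f t).
Proof.
move=> [mf [M fM]]; split; first exact: measurable_funM.
by exists (`|k| * M) => t; rewrite normrM ler_wpM2l.
Qed.

Lemma bmf_cst k : bounded_mfun (fun _ => k).
Proof. by split; [exact: measurable_cst|exists `|k|]. Qed.

Lemma bmf_sum (I : Type) (s : seq I) (F : I -> R -> R) :
  (forall i, bounded_mfun (F i)) -> bounded_mfun (fun t => \sum_(i <- s) F i t).
Proof.
move=> hF; elim: s => [|i s IH].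
  by under [X in bounded_mfun X]eq_fun do rewrite big_nil; exact: bmf_cst.
by under [X in bounded_mfun X]eq_fun do rewrite big_cons; exact: bmfD.
Qed.

Lemma cont_bmf f : continuous f -> (exists M, forall t, `|f t| <= M) -> bounded_mfun f.
Proof. by move=> cf; split => //; exact: continuous_measurable_fun. Qed.

Let mI : measurable I2pi. Proof. exact: measurable_itv. Qed.

Lemma cmeanD f g : bounded_mfun f -> bounded_mfun g ->
  cmean (fun t => f t + g t) = cmean f + cmean g.
Proof.
by move=> hf hg; rewrite /cmean RintegralD // ?mulrDr //; exact: bmf_int.
Qed.

Lemma cmeanZ k f : bounded_mfun f -> cmean (fun t => k * f t) = k * cmean f.
Proof.
move=> hf; rewrite /cmean RintegralZl //; first by rewrite mulrCA.
exact: bmf_int.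
Qed.

Lemma cmean_cst k : cmean (fun _ => k) = k.
Proof.
rewrite /cmean Rintegral_cst //= lebesgue_measure_itv/= lte_fin twopi_gt0 /= subr0.
by rewrite mulrCA mulVf ?mulr1 // gt_eqF ?twopi_gt0.
Qed.

Lemma le_cmean f g : bounded_mfun f -> bounded_mfun g -> (forall t, f t <= g t) ->
  cmean f <= cmean g.
Proof.
move=> hf hg fg; rewrite /cmean ler_pM2l ?invr_gt0 ?twopi_gt0 //.
by apply: le_Rintegral => //; exact: bmf_int.
Qed.

Lemma eq_cmean f g : f =1 g -> cmean f = cmean g.
Proof. by move=> /funext ->. Qed.

Lemma cmean_sum (I : Type) (s : seq I) (F : I -> R -> R) :
  (forall i, bounded_mfun (F i)) ->
  cmean (fun t => \sum_(i <- s) F i t) = \sum_(i <- s) cmean (F i).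
Proof.
move=> hF; elim: s => [|i s IH].
  by under eq_cmean do rewrite big_nil; rewrite cmean_cst big_nil.
under eq_cmean do rewrite big_cons.
by rewrite cmeanD ?IH ?big_cons //; exact: bmf_sum.
Qed.

Lemma cmean_refl f : bounded_mfun f -> cmean (fun t => f (2 * pi - t)) = cmean f.
Proof.
move=> hf; rewrite /cmean; congr (_ * _).
rewrite -[RHS](@Rintegral_affine _ (-1) (2 * pi)) ?normrN1 ?mu_itv_fin //.
rewrite (_ : [set t | _] = I2pi); last first.
  by apply/seteqP; split => x /=; rewrite !in_itv /=; lra.
by congr (Rintegral _ _); apply/funext => t; congr f; ring.
Qed.

Lemma Rintegral_itv_split f (a b c : R) : bounded_mfun f -> a <= b -> b <= c ->
  \int[mu]_(t in `[a, c]) f t =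
  \int[mu]_(t in `[a, b]) f t + \int[mu]_(t in `[b, c]) f t.
Proof.
move=> hf ab bc; have := @Rintegral_itvB _ f (BLeft a) (BRight c) b (bmf_int _ _ _ _ hf).
rewrite !bnd_simp => /(_ ab bc) /eqP; rewrite subr_eq => /eqP ->.
by rewrite Rintegral_itv_obnd_cbnd 1?addrC //; exact: bmf_int.
Qed.

Lemma bmf_shift f th : bounded_mfun f -> bounded_mfun (fun t => f (t + th)).
Proof.
move=> [mf [M fM]]; split; last by exists M.
exact: measurableT_comp mf (@measurable_funD _ _ _ _ _ _ (@measurable_id _ _ _) (@measurable_cst _ _ _ _ _ th)).
Qed.

(** The shifted interval [th, 2 pi + th] is cut at 2 pi and the excess is moved back by periodicity;
    th in [0, 2 pi] makes one cut enough. *)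
Lemma cmean_rot f th : bounded_mfun f -> (forall t, f (t + 2 * pi) = f t) ->
  0 <= th <= 2 * pi -> cmean (fun t => f (t + th)) = cmean f.
Proof.
move=> hf fp /andP[th0 th1]; rewrite /cmean; congr (_ * _).
have step c a b : \int[mu]_(t in `[a, b]) f (t + c) = \int[mu]_(t in `[a + c, b + c]) f t.
  rewrite -[RHS](@Rintegral_affine _ 1 c) ?normr1 ?mu_itv_fin //.
  rewrite (_ : [set t | _] = `[a, b]%classic); last first.
    by apply/seteqP; split => x /=; rewrite !in_itv /=; lra.
  by congr (Rintegral _ _); apply/funext => t; congr f; ring.
rewrite (@Rintegral_itv_split _ 0 (2 * pi - th)); last 3 first.
- exact: bmf_shift.
- lra.
- lra.
rewrite !step add0r subrK.
have -> : \int[mu]_(t in `[2 * pi, 2 * pi + th]) f t = \int[mu]_(t in `[0, th]) f t.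
  have := step (2 * pi) 0 th; rewrite add0r addrC => <-.
  by congr (Rintegral _ _); apply/funext => t.
by rewrite addrC -Rintegral_itv_split.
Qed.

(** Rotation by [th] equates the mean with its opposite. A half turn kills [cos] and [sin]; a
    quarter turn kills second harmonics, as in [log_mean]. *)
Lemma cmean_alt f th : bounded_mfun f -> (forall t, f (t + 2 * pi) = f t) ->
  0 <= th <= 2 * pi -> (forall t, f (t + th) = - f t) -> cmean f = 0.
Proof.
move=> hf fp hth alt; have := cmean_rot hf fp hth.
under eq_cmean do rewrite alt -mulN1r.
by rewrite cmeanZ // => h; lra.
Qed.

Lemma bmf_cos : bounded_mfun (@cos R).
Proof. by apply: cont_bmf; [exact: continuous_cos|exists 1 => t; exact: cos_max]. Qed.

Lemma bmf_sin : bounded_mfun (@sin R).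
Proof. by apply: cont_bmf; [exact: continuous_sin|exists 1 => t; exact: sin_max]. Qed.

Lemma cosD2pi' (t : R) : cos (t + 2 * pi) = cos t.
Proof. by rewrite mulr_natl cosD2pi. Qed.

Lemma sinD2pi' (t : R) : sin (t + 2 * pi) = sin t.
Proof. by rewrite mulr_natl sinD2pi. Qed.

Let pi_ok : 0 <= (pi : R) <= 2 * pi.
Proof. by have := @pi_gt0 R; lra. Qed.

Lemma cmean_cos : cmean (@cos R) = 0.
Proof. by apply: (@cmean_alt _ pi) => //; [exact: bmf_cos|exact: cosD2pi'|exact: cosDpi]. Qed.

Lemma cmean_sin : cmean (@sin R) = 0.
Proof. by apply: (@cmean_alt _ pi) => //; [exact: bmf_sin|exact: sinD2pi'|exact: sinDpi]. Qed.

End CircleMean.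

(** * The complex plane *)

(* Class resolution does not see through the alias [Rcomplex]. *)
#[global] Instance Rcomplex_nbhs_filter (R : realType) (z : Rcomplex R) :
  Filter (nbhs z).
Proof. exact: nbhs_filter. Qed.

#[global] Instance Rcomplex_nbhs_pfilter (R : realType) (z : Rcomplex R) :
  ProperFilter (nbhs z).
Proof. exact: nbhs_pfilter. Qed.

Section Plane.
Variable R : realType.
Local Notation C := (Rcomplex R).
Implicit Types (a z w : C) (r s t : R).

Lemma near_normP (V : normedModType R) (x : V) (P : set V) :
  (\forall y \near x, P y) <-> exists2 d, 0 < d & forall y, `|y - x| < d -> P y.
Proof.
split=> [/nbhs_normP[d d0 h]|[d d0 h]]; first by exists d => // y yx; apply: h; rewrite /= distrC.
by apply/nbhs_normP; exists d => // y /=; rewrite distrC => /h.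
Qed.

Lemma contP (V W : normedModType R) (f : V -> W) (x : V) : f @ x --> f x <->
  forall e, 0 < e -> exists2 d, 0 < d & forall y, `|y - x| < d -> `|f y - f x| < e.
Proof.
split=> [/cvgrPdist_lt h e /h /near_normP[d d0 hd]|h].
  by exists d => // y /hd; rewrite distrC.
apply/cvgrPdist_lt => e /h [d d0 hd]; apply/near_normP; exists d => // y /hd.
by rewrite distrC.
Qed.

Lemma ReD z w : complex.Re (z + w) = complex.Re z + complex.Re w.
Proof. by case: z w => [? ?] [? ?]. Qed.

Lemma ImD z w : complex.Im (z + w) = complex.Im z + complex.Im w.
Proof. by case: z w => [? ?] [? ?]. Qed.

Lemma ReN z : complex.Re (- z) = - complex.Re z.
Proof. by case: z. Qed.

Lemma ImN z : complex.Im (- z) = - complex.Im z.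
Proof. by case: z. Qed.

Lemma ReZ k z : complex.Re (k *: z) = k * complex.Re z.
Proof. by case: z. Qed.

Lemma ImZ k z : complex.Im (k *: z) = k * complex.Im z.
Proof. by case: z. Qed.

Lemma ReM z w : complex.Re (z * w) = complex.Re z * complex.Re w - complex.Im z * complex.Im w.
Proof. by case: z w => [? ?] [? ?]. Qed.

Lemma ImM z w : complex.Im (z * w) = complex.Re z * complex.Im w + complex.Im z * complex.Re w.
Proof. by case: z w => [? ?] [? ?]. Qed.

Definition ReImE := (ReD, ImD, ReN, ImN, ReZ, ImZ, ReM, ImM).

Lemma complexP z w : complex.Re z = complex.Re w -> complex.Im z = complex.Im w -> z = w.
Proof. by case: z w => [? ?] [? ?] /= -> ->. Qed.

Lemma sqnormE z : `|z| ^+ 2 = complex.Re z ^+ 2 + complex.Im z ^+ 2.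
Proof. by case: z => x y; rewrite /Num.norm /= /Normc.normc sqr_sqrtr // addr_ge0 ?sqr_ge0. Qed.

Lemma normCM z w : `|(z * w)%R : C| = `|z| * `|w|.
Proof. exact: Normc.normcM. Qed.

Lemma normRe z : `|complex.Re z| <= `|z|.
Proof.
rewrite -(@ler_pXn2r _ 2) ?nnegrE // sqnormE real_normK ?num_real //.
by rewrite lerDl sqr_ge0.
Qed.

Lemma normIm z : `|complex.Im z| <= `|z|.
Proof.
rewrite -(@ler_pXn2r _ 2) ?nnegrE // sqnormE real_normK ?num_real //.
by rewrite lerDr sqr_ge0.
Qed.

Lemma norm_le_ReIm z : `|z| <= `|complex.Re z| + `|complex.Im z|.
Proof.
rewrite -(@ler_pXn2r _ 2) ?nnegrE ?addr_ge0 // sqnormE sqrrD !real_normK ?num_real //.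
by rewrite lerD2r lerDl mulrn_wge0 // mulr_ge0.
Qed.

Lemma Re_circle a r t : complex.Re (circle_pt a r t) = complex.Re a + r * cos t.
Proof. by rewrite /circle_pt !ReImE. Qed.

Lemma Im_circle a r t : complex.Im (circle_pt a r t) = complex.Im a + r * sin t.
Proof. by rewrite /circle_pt !ReImE. Qed.

Definition circE := (Re_circle, Im_circle).

Lemma circle_ptE a r t : circle_pt a r t = a + circle_pt 0 r t.
Proof. by rewrite /circle_pt add0r. Qed.

Lemma norm_circle0 r t : `|circle_pt 0 r t| = `|r|.
Proof.
apply/eqP; rewrite -(@eqrXn2 _ 2) // sqnormE !circE /= real_normK ?num_real //.
by rewrite !add0r !exprMn -mulrDr cos2Dsin2 mulr1.
Qed.

Lemma norm_circle a r t : `|circle_pt a r t - a| = `|r|.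
Proof. by rewrite circle_ptE addrC addKr norm_circle0. Qed.

Lemma circle_per a r t : circle_pt a r (t + 2 * pi) = circle_pt a r t.
Proof. by apply: complexP; rewrite !circE ?cosD2pi' ?sinD2pi'. Qed.

(** [acos] gives the angle in the closed upper half-plane; below the axis it is replaced by 2 pi
    minus it. The range is the one [cmean_rot] accepts. *)
Lemma polar z : exists2 t, 0 <= t <= 2 * pi & z = circle_pt 0 `|z| t.
Proof.
have [->|z0] := eqVneq z 0.
  exists 0; first by rewrite lexx ltW ?twopi_gt0.
  by apply: complexP; rewrite !circE normr0 !mul0r addr0.
have nz : 0 < `|z| by rewrite normr_gt0.
pose x := complex.Re z / `|z|.
have x1 : -1 <= x <= 1.
  by rewrite -ler_norml /x normrM normfV normr_id ler_pdivrMr ?mul1r ?normRe.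
have Rez : complex.Re z = `|z| * x by rewrite /x mulrCA mulfV ?mulr1 // gt_eqF.
have Imz : `|complex.Im z| = `|z| * Num.sqrt (1 - x ^+ 2).
  have -> : 1 - x ^+ 2 = (complex.Im z / `|z|) ^+ 2.
    rewrite /x !expr_div_n -[X in X - _](@mulfV _ (`|z| ^+ 2)) ?expf_neq0 ?gt_eqF //.
    by rewrite -mulrBl [X in X - _]sqnormE addrC addKr.
  by rewrite sqrtr_sqr normrM normfV normr_id mulrCA mulfV ?mulr1 // gt_eqF.
have p0 := @pi_gt0 R; have a0 := acos_ge0 x1; have a1 := acos_lepi x1.
have ck : cos (acos x) = x by rewrite acosK // in_itv.
have [im0|im0] := leP 0 (complex.Im z).
  exists (acos x); first by apply/andP; split => //; lra.
  apply: complexP; rewrite !circE /= add0r ?ck // sin_acos // -Imz ger0_norm //.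
exists (2 * pi - acos x); first by apply/andP; split; lra.
have -> : 2 * pi - acos x = - acos x + 2 * pi by rewrite addrC.
apply: complexP; rewrite !circE /= add0r ?cosD2pi' ?sinD2pi' ?cosN ?ck // sinN.
by rewrite sin_acos // mulrN -Imz ltr0_norm // opprK.
Qed.

Lemma cont_Re : continuous (@complex.Re R : C -> R).
Proof.
move=> z; apply/contP => e e0; exists e => // y yz.
by rewrite -ReN -ReD (le_lt_trans (normRe _)).
Qed.

Lemma cont_Im : continuous (@complex.Im R : C -> R).
Proof.
move=> z; apply/contP => e e0; exists e => // y yz.
by rewrite -ImN -ImD (le_lt_trans (normIm _)).
Qed.

Lemma cvg_complex (T : Type) (F : set_system T) (FF : Filter F) (f : T -> C) z :
  complex.Re (f x) @[x --> F] --> complex.Re z ->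
  complex.Im (f x) @[x --> F] --> complex.Im z -> f x @[x --> F] --> z.
Proof.
move=> /cvgrPdist_lt hr /cvgrPdist_lt hi; apply/cvgrPdist_lt => e e0.
have e2 : 0 < e / 2 by rewrite divr_gt0.
near=> x; apply: le_lt_trans (norm_le_ReIm _) _; rewrite [ltRHS]splitr ltrD //.
  by rewrite ReD ReN; near: x; exact: hr.
by rewrite ImD ImN; near: x; exact: hi.
Unshelve. all: by end_near. Qed.

Lemma cont_circle a r : continuous (circle_pt a r).
Proof.
move=> t; apply: cvg_complex; rewrite ?circE.
  under eq_fun do rewrite Re_circle.
  by apply: cvgD; [exact: cvg_cst|apply: cvgM; [exact: cvg_cst|exact: continuous_cos]].
under eq_fun do rewrite Im_circle.
by apply: cvgD; [exact: cvg_cst|apply: cvgM; [exact: cvg_cst|exact: continuous_sin]].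
Qed.

Lemma closed_disc a r : closed [set z : C | `|z - a| <= r].
Proof.
rewrite -[X in closed X]setCK; apply: open_closedC; rewrite openE => z /= /negP.
rewrite -ltNge => rz; apply/near_normP; exists (`|z - a| - r); first by rewrite subr_gt0.
move=> y yz /=; apply/negP; rewrite -ltNge.
have : `|z - a| <= `|y - z| + `|y - a|.
  by rewrite (distrC y z) -{1}(subrKA y); exact: ler_normD.
lra.
Qed.

Lemma compact_closed_bounded (A : set C) (M : R) : closed A -> (forall z, A z -> `|z| <= M) -> compact A.
Proof.
move=> cA bA.
pose f (p : R * R) : C := (p.1 +i* p.2)%C.
have fc : continuous f.
  move=> p; apply: cvg_complex => /=; [exact: cvg_fst|exact: cvg_snd].
have cc : compact (f @` (`[- M, M] `*` `[- M, M])).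
  apply: continuous_compact; first exact: continuous_subspaceT.
  apply: compact_setX; exact: segment_compact.
apply: (subclosed_compact cA cc) => z Az.
exists (complex.Re z, complex.Im z); last by case: z Az.
by split; rewrite /= in_itv /= -ler_norml; apply: le_trans (bA _ Az);
  [exact: normRe|exact: normIm].
Qed.

Lemma compact_disc a r : compact [set z : C | `|z - a| <= r].
Proof.
apply: (@compact_closed_bounded _ (r + `|a|)); first exact: closed_disc.
move=> z /= zr; rewrite -[z](subrK a); apply: le_trans (ler_normD _ _) _.
by rewrite lerD2r.
Qed.

(** Without a maximum, each x of K would be beaten, in a neighbourhood, by all i with F i large
    enough. Compactness in near-covering form, along the filter of large values of F, then gives a y
    beating all of K, itself included. *)
Lemma usc_compact_max (T : topologicalType) (K : set T) (F : T -> R) : compact K -> K !=set0 ->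
  (forall (z : T) (c : R), K z -> F z < c -> \forall y \near z, K y -> F y < c) ->
  exists2 z : T, K z & forall y, K y -> F y <= F z.
Proof.
move=> cK [k0 Kk0] usc; apply: contrapT => hno.
have hno' : forall z : T, K z -> exists2 y, K y & F z < F y.
  move=> z Kz; apply: contrapT => h; apply: hno; exists z => // y Ky.
  by rewrite leNgt; apply/negP => zy; apply: h; exists y.
pose G := filter_from K (fun y => [set x | K x /\ F y <= F x]).
have FG : Filter G.
  apply: filter_from_filter; first by exists k0.
  move=> x y Kx Ky; have [xy|yx] := leP (F x) (F y).
    by exists y => // z [Kz yz]; split; split => //; apply: le_trans yz.
  by exists x => // z [Kz xz]; split; split => //; apply: le_trans xz; exact: ltW.
move/compact_near_coveringP: cK => /(_ T G (fun i x => K x -> F x < F i) FG) [|y Ky hy].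
  move=> x Kx; have [y Ky xy] := hno' _ Kx.
  exists ([set x' | K x' -> F x' < F y], [set i | K i /\ F y <= F i]).
    by split; [exact: usc|exists y].
  by move=> [x' i] /= [hx' [Ki yi]] Kx'; apply: lt_le_trans (hx' Kx') yi.
by have := hy y (conj Ky (lexx _)) y Ky Ky; rewrite ltxx.
Qed.

End Plane.

(** * Asymptotic submean inequality and maximum principle *)

Section ASub.
Variable R : realType.
Local Notation C := (Rcomplex R).
Implicit Types (a z w : C) (r s t : R) (F G : C -> R).

(* Submean inequality up to o(r^2): unlike the exact one it is local, and it
   survives a second-order perturbation of the centre. *)
Definition asub F z := forall e, 0 < e -> exists2 d, 0 < d &
  forall r, 0 < r < d -> bounded_mfun (fun t => F (circle_pt z r t)) /\
    F z - e * r ^+ 2 <= cmean (fun t => F (circle_pt z r t)).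

Lemma asubD F G z : asub F z -> asub G z -> asub (fun w => F w + G w) z.
Proof.
move=> hF hG e e0; have e2 : 0 < e / 2 by rewrite divr_gt0.
have [d1 d10 h1] := hF _ e2; have [d2 d20 h2] := hG _ e2.
exists (Num.min d1 d2) => [|r]; first by rewrite lt_min d10.
rewrite lt_min => /and3P[r0 r1 r2].
have /h1[b1 l1] : 0 < r < d1 by rewrite r0.
have /h2[b2 l2] : 0 < r < d2 by rewrite r0.
split; first exact: bmfD.
rewrite cmeanD //; lra.
Qed.

Lemma asubZ k F z : 0 <= k -> asub F z -> asub (fun w => k * F w) z.
Proof.
(* [k] may be 0, so the tolerance is divided by k + 1. *)
move=> k0 hF e e0; have k1 : 0 < k + 1 by lra.
have [|d d0 h] := hF (e / (k + 1)); first by rewrite divr_gt0.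
exists d => // r rd; have [b l] := h _ rd.
split; first exact: bmfZ.
rewrite cmeanZ //; apply: le_trans (ler_wpM2l k0 l).
rewrite mulrBr lerD2l lerN2 mulrA ler_wpM2r ?sqr_ge0 //.
by rewrite mulrA ler_pdivrMr // mulrC ler_pM2l // lerDl.
Qed.

Lemma asub_cst k z : asub (fun=> k) z.
Proof.
move=> e e0; exists 1 => // r _; split; first exact: bmf_cst.
by rewrite cmean_cst lerBlDr lerDl mulr_ge0 ?sqr_ge0 // ltW.
Qed.

Lemma asub_sum (I : Type) (s : seq I) (F : I -> C -> R) z :
  (forall i, asub (F i) z) -> asub (fun w => \sum_(i <- s) F i w) z.
Proof.
move=> hF; elim: s => [|i s IH].
  rewrite (_ : (fun _ => _) = fun=> 0); first exact: asub_cst.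
  by apply/funext => w; rewrite big_nil.
rewrite (_ : (fun _ => _) = fun w => F i w + \sum_(j <- s) F j w); first exact: asubD.
by apply/funext => w; rewrite big_cons.
Qed.

Definition crot (c : C) (th : R) (z : C) : C := c + (((cos th +i* sin th)%C : C) * (z - c) : C).

Lemma crot_circle c th z r t :
  crot c th (circle_pt z r t) = circle_pt (crot c th z) r (t + th).
Proof.
by apply: complexP; rewrite /crot !(ReImE, circE) /= ?cosD ?sinD; ring.
Qed.

Lemma crot_pole c th : crot c th c = c.
Proof. by rewrite /crot subrr mulr0 addr0. Qed.

Lemma cont_crot c th : continuous (crot c th).
Proof.
move=> z; apply/contP => e e0; exists e => // y yz.
rewrite /crot opprD addrACA subrr add0r -mulrBr normCM opprB addrA subrK.
suff -> : `|(cos th +i* sin th)%C : C| = 1 by rewrite mul1r.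
by apply/eqP; rewrite -(@eqrXn2 _ 2) // sqnormE /= cos2Dsin2 expr1n.
Qed.

Lemma norm_crot c th z : `|crot c th z - c| = `|z - c|.
Proof.
rewrite /crot addrC addKr normCM.
suff -> : `|(cos th +i* sin th)%C : C| = 1 by rewrite mul1r.
by apply/eqP; rewrite -(@eqrXn2 _ 2) // sqnormE /= cos2Dsin2 expr1n.
Qed.

Lemma asub_rot c th F z : 0 <= th <= 2 * pi -> asub F (crot c th z) ->
  asub (fun w => F (crot c th w)) z.
Proof.
move=> hth hF e e0; have [d d0 h] := hF _ e0; exists d => // r rd.
have [b l] := h _ rd.
under eq_cmean do rewrite crot_circle.
under [X in bounded_mfun X]eq_fun do rewrite crot_circle.
split; first exact: (bmf_shift _ b).
rewrite (@cmean_rot _ (fun t => F (circle_pt (crot c th z) r t))) // => t.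
by rewrite circle_per.
Qed.

Lemma sqnorm_circle z r t : `|circle_pt z r t| ^+ 2 =
  `|z| ^+ 2 + r ^+ 2 + 2 * r * (complex.Re z * cos t + complex.Im z * sin t).
Proof.
rewrite !sqnormE !circE (_ : r ^+ 2 = r ^+ 2 * (cos t ^+ 2 + sin t ^+ 2)).
  by ring.
by rewrite cos2Dsin2 mulr1.
Qed.

Lemma bmf_trig (x y : R) : bounded_mfun (fun t => x * cos t + y * sin t).
Proof. by apply: bmfD; apply: bmfZ; [exact: bmf_cos|exact: bmf_sin]. Qed.

Lemma cmean_trig (x y : R) : cmean (fun t => x * cos t + y * sin t) = 0.
Proof.
have bc := @bmf_cos R; have bs := @bmf_sin R.
by rewrite cmeanD ?cmeanZ ?cmean_cos ?cmean_sin ?mulr0 ?addr0 //; exact: bmfZ.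
Qed.

(* Perturb F by a small multiple of |z|^2, whose mean on circles exceeds its
   value at the centre by exactly r^2, and look at a maximum point. *)
Lemma maximum_principle (K : set C) F (M : R) : compact K -> (forall z, K z -> `|z| <= M) ->
  (forall z c, K z -> F z < c -> \forall y \near z, K y -> F y < c) ->
  (forall z, K z -> F z <= 0 \/ (asub F z /\
    exists2 d, 0 < d & forall r t, 0 < r < d -> K (circle_pt z r t))) ->
  forall z, K z -> F z <= 0.
Proof.
move=> cK bK uF hF z1 Kz1; rewrite leNgt; apply/negP => Fz1.
have M0 : 0 <= M by apply: le_trans (bK _ Kz1).
(* Small enough that n |z|^2 < F z1 on K, so that F is still positive where G is maximal; the 1
   covers M = 0. *)
pose n := F z1 / (2 * (M ^+ 2 + 1)).
have M2 : 0 < M ^+ 2 + 1 by rewrite ltr_wpDl ?sqr_ge0.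
have n0 : 0 < n by rewrite divr_gt0 // mulr_gt0.
have nM : n * M ^+ 2 < F z1.
  have : n * (M ^+ 2 + 1) = F z1 / 2.
    by rewrite /n; field; rewrite gt_eqF //.
  lra.
pose G z := F z + n * `|z| ^+ 2.
have [||z Kz zmax] := @usc_compact_max _ _ K G cK; first by exists z1.
  move=> z c Kz; rewrite /G => zc.
  pose dl := (c - (F z + n * `|z| ^+ 2)) / 2.
  have dl0 : 0 < dl by rewrite divr_gt0 // subr_gt0.
  have h1 : \forall y \near z, K y -> F y < F z + dl by apply: uF => //; rewrite ltrDl.
  have h2 : \forall y \near z, n * `|y| ^+ 2 < n * `|z| ^+ 2 + dl.
    have : (fun y : C => n * `|y| ^+ 2) @ z --> n * `|z| ^+ 2.
      apply: cvgM; first exact: cvg_cst.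
      by apply: cvgM; apply: cvg_norm; exact: cvg_id.
    by move=> /cvgr_lt; apply; rewrite ltrDl.
  near=> y => Ky.
  have y1 : F y < F z + dl by apply: (near h1 y).
  have y2 : n * `|y| ^+ 2 < n * `|z| ^+ 2 + dl by near: y.
  rewrite /dl in y1 y2; lra.
have Fz0 : 0 < F z.
  have := zmax _ Kz1; rewrite /G => le1.
  have : n * `|z| ^+ 2 <= n * M ^+ 2.
    by rewrite ler_pM2l // ler_pXn2r ?nnegrE // bK.
  have : 0 <= n * `|z1| ^+ 2 by rewrite mulr_ge0 ?sqr_ge0 // ltW.
  lra.
have [|[aF [d1 d10 hd1]]] := hF _ Kz; first by lra.
(* The allowed loss n r^2 / 2 is less than the gain n r^2 of the quadratic term. *)
have n2 : 0 < n / 2 by rewrite divr_gt0.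
have [d2 d20 hd2] := aF _ n2.
pose r := Num.min d1 d2 / 2.
have m0 : 0 < Num.min d1 d2 by rewrite lt_min d10.
have r0 : 0 < r by rewrite divr_gt0.
have : r < Num.min d1 d2 by rewrite /r; lra.
rewrite lt_min => /andP[rd1 rd2].
have /hd2[bF lF] : 0 < r < d2 by rewrite r0.
have : cmean (fun t => F (circle_pt z r t) + (n * (`|z| ^+ 2 + r ^+ 2) +
   (n * (2 * r)) * (complex.Re z * cos t + complex.Im z * sin t))) <= G z.
  have -> : G z = cmean (fun=> G z) by rewrite cmean_cst.
  apply: le_cmean.
  - by apply: bmfD => //; apply: bmfD; [exact: bmf_cst|apply: bmfZ; exact: bmf_trig].
  - exact: bmf_cst.
  - move=> t; apply: le_trans (zmax (circle_pt z r t) _); last by apply: hd1; rewrite r0.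
    by rewrite /G sqnorm_circle le_eqVlt; apply/orP; left; apply/eqP; ring.
rewrite cmeanD //; last by apply: bmfD; [exact: bmf_cst|apply: bmfZ; exact: bmf_trig].
rewrite cmeanD; [|exact: bmf_cst|apply: bmfZ; exact: bmf_trig].
rewrite cmean_cst cmeanZ ?cmean_trig; last exact: bmf_trig.
have : 0 < n * r ^+ 2 by rewrite mulr_gt0 // exprn_gt0.
rewrite /G mulrDr; lra.
Unshelve. all: by end_near. Qed.

End ASub.

(** * From the asymptotic to the exact submean inequality *)

Section SubMean.

Variable R : realType.
Local Notation C := (Rcomplex R).
Implicit Types (a z w : C) (r s t : R) (F G : C -> R).

(** Only [x] is confined to the segment; [y] may leave it. *)
Lemma unif_cont_segment (f : R -> R) (a b e : R) : continuous f -> 0 < e ->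
  exists2 d, 0 < d & forall x y, a <= x <= b -> `|y - x| < d -> `|f y - f x| < e.
Proof.
move=> cf e0.
have /compact_near_coveringP := @segment_compact R a b.
move=> /(_ R (0^'+) (fun d x => forall y, `|y - x| < d -> `|f y - f x| < e) _).
case=> [x _|d /= d0 h].
  have e2 : 0 < e / 2 by rewrite divr_gt0.
  have [d d0 hd] := (contP f x).1 (cf x) _ e2.
  have d2 : 0 < d / 2 by rewrite divr_gt0.
  exists ([set x' | `|x' - x| < d / 2], [set i | i < d / 2]).
    have h1 : \forall x' \near (x : R), `|x' - x| < d / 2 by apply/near_normP; exists (d / 2).
    have h2 : \forall i \near (0 : R)^'+, i < d / 2 by exact: nbhs_right_lt.
    by split; [exact: h1|exact: h2].
  move=> [x' i] /= [hx' hi] y yx'.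
  have h1 : `|f y - f x| < e / 2.
    apply: hd; rewrite -(subrKA x'); apply: le_lt_trans (ler_normD _ _) _; lra.
  have h2 : `|f x' - f x| < e / 2 by apply: hd; lra.
  rewrite -(subrKA (f x)); apply: le_lt_trans (ler_normD _ _) _.
  by rewrite (distrC (f x)); lra.
exists (d / 2); first by rewrite divr_gt0.
move=> x y xab xy; apply: (h (d / 2)) => //=.
- by rewrite sub0r normrN gtr0_norm; lra.
by lra.
Qed.

Lemma periodic_int (f : R -> R) (p : R) (k : int) : (forall t, f (t + p) = f t) ->
  forall t, f (t + k%:~R * p) = f t.
Proof.
move=> fp.
have hn n t : f (t + n%:R * p) = f t.
  elim: n t => [|n IH] t; first by rewrite mul0r addr0.
  by rewrite -natr1 mulrDl mul1r addrA fp IH.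
case: k => n t; first by rewrite -pmulrn hn.
rewrite NegzE mulrNz mulNr -(hn n.+1 (t - _)) -pmulrn subrK //.
Qed.

Lemma periodic_repr (f : R -> R) (p : R) : 0 < p -> (forall t, f (t + p) = f t) ->
  forall t, exists2 t', 0 <= t' <= p & f t = f t'.
Proof.
move=> p0 fp t; have /andP[h1 h2] := floor_itv (t / p).
exists (t + (- Num.floor (t / p))%:~R * p); last by rewrite periodic_int.
rewrite ler_pdivlMr // in h1; rewrite ltr_pdivrMr // intrD mulrDl mul1r in h2.
by rewrite mulrNz mulNr; apply/andP; split; lra.
Qed.

Lemma average_const N (x : R) : (0 < N)%N -> N%:R^-1 * \sum_(j < N) x = x.
Proof.
move=> N0; rewrite sumr_const card_ord -(mulr_natr x) mulrC -mulrA mulfV ?mulr1 //.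
by rewrite pnatr_eq0 -lt0n.
Qed.

Lemma turn_bounds N (j : 'I_N) :
  (0 : R) <= 2 * (pi : R) * (j%:R / N%:R) <= 2 * (pi : R).
Proof.
have N0 : (0 : R) < N%:R by rewrite ltr0n; apply: leq_ltn_trans (ltn_ord j).
have h : (0 : R) <= (j%:R / N%:R : R) <= 1.
  by rewrite divr_ge0 //= ler_pdivrMr // mul1r ler_nat ltnW.
have /ltW p0 := @twopi_gt0 R; case/andP: h => h1 h2.
by rewrite mulr_ge0 // ler_piMr.
Qed.

(** The average [Ph] over N equidistant shifts has period 2 pi / N and the same mean as f. Two of
    its values can thus be compared at arguments closer than the modulus of continuity, which makes
    the estimate uniform in t. *)
Lemma riemann_periodic (f : R -> R) (e : R) : continuous f ->
  (forall t, f (t + 2 * pi) = f t) -> 0 < e ->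
  exists N, (0 < N)%N /\ forall t,
   N%:R^-1 * \sum_(j < N) f (t + 2 * pi * (j%:R / N%:R)) <= cmean f + e.
Proof.
move=> cf fp e0; have pi0 := @twopi_gt0 R.
(* 4 pi: a representative in one period p <= 2 pi, plus a shift of at most 2 pi. *)
have [d d0 hd] := @unif_cont_segment f 0 (4 * pi) e cf e0.
have bf : bounded_mfun f.
  apply: cont_bmf => //.
  have cnf : continuous (fun t => `|f t|) by move=> t; apply: cvg_norm; exact: cf.
  have [x _ xmax] := EVT_max (ltW pi0) (continuous_subspaceT cnf).
  exists `|f x| => t; have [t' t'p ->] := periodic_repr pi0 fp t.
  by apply: xmax; rewrite in_itv.
have [m hm] : exists m, 2 * pi / d < m.+1%:R.
  by exists (Num.truncn (2 * pi / d)); exact: truncnS_gt.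
pose N := m.+1.
have N0 : (0 : R) < N%:R by rewrite ltr0n.
pose p : R := 2 * pi / N%:R.
have p0 : 0 < p by rewrite divr_gt0.
have pd : p < d.
  by move: hm; rewrite ltr_pdivrMr // /p ltr_pdivrMr // (mulrC d).
have pN : p * N%:R = 2 * pi by rewrite /p mulfVK // gt_eqF.
have p2 : p <= 2 * pi.
  by rewrite -pN ler_peMr ?ler1n // ltW.
exists N; split => // t.
pose Ph t := N%:R^-1 * \sum_(j < N) f (t + 2 * pi * (j%:R / N%:R)).
rewrite -/(Ph t).
have shE (j : nat) : 2 * pi * (j%:R / N%:R) = j%:R * p by rewrite /p; ring.
have bterm j : bounded_mfun (fun s => f (s + 2 * pi * (j%:R / N%:R))) by exact: bmf_shift.
have Phper s : Ph (s + p) = Ph s.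
  rewrite /Ph; congr (_ * _).
  rewrite -(big_mkord xpredT (fun j => f (s + p + 2 * pi * (j%:R / N%:R)))).
  rewrite -(big_mkord xpredT (fun j => f (s + 2 * pi * (j%:R / N%:R)))).
  (* A shift by p moves each term to the next one, and the last to the first by periodicity of f. *)
  rewrite big_nat_recr //= big_nat_recl //= addrC; congr (_ + _).
    rewrite shE mul0r mulr0 addr0 -[RHS]fp; congr f.
    by rewrite -pN /N -natr1; ring.
  by apply: eq_bigr => j _; congr f; rewrite !shE -natr1; ring.
have bPh : bounded_mfun Ph by apply: bmfZ; apply: bmf_sum => j.
have cPh : cmean Ph = cmean f.
  rewrite /Ph cmeanZ; last by apply: bmf_sum => j.
  rewrite cmean_sum //; rewrite (eq_bigr (fun=> cmean f)); last first.
    move=> j _; rewrite cmean_rot //; exact: turn_bounds.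
  by rewrite average_const.
rewrite -cPh -(cmean_cst e) -cmeanD //; last exact: bmf_cst.
rewrite -[leLHS]cmean_cst; apply: le_cmean; [exact: bmf_cst|apply: bmfD => //; exact: bmf_cst|].
move=> s.
have [t' t'p ->] := periodic_repr p0 Phper t.
have [s' s'p ->] := periodic_repr p0 Phper s.
rewrite -(@average_const N e) //.
rewrite -mulrDr ler_pM2l ?invr_gt0 // -big_split /=; apply: ler_sum => j _.
have jp := turn_bounds j.
have : `|f (t' + 2 * pi * (j%:R / N%:R)) - f (s' + 2 * pi * (j%:R / N%:R))| < e.
  apply: hd; first by lra.
  rewrite (_ : _ - _ = t' - s'); last by ring.
  by rewrite ltr_norml; apply/andP; split; lra.
by move=> /ltr_normlW; lra.
Qed.

Lemma cont_sum (I : Type) (s : seq I) (F : I -> C -> R) z :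
  (forall i, F i @ z --> F i z) ->
  (fun w => \sum_(i <- s) F i w) @ z --> \sum_(i <- s) F i z.
Proof.
move=> hF; elim: s => [|i s IH].
  rewrite (_ : (fun _ => _) = fun=> 0) ?big_nil; first exact: cvg_cst.
  by apply/funext => w; rewrite big_nil.
rewrite (_ : (fun _ => _) = fun w => F i w + \sum_(j <- s) F j w) ?big_cons.
  by apply: cvgD; [exact: hF|exact: IH].
by apply/funext => w; rewrite big_cons.
Qed.

(* The average of F over N rotations about c is nearly constant on the circle,
   so the maximum principle compares its value at c with the circular mean. *)
Lemma submean_cont (c : C) r F : 0 < r ->
  (forall z, `|z - c| <= r -> F @ z --> F z) ->
  (forall z, `|z - c| < r -> asub F z) ->
  F c <= cmean (fun t => F (circle_pt c r t)).
Proof.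
move=> r0 cF aF; apply/ler_addgt0Pr => e e0.
pose f t := F (circle_pt c r t).
have cf : continuous f.
  move=> t; apply: (@continuous_comp _ _ _ (circle_pt c r) F); first exact: cont_circle.
  by apply: cF; rewrite norm_circle gtr0_norm.
have fp t : f (t + 2 * pi) = f t by rewrite /f circle_per.
have [N [N0 hN]] := riemann_periodic cf fp e0.
have N0' : (0 : R) < N%:R by rewrite ltr0n.
pose th (j : nat) : R := 2 * pi * (j%:R / N%:R).
pose G z := N%:R^-1 * (\sum_(j < N) F (crot c (th j) z)) + - (cmean f + e).
suff : G c <= 0.
  rewrite /G (eq_bigr (fun=> F c)) => [|j _]; last by rewrite crot_pole.
  by rewrite average_const // subr_le0.
apply: (@maximum_principle _ [set z : C | `|z - c| <= r] G (r + `|c|)).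
- exact: compact_disc.
- move=> z /= zr; rewrite -[z](subrK c); apply: le_trans (ler_normD _ _) _.
  by rewrite lerD2r.
- move=> z x /= zr Gx.
  have : G @ z --> G z.
    apply: cvgD; last exact: cvg_cst.
    apply: cvgM; first exact: cvg_cst.
    apply: cont_sum => j; apply: (@continuous_comp _ _ _ (crot c (th j)) F); first exact: cont_crot.
    by apply: cF; rewrite norm_crot.
  by move=> /cvgr_lt /(_ _ Gx); apply: filterS.
- move=> z /= zr; have [zr'|zr'] := ltP `|z - c| r.
    right; split.
      apply: asubD; last exact: asub_cst.
      apply: asubZ; first by rewrite invr_ge0 ltW.
      apply: asub_sum => j; apply: asub_rot; first exact: turn_bounds.
      by apply: aF; rewrite norm_crot.
    exists (r - `|z - c|); first by rewrite subr_gt0.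
    move=> s t /andP[s0 sr]; rewrite -(subrKA z).
    apply: le_trans (ler_normD _ _) _; rewrite norm_circle gtr0_norm //; lra.
  left; have {zr zr'}zr : `|z - c| = r by apply/eqP; rewrite eq_le zr.
  have [t _ zt] := polar (z - c).
  have -> : z = circle_pt c r t by rewrite circle_ptE -zr -zt addrC subrK.
  rewrite /G subr_le0; apply: le_trans (hN t).
  rewrite ler_pM2l ?invr_gt0 //; apply: ler_sum => j _.
  by rewrite crot_circle crot_pole.
- by rewrite /= subrr normr0 ltW.
Qed.

End SubMean.

(** * Goursat's lemma *)

Section Goursat.
Variable R : realType.
Local Notation C := (Rcomplex R).
Local Notation mu := (@lebesgue_measure R).

(** Base point and length instead of two endpoints: subdivision then only halves [l]. *)
Definition seg (f : R -> R) (a l : R) := \int[mu]_(x in `[a, a + l]) f x.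

Lemma cont_seg_int (f : R -> R) (a b : R) :
  (forall x, a <= x <= b -> f @ x --> f x) ->
  mu.-integrable `[a, b] (EFin \o f).
Proof.
move=> cf; apply: continuous_compact_integrable; first exact: segment_compact.
by apply: continuous_in_subspaceT => x; rewrite inE /= in_itv => /cf.
Qed.

Lemma segD (f : R -> R) (a l m : R) : 0 <= l -> 0 <= m ->
  (forall x, a <= x <= a + (l + m) -> f @ x --> f x) ->
  seg f a (l + m) = seg f a l + seg f (a + l) m.
Proof.
move=> l0 m0 /cont_seg_int cf; rewrite /seg.
have := @Rintegral_itvB _ f (BLeft a) (BRight (a + (l + m))) (a + l) cf.
rewrite !bnd_simp => h; have /h{}h : a <= a + l by lra.
have /h/eqP : a + l <= a + (l + m) by lra.
rewrite subr_eq => /eqP ->; rewrite addrC; congr (_ + _).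
rewrite -addrA Rintegral_itv_obnd_cbnd //.
by apply: (integrableS _ _ _ cf) => // x /=; rewrite !in_itv /=; lra.
Qed.

(** Applied to opposite sides of a rectangle: [c] is the linear increment across it and [e] the
    differentiability error. *)
Lemma seg_bound (f g : R -> R) (a l c e : R) : 0 <= l ->
  (forall x, a <= x <= a + l -> f @ x --> f x) ->
  (forall x, a <= x <= a + l -> g @ x --> g x) ->
  (forall x, a <= x <= a + l -> `|g x - f x - c| <= e) ->
  `|seg g a l - seg f a l - c * l| <= e * l.
Proof.
move=> l0 /cont_seg_int cf /cont_seg_int cg b; rewrite /seg -RintegralB //.
have mcst k : \int[mu]_(x in `[a, a + l]) k = k * l.
  rewrite Rintegral_cst //= lebesgue_measure_itv /= lte_fin.
  by case: ltP => h /=; [congr (_ * _); ring|have -> : l = 0 by lra].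
have icst k : mu.-integrable `[a, a + l] (EFin \o (fun=> k : R)).
  by apply: cont_seg_int => x _; exact: cvg_cst.
have iB : mu.-integrable `[a, a + l] (EFin \o (fun x => g x - f x)).
  exact: (integrableB _ cg cf).
rewrite ler_norml; apply/andP; split.
  rewrite lerBrDl -mulrBl -mcst; apply: le_Rintegral => // x /=; rewrite in_itv /= => /b.
  by rewrite ler_norml; lra.
rewrite lerBlDl -mulrDl -mcst; apply: le_Rintegral => // x /=; rewrite in_itv /= => /b.
by rewrite ler_norml; lra.
Qed.

Lemma nested_point (a b : nat -> R) : (forall k, a k <= a k.+1) ->
  (forall k, b k.+1 <= b k) -> (forall k, a k <= b k) ->
  exists x, forall k, a k <= x <= b k.
Proof.
move=> ha hb hab.
have am i j : (i <= j)%N -> a i <= a j.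
  by move=> /subnKC <-; elim: (j - i)%N => [|n IH]; rewrite ?addn0 // addnS (le_trans IH).
have bm i j : (i <= j)%N -> b j <= b i.
  by move=> /subnKC <-; elim: (j - i)%N => [|n IH]; rewrite ?addn0 // addnS (le_trans _ IH).
have ab i j : a i <= b j.
  apply: le_trans (am _ _ (leq_maxl i j)) _; apply: le_trans (hab _) _.
  exact: bm _ _ (leq_maxr i j).
have hs : has_sup (range a).
  by split; [exists (a 0%N), 0%N|exists (b 0%N) => _ [i _ <-]].
exists (sup (range a)) => k; apply/andP; split.
  by apply: sup_upper_bound => //; exists k.
by apply: sup_le_ub; [case: hs|move=> _ [i _ <-]].
Qed.

Lemma pow2_small (x d : R) : 0 < d -> exists k, x / 2 ^+ k < d.
Proof.
move=> d0; exists (Num.truncn (x / d)).+1; set n := (Num.truncn _).+1.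
have h : x / d < n%:R by exact: truncnS_gt.
rewrite ltr_pdivrMr ?exprn_gt0 //; rewrite ltr_pdivrMr // in h.
apply: lt_trans h _; rewrite mulrC ltr_pM2l // -natrX ltr_nat; exact: ltn_expl.
Qed.

(** Differentiability with error constant 1 gives continuity: |X| <= 2 M (|x| + |y|), and both |x|
    and |y| are below e / (4 M). *)
Lemma lin_small (u v M x y X e : R) : 1 <= M -> `|u| <= M -> `|v| <= M ->
  `|x| * (4 * M) < e -> `|y| * (4 * M) < e ->
  `|X - (u * x + v * y)| <= 1 * (`|x| + `|y|) -> `|X| < e.
Proof.
move=> M1 uM vM xe ye hX; rewrite -(subrK (u * x + v * y) X).
apply: le_lt_trans (ler_normD _ _) _.
have hx : `|u| * `|x| <= M * `|x| by rewrite ler_wpM2r.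
have hy : `|v| * `|y| <= M * `|y| by rewrite ler_wpM2r.
have xM : `|x| <= `|x| * M by rewrite ler_peMr.
have yM : `|y| <= `|y| * M by rewrite ler_peMr.
have h := ler_normD (u * x) (v * y); rewrite !normrM in h.
rewrite (mulrC M) in hx; rewrite (mulrC M) in hy.
rewrite mulrCA in xe; rewrite mulrCA in ye.
lra.
Qed.

Lemma quarter_norm (a b c d : R) : [\/ `|a + b + c + d| <= 4 * `|a|,
  `|a + b + c + d| <= 4 * `|b|, `|a + b + c + d| <= 4 * `|c| |
  `|a + b + c + d| <= 4 * `|d|].
Proof.
have n3 := ler_normD (a + b + c) d.
have n2 := ler_normD (a + b) c; have n1 := ler_normD a b.
have [h1|h1] := leP (`|a + b + c + d|) (4 * `|a|); first exact: Or41.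
have [h2|h2] := leP (`|a + b + c + d|) (4 * `|b|); first exact: Or42.
have [h3|h3] := leP (`|a + b + c + d|) (4 * `|c|); first exact: Or43.
by apply: Or44; lra.
Qed.

Variables (P Q : R -> R -> R) (S0 : R).
(* Differentiability of (P, Q) with the Cauchy-Riemann relation Q_t = P_s; the
   differential form P dt - Q ds is then closed. *)
Hypothesis dPQ : forall s t, s < S0 -> exists a b c, forall e, 0 < e ->
  exists2 d, 0 < d & forall s' t', `|s' - s| < d -> `|t' - t| < d ->
    `|P s' t' - P s t - (a * (s' - s) + b * (t' - t))| <= e * (`|s' - s| + `|t' - t|) /\
    `|Q s' t' - Q s t - (c * (s' - s) + a * (t' - t))| <= e * (`|s' - s| + `|t' - t|).

Let contPQ s t : s < S0 -> forall e, 0 < e -> exists2 d, 0 < d &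
  forall s' t', `|s' - s| < d -> `|t' - t| < d ->
    `|P s' t' - P s t| < e /\ `|Q s' t' - Q s t| < e.
Proof.
move=> sS e e0; have [a [b [c h]]] := dPQ t sS.
have [d d0 hd] := h _ ltr01.
have [M [M1 aM bM cM]] : exists M, [/\ 1 <= M, `|a| <= M, `|b| <= M & `|c| <= M].
  exists (`|a| + `|b| + `|c| + 1); have := normr_ge0 a; have := normr_ge0 b.
  by have := normr_ge0 c; clear => h1 h2 h3; split; lra.
have M0 : 0 < M by apply: lt_le_trans M1.
exists (Num.min d (e / (4 * M))); first by rewrite lt_min d0 divr_gt0 // mulr_gt0.
move=> s' t'; rewrite !lt_min => /andP[s1 s2] /andP[t1 t2].
have [h1 h2] := hd _ _ s1 t1.
rewrite ltr_pdivlMr ?mulr_gt0 // in s2; rewrite ltr_pdivlMr ?mulr_gt0 // in t2.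
by split; [apply: (lin_small M1 aM bM s2 t2)|apply: (lin_small M1 cM aM s2 t2)].
Qed.

Let cPt s t : s < S0 -> P s @ t --> P s t.
Proof.
move=> sS; apply/contP => e e0; have [d d0 hd] := contPQ t sS e0.
by exists d => // t' tt'; have [] := hd s t' _ tt'; rewrite ?subrr ?normr0.
Qed.

Let cQs s t : s < S0 -> Q^~ t @ s --> Q s t.
Proof.
move=> sS; apply/contP => e e0; have [d d0 hd] := contPQ t sS e0.
by exists d => // s' ss'; have [] := hd s' t ss' _; rewrite ?subrr ?normr0.
Qed.

(** Formally the integral of P_s - Q_t over the rectangle, expressed by its four sides because the
    partial derivatives need not be integrable. *)
Definition rect_int s t sg tau := seg (P (s + sg)) t tau - seg (P s) t tau
  - (seg (Q^~ (t + tau)) s sg - seg (Q^~ t) s sg).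

Let I_split s t sg tau : 0 <= sg -> 0 <= tau -> s + (sg + sg) < S0 ->
  rect_int s t (sg + sg) (tau + tau) = rect_int s t sg tau + rect_int (s + sg) t sg tau
    + rect_int s (t + tau) sg tau + rect_int (s + sg) (t + tau) sg tau.
Proof.
move=> sg0 tau0 sS; rewrite /rect_int.
rewrite !(@segD _ t tau tau) //; try by move=> x _; apply: cPt; lra.
rewrite !(@segD _ s sg sg) //; try by move=> x hx; apply: cQs; lra.
rewrite !addrA.
move: (seg _ _ _) (seg _ _ _) (seg _ _ _) (seg _ _ _) (seg _ _ _) (seg _ _ _).
move: (seg _ _ _) (seg _ _ _) (seg _ _ _) (seg _ _ _) (seg _ _ _) (seg _ _ _) => *; ring.
Qed.

(** Both pairs of opposite sides have the same linear part [a * sg * tau], which cancels because P_s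
    = Q_t. What remains is the differentiability error times the squared half-perimeter. *)
Let I_small s0 t0 : s0 < S0 -> forall e, 0 < e -> exists2 d, 0 < d &
  forall s t sg tau, 0 <= sg < d -> 0 <= tau < d -> s + sg < S0 ->
    s <= s0 <= s + sg -> t <= t0 <= t + tau ->
    `|rect_int s t sg tau| <= e * (sg + tau) ^+ 2.
Proof.
move=> sS e e0; have [a [b [c h]]] := dPQ t0 sS.
have e2 : 0 < e / 2 by rewrite divr_gt0.
have [d d0 hd] := h _ e2; exists d => // s t sg tau /andP[sg0 sgd] /andP[tau0 taud] sgS.
move=> /andP[ss0 s0s] /andP[tt0 t0t].
have near u v : s <= u <= s + sg -> t <= v <= t + tau ->
    `|P u v - P s0 t0 - (a * (u - s0) + b * (v - t0))| <= e / 2 * (sg + tau) /\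
    `|Q u v - Q s0 t0 - (c * (u - s0) + a * (v - t0))| <= e / 2 * (sg + tau).
  move=> hu hv.
  have u1 : `|u - s0| <= sg by rewrite ler_norml; lra.
  have v1 : `|v - t0| <= tau by rewrite ler_norml; lra.
  have [||h1 h2] := hd u v; [by apply: le_lt_trans sgd|by apply: le_lt_trans taud|].
  by split; [apply: le_trans h1 _|apply: le_trans h2 _]; rewrite ler_pM2l // lerD.
have hP : `|seg (P (s + sg)) t tau - seg (P s) t tau - a * sg * tau| <= e * (sg + tau) * tau.
  apply: seg_bound => // x hx; [by apply: cPt; lra|by apply: cPt; lra|].
  have [||+ _] := near (s + sg) x; [by lra|by lra|].
  have [||+ _] := near s x; [by lra|by lra|].
  by rewrite !ler_norml; lra.
have hQ : `|seg (Q^~ (t + tau)) s sg - seg (Q^~ t) s sg - a * tau * sg| <= e * (sg + tau) * sg.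
  apply: seg_bound => // x hx; [by apply: cQs; lra|by apply: cQs; lra|].
  have [||_] := near x (t + tau); [by lra|by lra|].
  have [||_] := near x t; [by lra|by lra|].
  by rewrite !ler_norml; lra.
move: hP hQ; rewrite /rect_int.
move: (seg _ _ _) (seg _ _ _) (seg _ _ _) (seg _ _ _) => A1 A2 A3 A4.
by clear => hP hQ; rewrite ler_norml; move: hP hQ; rewrite !ler_norml; lra.
Qed.

(** If [rect_int] is nonzero, some quarter of each rectangle carries at least a quarter of its
    value. The nested quarters shrink to a point, where [I_small] makes them too small. *)
Lemma goursat_rect s t sg tau : 0 <= sg -> 0 <= tau -> s + sg < S0 ->
  seg (P (s + sg)) t tau - seg (P s) t tau =
  seg (Q^~ (t + tau)) s sg - seg (Q^~ t) s sg.
Proof.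
move=> sg0 tau0 sS; apply/eqP; rewrite -subr_eq0 -/(rect_int s t sg tau); apply: contrapT => /negP I0.
have eta0 : 0 < `|rect_int s t sg tau| by rewrite normr_gt0.
set eta := `|rect_int s t sg tau| in eta0.
pose sk k : R := sg / 2 ^+ k; pose tk k : R := tau / 2 ^+ k.
have skS k : sk k = sk k.+1 + sk k.+1.
  by rewrite /sk exprS; field; rewrite expf_neq0.
have tkS k : tk k = tk k.+1 + tk k.+1.
  by rewrite /tk exprS; field; rewrite expf_neq0.
have sk0 k : 0 <= sk k by rewrite divr_ge0 // exprn_ge0.
have tk0 k : 0 <= tk k by rewrite divr_ge0 // exprn_ge0.
(* The bound by [S0] is a premise inside the existential so that [choice] returns a total function;
   [(0, 0)] is the junk value where it fails. *)
have step (x : nat * (R * R)) : exists y : R * R, x.2.1 + sk x.1 < S0 ->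
   [/\ x.2.1 <= y.1, y.1 + sk x.1.+1 <= x.2.1 + sk x.1, x.2.2 <= y.2,
       y.2 + tk x.1.+1 <= x.2.2 + tk x.1 &
       `|rect_int x.2.1 x.2.2 (sk x.1) (tk x.1)| <= 4 * `|rect_int y.1 y.2 (sk x.1.+1) (tk x.1.+1)|].
  case: x => k [u v] /=; have := sk0 k.+1; have := tk0 k.+1 => t0 s0.
  have [hS|hS] := ltP (u + sk k) S0; last by exists (0, 0).
  have Isum : rect_int u v (sk k) (tk k) = rect_int u v (sk k.+1) (tk k.+1) +
      rect_int (u + sk k.+1) v (sk k.+1) (tk k.+1) +
      rect_int u (v + tk k.+1) (sk k.+1) (tk k.+1) +
      rect_int (u + sk k.+1) (v + tk k.+1) (sk k.+1) (tk k.+1).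
    by rewrite {1}skS {1}tkS I_split // -skS.
  have sh := skS k; have th := tkS k.
  have := quarter_norm (rect_int u v (sk k.+1) (tk k.+1))
      (rect_int (u + sk k.+1) v (sk k.+1) (tk k.+1))
      (rect_int u (v + tk k.+1) (sk k.+1) (tk k.+1))
      (rect_int (u + sk k.+1) (v + tk k.+1) (sk k.+1) (tk k.+1)).
  rewrite -Isum; case=> h.
  - by exists (u, v) => _; split; last exact: h; clear - sh th t0 s0; rewrite /=; lra.
  - by exists (u + sk k.+1, v) => _; split; last exact: h; clear - sh th t0 s0; rewrite /=; lra.
  - by exists (u, v + tk k.+1) => _; split; last exact: h; clear - sh th t0 s0; rewrite /=; lra.
  - by exists (u + sk k.+1, v + tk k.+1) => _; split; last exact: h; clear - sh th t0 s0; rewrite /=; lra.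
have [f hf] := choice step.
pose x := fix x n := if n is n'.+1 then f (n', x n') else (s, t).
have inv k : (x k).1 + sk k <= s + sg /\ eta <= 4 ^+ k * `|rect_int (x k).1 (x k).2 (sk k) (tk k)|.
  elim: k => [|k [IH1 IH2]]; first by rewrite /= /sk /tk expr0 !divr1 mul1r lexx.
  have [|_ h2 _ _ h5] := hf (k, x k); first by apply: le_lt_trans sS.
  split; first by apply: le_trans h2 IH1.
  apply: le_trans IH2 _; rewrite exprS -mulrA mulrCA ler_pM2l ?exprn_gt0 //.
have st k := hf (k, x k) (le_lt_trans (inv k).1 sS).
have [s0 hs0] : exists x0, forall k, (x k).1 <= x0 <= (x k).1 + sk k.
  apply: nested_point => k; first by case: (st k).
    by case: (st k).
  by rewrite lerDl.
have [t0 ht0] : exists x0, forall k, (x k).2 <= x0 <= (x k).2 + tk k.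
  apply: nested_point => k; first by case: (st k).
    by case: (st k).
  by rewrite lerDl.
have s0S : s0 < S0.
  by apply: le_lt_trans sS; have /andP[_] := hs0 0%N; rewrite /= /sk expr0 divr1.
(* At level k the factors 4^k cancel and leave eta * W / (2 (W + 1)) < eta with W = (sg + tau)^2;
   the 1 covers W = 0. *)
have [|d d0 hd] := I_small t0 s0S (e := eta / (2 * ((sg + tau) ^+ 2 + 1))).
  by rewrite divr_gt0 // mulr_gt0 // ltr_wpDl ?sqr_ge0.
have [k hk] := pow2_small (sg + tau) d0.
have kk : (0 : R) < 2 ^+ k by rewrite exprn_gt0.
have skd : sk k < d.
  by apply: le_lt_trans hk; rewrite /sk ler_pM2r ?invr_gt0 // lerDl.
have tkd : tk k < d.
  by apply: le_lt_trans hk; rewrite /tk ler_pM2r ?invr_gt0 // lerDr.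
have := hd (x k).1 (x k).2 (sk k) (tk k).
rewrite sk0 skd tk0 tkd hs0 ht0 => /(_ isT isT _ isT isT).
have [i1 i2] := inv k; move=> /(_ (le_lt_trans i1 sS)) hI.
have : eta <= 4 ^+ k * (eta / (2 * ((sg + tau) ^+ 2 + 1)) * (sk k + tk k) ^+ 2).
  by apply: le_trans i2 _; rewrite ler_pM2l ?exprn_gt0.
have -> : 4 ^+ k * (eta / (2 * ((sg + tau) ^+ 2 + 1)) * (sk k + tk k) ^+ 2) =
   eta * ((sg + tau) ^+ 2 / (2 * ((sg + tau) ^+ 2 + 1))).
  have -> : sk k + tk k = (sg + tau) / 2 ^+ k by rewrite /sk /tk mulrDl.
  have -> : 4 ^+ k = (2 ^+ k) ^+ 2 :> R by rewrite -exprM mulnC exprM expr2 -natrM.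
  rewrite expr_div_n; move: ((sg + tau) ^+ 2) (sqr_ge0 (sg + tau)) (2 ^+ k) kk.
  clear => W W0 T T0; field.
  by apply/andP; split; rewrite gt_eqF //; lra.
have S2 := sqr_ge0 (sg + tau).
have : (sg + tau) ^+ 2 / (2 * ((sg + tau) ^+ 2 + 1)) < 1.
  by rewrite ltr_pdivrMr; lra.
by move=> h1; rewrite leNgt => /negP; apply; rewrite gtr_pMr.
Qed.

End Goursat.

(** * Holomorphic functions *)

Section Holomorphic.
Variable R : realType.
Local Notation C := (Rcomplex R).
Implicit Types (h : C -> C) (z w : C).

(** The plane is normed over the reals here, so complex differentiability is stated as approximation
    by a complex multiplication. *)
Definition cderivable h z := exists d : C, forall e, 0 < e -> exists2 dl, 0 < dl &
  forall w, `|w - z| < dl -> `|h w - h z - (d * (w - z) : C)| <= e * `|w - z|.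

Lemma cderivable_cont h z : cderivable h z -> h @ z --> h z.
Proof.
move=> [d hd]; apply/contP => e e0; have [dl dl0 h1] := hd _ ltr01.
have K0 : 0 < `|d| + 1 by rewrite ltr_wpDl.
exists (Num.min dl (e / (`|d| + 1))); first by rewrite lt_min dl0 divr_gt0.
move=> w; rewrite lt_min => /andP[/h1 w1 w2]; rewrite ltr_pdivlMr // in w2.
rewrite -(subrK (d * (w - z) : C) (h w - h z)).
apply: le_lt_trans (ler_normD _ _) _; rewrite normCM.
rewrite mul1r in w1; apply: le_lt_trans w2.
by rewrite [leRHS]mulrDr [X in _ <= _ + X]mulr1 addrC (mulrC `|d|) lerD.
Qed.

Lemma cderivable_mulr h z (k : C) : cderivable h z -> cderivable (fun w => (k * h w : C)) z.
Proof.
move=> [d hd]; exists (k * d : C) => e e0.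
have K0 : 0 < `|k| + 1 by rewrite ltr_wpDl.
have [|dl dl0 h1] := hd (e / (`|k| + 1)); first by rewrite divr_gt0.
exists dl => // w /h1 w1.
have -> : (k * h w : C) - (k * h z : C) - ((k * d : C) * (w - z) : C)
   = (k * (h w - h z - (d * (w - z) : C)) : C).
  by ring.
rewrite normCM; apply: le_trans (ler_wpM2l (normr_ge0 _) w1) _.
rewrite mulrA ler_wpM2r // mulrA ler_pdivrMr // mulrC ler_pM2l // lerDl //.
Qed.

Lemma deriv_small (f : R -> R) (x l : R) : is_derive x 1 f l ->
  forall e, 0 < e -> exists2 d, 0 < d & forall y, `|y| < d -> `|f (x + y) - f x - l * y| <= e * `|y|.
Proof.
move=> [df fl] e e0.
have H : h^-1 *: (f (h *: 1 + x) - f x) @[h --> (0 : R)^'] --> l by rewrite -fl.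
move/cvgrPdist_le: H => /(_ e e0).
move=> /near_normP [d d0 hd]; exists d => // y yd.
have [->|y0] := eqVneq y 0; first by rewrite addr0 subrr mulr0 subrr normr0 mulr0.
have := hd y; rewrite subr0 => /(_ yd y0); rewrite -[y *: 1]/(y * 1) mulr1 => h1.
rewrite (addrC x) distrC.
have -> : l * y - (f (y + x) - f x) = (l - y^-1 *: (f (y + x) - f x)) * y.
  by rewrite mulrBl -[_ *: _]/(_ * _) mulrAC mulVf ?mul1r.
by rewrite normrM ler_wpM2r.
Qed.

(** This is differentiability of z0 + exp (s + i t). The error is exp (s + i t) times exp (x + i y)
    - 1 - (x + i y), so only the derivatives of [expR], [sin] and [cos] at 0 enter. *)
Lemma polar_small (s t : R) (z0 : C) : forall e, 0 < e -> exists2 d, 0 < d &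
  forall s' t', `|s' - s| < d -> `|t' - t| < d ->
  `|circle_pt z0 (expR s') t' - circle_pt z0 (expR s) t -
     (circle_pt 0 (expR s) t * ((s' - s) +i* (t' - t))%C : C)|
  <= e * (`|s' - s| + `|t' - t|).
Proof.
move=> e e0; have M0 := expR_gt0 s.
(* The real part costs e1 (|x| + 2 |y|) and the imaginary part 3 e1 |y|, hence 5; the cap 1 gives
   |expR x| <= 2. *)
pose e1 := Num.min (e / (5 * expR s)) 1.
have e10 : 0 < e1 by rewrite lt_min ltr01 divr_gt0 // mulr_gt0.
have e1e : expR s * (5 * e1) <= e.
  rewrite mulrCA mulrA mulrC -ler_pdivlMr ?mulr_gt0 // ge_min lexx //.
have e11 : e1 <= 1 by rewrite ge_min lexx orbT.
have [d1 d10 h1] := deriv_small (is_derive_expR 0) e10.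
have [d2 d20 h2] := deriv_small (is_derive_sin 0) e10.
have [d3 d30 h3] := deriv_small (is_derive_cos 0) e10.
exists (Num.min (Num.min d1 d2) (Num.min d3 (e1 / 2))).
  by rewrite !lt_min d10 d20 d30 divr_gt0.
move=> s' t'; have [x xE] : exists x, x = s' - s by exists (s' - s).
have [y yE] : exists y, y = t' - t by exists (t' - t).
rewrite -xE -yE !lt_min.
move=> /andP[/andP[x1 x2] /andP[x3 x4]] /andP[/andP[y1 y2] /andP[y3 y4]].
have := h1 _ x1; rewrite add0r expR0 mul1r => ex.
have := h2 _ y2; rewrite add0r sin0 cos0 mul1r subr0 => sy.
have := h3 _ y3; rewrite add0r sin0 cos0 oppr0 mul0r subr0 => cy.
have -> : circle_pt z0 (expR s') t' - circle_pt z0 (expR s) t -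
     (circle_pt 0 (expR s) t * (x +i* y)%C : C) =
   (circle_pt 0 (expR s) t * ((expR x * cos y - 1 - x) +i* (expR x * sin y - y))%C : C).
  have -> : s' = s + x by rewrite xE; ring.
  have -> : t' = t + y by rewrite yE; ring.
  apply: complexP; rewrite !(ReImE, circE) /= expRD ?cosD ?sinD; ring.
rewrite normCM norm_circle0 (gtr0_norm M0).
apply: le_trans (_ : expR s * (5 * e1 * (`|x| + `|y|)) <= _); last first.
  by rewrite mulrA ler_wpM2r ?addr_ge0.
rewrite ler_pM2l //; apply: le_trans (norm_le_ReIm _) _ => /=.
have bex : `|expR x - 1| <= e1.
  have := ler_normD (expR x - 1 - x) x; rewrite subrK => h.
  have : e1 * `|x| <= `|x| by rewrite ler_piMl.
  lra.
have bex2 : `|expR x| <= 2.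
  have := ler_normD (expR x - 1) 1; rewrite subrK normr1; lra.
have -> : expR x * cos y - 1 - x = (expR x - 1 - x) + expR x * (cos y - 1) by ring.
have -> : expR x * sin y - y = expR x * (sin y - y) + (expR x - 1) * y by ring.
have n1 := ler_normD (expR x - 1 - x) (expR x * (cos y - 1)).
have n2 := ler_normD (expR x * (sin y - y)) ((expR x - 1) * y).
rewrite !normrM in n1 n2.
have p1 : `|expR x| * `|cos y - 1| <= 2 * (e1 * `|y|) by apply: ler_pM.
have p2 : `|expR x| * `|sin y - y| <= 2 * (e1 * `|y|) by apply: ler_pM.
have p3 : `|expR x - 1| * `|y| <= e1 * `|y| by rewrite ler_wpM2r.
have q1 : 0 <= e1 * `|x| by rewrite mulr_ge0 // ltW.
rewrite [leRHS]mulrDr -!(mulrA 5); move: (e1 * `|x|) (e1 * `|y|) ex p1 p2 p3 q1 n1 n2.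
move=> A B; clear; lra.
Qed.

Lemma polar_cderivable h (z0 : C) (s t : R) : cderivable h (circle_pt z0 (expR s) t) ->
  exists D : C, forall e, 0 < e -> exists2 d, 0 < d &
  forall s' t', `|s' - s| < d -> `|t' - t| < d ->
  `|h (circle_pt z0 (expR s') t') - h (circle_pt z0 (expR s) t) -
     (D * ((s' - s) +i* (t' - t))%C : C)|
  <= e * (`|s' - s| + `|t' - t|).
Proof.
move=> [d hd]; exists (d * circle_pt 0 (expR s) t : C) => e e0.
pose M := expR s + 1; have M0 : 0 < M by rewrite /M addr_gt0 ?expR_gt0.
pose K := `|d| + 1; have K0 : 0 < K by rewrite /K ltr_wpDl.
have [|d1 d10 h1] := hd (e / (2 * M)); first by rewrite divr_gt0 // mulr_gt0.
pose e2 := Num.min (e / (2 * K)) 1.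
have e20 : 0 < e2 by rewrite lt_min ltr01 divr_gt0 // mulr_gt0.
have [d2 d20 h2] := polar_small s t z0 e20.
have dM : 0 < d1 / (2 * M) by rewrite divr_gt0 // mulr_gt0.
exists (Num.min d2 (d1 / (2 * M))); first by rewrite lt_min d20.
move=> s' t'; rewrite !lt_min => /andP[s2 s3] /andP[t2 t3].
have := h2 _ _ s2 t2.
set w := circle_pt z0 _ t'; set z := circle_pt z0 _ t.
set x := s' - s in s3 *; set y := t' - t in t3 *; set n := `|x| + `|y|.
have n0 : 0 <= n by rewrite addr_ge0.
set E := circle_pt 0 _ t => hw.
have nxy : `|(x +i* y)%C : C| <= n by apply: le_trans (norm_le_ReIm _) _.
have wz : `|w - z| <= M * n.
  rewrite -(subrK (E * (x +i* y)%C : C) (w - z)).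
  apply: le_trans (ler_normD _ _) _; rewrite normCM norm_circle0 gtr0_norm ?expR_gt0 //.
  rewrite addrC [leRHS]mulrDl; apply: lerD; first by rewrite ler_pM2l ?expR_gt0.
  by apply: le_trans hw _; rewrite ler_wpM2r // ge_min lexx orbT.
have wzd : `|w - z| < d1.
  apply: le_lt_trans wz _; rewrite ltr_pdivlMr ?mulr_gt0 // in s3.
  rewrite ltr_pdivlMr ?mulr_gt0 // in t3; rewrite /n; clear - s3 t3; lra.
have hz := h1 _ wzd.
have -> : h w - h z - ((d * E : C) * (x +i* y)%C : C) =
  (h w - h z - (d * (w - z) : C)) + (d * (w - z - (E * (x +i* y)%C : C)) : C).
  by rewrite [X in _ = _ + X]mulrBr mulrA addrA subrK.
apply: le_trans (ler_normD _ _) _; rewrite normCM.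
have a1 : e / (2 * M) * `|w - z| <= e / 2 * n.
  apply: le_trans (_ : e / (2 * M) * (M * n) <= _).
    by rewrite ler_pM2l // divr_gt0 // mulr_gt0.
  rewrite le_eqVlt; apply/orP; left; apply/eqP; field; rewrite gt_eqF //.
have a2 : `|d| * `|w - z - (E * (x +i* y)%C : C)| <= e / 2 * n.
  apply: le_trans (_ : K * (e2 * n) <= _).
    by apply: ler_pM => //; rewrite /K lerDl.
  rewrite mulrA ler_wpM2r //.
  apply: le_trans (_ : K * (e / (2 * K)) <= _).
    by rewrite ler_pM2l // ge_min lexx.
  rewrite le_eqVlt; apply/orP; left; apply/eqP; field; rewrite gt_eqF //.
lra.
Qed.

Lemma cont_circle_bmf (f : C -> R) (z : C) (r : R) :
  (forall t, f @ circle_pt z r t --> f (circle_pt z r t)) ->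
  bounded_mfun (fun t => f (circle_pt z r t)).
Proof.
move=> cf.
have cg : continuous (fun t => f (circle_pt z r t)).
  move=> t; apply: (@continuous_comp _ _ _ (circle_pt z r) f); first exact: cont_circle.
  exact: cf.
apply: cont_bmf => //.
have cnf : continuous (fun t => `|f (circle_pt z r t)|) by move=> t; apply: cvg_norm; exact: cg.
have [x _ xmax] := EVT_max (ltW (twopi_gt0 R)) (continuous_subspaceT cnf).
exists `|f (circle_pt z r x)| => t.
have fp u : f (circle_pt z r (u + 2 * pi)) = f (circle_pt z r u) by rewrite circle_per.
have [t' t'p ->] := periodic_repr (twopi_gt0 R) fp t.
by apply: xmax; rewrite in_itv.
Qed.

(* In log-polar coordinates z0 + e^(s + it), the real part P and the imaginary
   part Q satisfy Q_t = P_s; Goursat's argument on [s1, s2] x [0, 2 pi] and the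
   periodicity of Q show that the circular mean of P does not depend on s. *)
Lemma cmean_holo_Re h (z0 : C) (r0 r : R) : (forall z, `|z - z0| < r0 -> cderivable h z) ->
  0 < r < r0 -> cmean (fun t => complex.Re (h (circle_pt z0 r t))) = complex.Re (h z0).
Proof.
move=> dh /andP[rpos rr0]; have r00 : 0 < r0 by apply: lt_trans rr0.
have cRh z : `|z - z0| < r0 -> (fun w => complex.Re (h w)) @ z --> complex.Re (h z).
  move=> /dh/cderivable_cont ch.
  by apply: (@continuous_comp _ _ _ h (@complex.Re R : C -> R)); [exact: ch|exact: cont_Re].
have bmfr r1 : 0 < r1 < r0 -> bounded_mfun (fun t => complex.Re (h (circle_pt z0 r1 t))).
  move=> /andP[r10 r1r]; apply: (@cont_circle_bmf (fun w => complex.Re (h w))) => t.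
  by apply: cRh; rewrite norm_circle gtr0_norm.
have eqr r1 : 0 < r1 < r -> cmean (fun t => complex.Re (h (circle_pt z0 r1 t))) =
    cmean (fun t => complex.Re (h (circle_pt z0 r t))).
  move=> /andP[r10 r1r].
  pose P s t := complex.Re (h (circle_pt z0 (expR s) t)).
  pose Q s t := complex.Im (h (circle_pt z0 (expR s) t)).
  have dPQ : forall s t, s < ln r0 -> exists a b c, forall e, 0 < e ->
    exists2 d, 0 < d & forall s' t', `|s' - s| < d -> `|t' - t| < d ->
      `|P s' t' - P s t - (a * (s' - s) + b * (t' - t))| <= e * (`|s' - s| + `|t' - t|) /\
      `|Q s' t' - Q s t - (c * (s' - s) + a * (t' - t))| <= e * (`|s' - s| + `|t' - t|).
    move=> s t sr.
    have [|D hD] := @polar_cderivable h z0 s t.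
      apply: dh; rewrite norm_circle gtr0_norm ?expR_gt0 //.
      by rewrite -[r0]lnK ?posrE // ltr_expR.
    (* Cauchy-Riemann in s + i t: P_s = Q_t = Re D, P_t = - Im D, Q_s = Im D. *)
    exists (complex.Re D), (- complex.Im D), (complex.Im D) => e e0.
    have [d d0 hd] := hD _ e0; exists d => // s' t' ss tt.
    have := hd _ _ ss tt => hd'; split.
      apply: le_trans hd'; apply: le_trans (normRe _).
      by rewrite !ReImE /= mulNr.
    apply: le_trans hd'; apply: le_trans (normIm _).
    by rewrite !ReImE /= addrC; rewrite le_eqVlt; apply/orP; left; apply/eqP; congr `|_|; ring.
  have := goursat_rect dPQ 0 (s := ln r1) (sg := ln r - ln r1) (tau := 2 * pi).
  rewrite subr_ge0 ler_ln ?posrE // (ltW r1r) (ltW (twopi_gt0 R)) (addrC (ln r1)) subrK.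
  rewrite ltr_ln ?posrE // rr0 => /(_ isT isT isT).
  (* The sides t = 0 and t = 2 pi lie on the same ray, so the two integrals of Q cancel. *)
  have -> : Q^~ (0 + 2 * pi) = Q^~ 0 by apply/funext => s; rewrite /Q circle_per.
  rewrite subrr => /eqP; rewrite subr_eq0 => /eqP.
  by rewrite /seg /P !lnK ?posrE // /cmean add0r => ->.
(* The mean being independent of the radius, it is compared with the central value on a circle so
   small that Re h varies by less than e. *)
apply/eqP; rewrite -subr_eq0 -normr_le0; apply/ler_addgt0Pr => e e0; rewrite add0r.
have cz0 : (fun w => complex.Re (h w)) @ z0 --> complex.Re (h z0) by apply: cRh; rewrite subrr normr0.
have [d d0 hd] := (contP _ _).1 cz0 e e0.
pose r1 := Num.min d r / 2.
have m0 : 0 < Num.min d r by rewrite lt_min d0.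
have r10 : 0 < r1 by rewrite /r1 divr_gt0.
have : r1 < Num.min d r by rewrite /r1; lra.
rewrite lt_min => /andP[r1d r1r].
have b1 : bounded_mfun (fun t => complex.Re (h (circle_pt z0 r1 t))) by apply: bmfr; rewrite r10 (lt_trans r1r).
rewrite -(eqr r1) ?r10 // ler_norml; apply/andP; split.
  rewrite lerBrDl -(cmean_cst (complex.Re (h z0) + - e)).
  apply: le_cmean => //; first exact: bmf_cst.
  move=> t; have := hd (circle_pt z0 r1 t); rewrite norm_circle gtr0_norm // => /(_ r1d).
  by rewrite ltr_norml; lra.
rewrite lerBlDl -(cmean_cst (complex.Re (h z0) + e)).
apply: le_cmean => //; first exact: bmf_cst.
move=> t; have := hd (circle_pt z0 r1 t); rewrite norm_circle gtr0_norm // => /(_ r1d).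
by rewrite ltr_norml; lra.
Qed.

Lemma cmean_holo_Im h (z0 : C) (r0 r : R) : (forall z, `|z - z0| < r0 -> cderivable h z) ->
  0 < r < r0 -> cmean (fun t => complex.Im (h (circle_pt z0 r t))) = complex.Im (h z0).
Proof.
move=> dh rr.
have := @cmean_holo_Re (fun w => ((0 +i* (-1))%C * h w : C)) z0 r0 r _ rr.
rewrite !ReImE /= mul0r mulN1r sub0r opprK => <-.
  by apply: eq_cmean => t; rewrite !ReImE /= mul0r mulN1r sub0r opprK.
by move=> z /dh; exact: cderivable_mulr.
Qed.

End Holomorphic.

(** * Subharmonic functions *)

Section Clip.
Variable R : realType.
Local Notation C := (Rcomplex R).
Local Notation mu := (@lebesgue_measure R).
Local Notation I2pi := (`[0, 2 * pi]%classic : set R).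
Local Open Scope ereal_scope.
Implicit Types (m c : R) (x y : \bar R).

(** Clamping to [-m, 0] gives a bounded real for every extended [x]; for m >= 0 and x <= 0 it is
    max(x, -m). *)
Definition clip m x : R :=
  match x with
  | EFin r => Num.min 0%R (Num.max r (- m)%R)
  | EPInf => 0%R
  | ENInf => (- m)%R
  end.

Lemma clip_ge m x : (0 <= m)%R -> (- m <= clip m x)%R.
Proof. by case: x => [r| |] /= m0; rewrite ?le_min ?le_max ?lexx ?orbT ?oppr_le0 ?m0. Qed.

Lemma clip_le0 m x : (0 <= m)%R -> (clip m x <= 0)%R.
Proof. by case: x => [r| |] /= m0; rewrite ?ge_min ?lexx ?oppr_le0. Qed.

Lemma clip_norm m x : (0 <= m)%R -> (`|clip m x| <= m)%R.
Proof.
move=> m0; rewrite ler_norml clip_ge //=.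
by apply: le_trans (clip_le0 x m0) m0.
Qed.

Lemma clip_ge_self m x : x <= 0 -> x <= (clip m x)%:E.
Proof.
case: x => [r| |] //=; rewrite ?lee_fin => r0; rewrite ?leNye //.
by rewrite le_min r0 le_max lexx.
Qed.

(** A strict sublevel set of the truncation is everything, empty, or a sublevel set of [x] itself;
    upper semicontinuity therefore passes to truncations. *)
Lemma clip_lt m x c : (0 <= m)%R ->
  (clip m x < c)%R <-> (0 < c)%R \/ ((- m < c)%R /\ x < c%:E).
Proof.
move=> m0; case: x => [r| |] /=.
- rewrite lte_fin gt_min gt_max; split.
    by case/orP => [->|/andP[-> ->]]; [left|right].
  by case=> [->//|[-> ->]]; rewrite orbT.
- by split; [left|case=> // -[]].
- rewrite ltNyr; split; first by right.
  by case=> [c0|[]//]; apply: le_lt_trans c0; rewrite oppr_le0.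
Qed.

Lemma le_clip m x y : (0 <= m)%R -> x <= y -> (clip m x <= clip m y)%R.
Proof.
move=> m0 xy; rewrite leNgt; apply/negP => /(clip_lt _ _ m0)[h|[h1 h2]].
  by have := clip_le0 x m0; rewrite leNgt h.
have /(clip_lt _ _ m0) : (0 < clip m x)%R \/ ((- m < clip m x)%R /\ x < (clip m x)%:E).
  by right; split => //; apply: le_lt_trans xy h2.
by rewrite ltxx.
Qed.

(** Upper semicontinuity of [g] is phrased as lower semicontinuity of [\- g], the form from which
    measurability follows. *)
Lemma clip_lsc m (g : R -> \bar R) : (0 <= m)%R -> lower_semicontinuous (\- g) ->
  measurable_fun setT (fun t => clip m (g t)).
Proof.
move=> m0 hg.
suff h : lower_semicontinuous (fun t => (- clip m (g t))%:E).
  have /measurable_EFinP/measurable_funN := lower_semicontinuous_measurable h.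
  by under [X in measurable_fun _ X]eq_fun do rewrite opprK.
move=> t c; rewrite lte_fin ltrNr => /(clip_lt _ _ m0)[c0|[c1 c2]].
  exists setT; first exact: filterT.
  by move=> s _; rewrite lte_fin ltrNr; apply/clip_lt => //; left.
have [|V Vt hV] := hg t c; first by rewrite lteNr -EFinN.
exists V => // s /hV; rewrite lteNr -EFinN => h.
by rewrite lte_fin ltrNr; apply/clip_lt => //; right.
Qed.

Lemma clip_bmf m (g : R -> \bar R) : (0 <= m)%R -> lower_semicontinuous (\- g) ->
  bounded_mfun (fun t => clip m (g t)).
Proof.
move=> m0 hg; split; first exact: clip_lsc.
by exists m => t; exact: clip_norm.
Qed.

Lemma bmf_integral (f : R -> R) : bounded_mfun f ->
  \int[mu]_(t in I2pi) (f t)%:E = (2 * pi * cmean f)%:E.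
Proof.
move=> hf; rewrite /cmean mulrA mulfV ?mul1r ?gt_eqF ?twopi_gt0 //.
rewrite /Rintegral fineK //; apply: integrable_fin_num => //; exact: (bmf_int _ _ _ _ hf).
Qed.

(** Turns integrals of nonpositive functions into nonnegative ones, to which monotonicity, monotone
    convergence and Fatou apply. *)
Lemma emeanN (g : R -> \bar R) : (forall t, g t <= 0) ->
  \int[mu]_(t in I2pi) g t = - \int[mu]_(t in I2pi) (- g t).
Proof.
move=> g0; rewrite -integral_ge0N.
  by apply: eq_integral => t _; rewrite oppeK.
by move=> t _; rewrite oppe_ge0.
Qed.

(** The mean of the truncation is at least that of [g], hence at least [x], and it is also at least
    -m. *)
Lemma emean_clip (g : R -> \bar R) x m : (forall t, g t <= 0) ->
  lower_semicontinuous (\- g) -> (0 <= m)%R ->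
  x <= ((2 * pi)^-1)%:E * \int[mu]_(t in I2pi) g t ->
  (clip m x <= cmean (fun t => clip m (g t)))%R.
Proof.
move=> g0 lg m0; rewrite emeanN // muleN => hx.
have bc := clip_bmf m0 lg.
have mg := lower_semicontinuous_measurable lg.
have mc : (- m <= cmean (fun t => clip m (g t)))%R.
  by rewrite -[leLHS]cmean_cst; apply: le_cmean => [|//|t]; [exact: bmf_cst|exact: clip_ge].
have hJ : (- (2 * pi * cmean (fun t => clip m (g t))))%:E <= \int[mu]_(t in I2pi) (- g t).
  rewrite EFinN -bmf_integral // emeanN; last by move=> t; rewrite lee_fin clip_le0.
  rewrite oppeK; apply: ge0_le_integral => //.
  - by move=> t _; rewrite -EFinN lee_fin oppr_ge0 clip_le0.
  - apply/measurable_EFinP; apply: measurable_funN; exact: (measurable_funTS bc.1).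
  - exact: measurable_funTS.
  - by move=> t _; rewrite -EFinN leeNr -EFinN opprK clip_ge_self.
have p0 := twopi_gt0 R.
have {hx hJ}: x <= (cmean (fun t => clip m (g t)))%:E.
  apply: le_trans hx _; rewrite leeNl.
  apply: le_trans (_ : ((2 * pi)^-1)%:E * (- (2 * pi * cmean (fun t => clip m (g t))))%:E <= _).
    by rewrite -EFinM lee_fin mulrN mulrA mulVf ?mul1r // gt_eqF.
  by rewrite lee_pmul2l // lte_fin invr_gt0.
case: x => [r| |] //=; rewrite lee_fin => h; rewrite ge_min; apply/orP; right.
by rewrite ge_max h.
Qed.

(** [- clip n g] increases to [- g] with n, so monotone convergence carries the truncated
    inequalities to [g]. *)
Lemma clip_emean (g : R -> \bar R) x : (forall t, g t <= 0) ->
  lower_semicontinuous (\- g) -> x <= 0 ->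
  (forall n : nat, (clip n%:R x <= cmean (fun t => clip n%:R (g t)))%R) ->
  x <= ((2 * pi)^-1)%:E * \int[mu]_(t in I2pi) g t.
Proof.
move=> g0 lg x0 hx; rewrite emeanN // muleN leeNr.
have p0 := twopi_gt0 R.
case: x x0 hx => [r| |] //= r0 hx; last by rewrite leey.
suff : \int[mu]_(t in I2pi) (- g t) <= (2 * pi * - r)%:E.
  move=> h; apply: le_trans (_ : ((2 * pi)^-1)%:E * (2 * pi * - r)%:E <= _).
    by rewrite lee_pmul2l // lte_fin invr_gt0.
  by rewrite -EFinM lee_fin mulrA mulVf ?mul1r // gt_eqF.
pose f n t : \bar R := (- clip n%:R (g t))%:E.
have mf n : measurable_fun I2pi (f n).
  apply/measurable_EFinP; apply: measurable_funN; apply: measurable_funTS.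
  exact: (clip_lsc _ lg).
have f0 n t : I2pi t -> 0 <= f n t by move=> _; rewrite lee_fin oppr_ge0 clip_le0.
have fnd t : I2pi t -> {homo f^~ t : n m / (n <= m)%N >-> n <= m}.
  move=> _ n k nk; rewrite lee_fin lerN2.
  case: (g t) => [s| |] //=; last by rewrite lerN2 ler_nat.
  by rewrite le_min ge_min lexx /= ge_min; apply/orP; right; rewrite ge_max !le_max lexx lerN2 ler_nat nk orbT.
have flim t : limn (f^~ t) = - g t.
  apply/cvg_lim => //; have := g0 t; case E : (g t) => [s| |] //= s0.
    apply: cvg_near_cst; exists (Num.truncn (- s)).+1 => // n /= hn.
    rewrite /f E /=; congr (- _)%:E.
    have : (- s <= n%:R)%R.
      by apply: le_trans (ltW (truncnS_gt _)) _; rewrite ler_nat.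
    rewrite lee_fin in s0; rewrite lerNl => h.
    by rewrite max_l // min_r.
  apply/cvgeyPge => A; exists (Num.truncn A).+1 => // n /= hn.
  rewrite /f E /= opprK lee_fin.
  by apply: le_trans (ltW (truncnS_gt _)) _; rewrite ler_nat.
have -> : \int[mu]_(t in I2pi) (- g t) = \int[mu]_(t in I2pi) limn (f^~ t).
  by apply: eq_integral => t _; rewrite flim.
rewrite monotone_convergence //; apply: lime_le.
  apply: ereal_nondecreasing_is_cvgn => n k nk.
  apply: ge0_le_integral; [exact: measurable_itv|exact: f0|exact: mf|exact: mf|].
  by move=> t It; exact: fnd.
apply: nearW => n; rewrite (@bmf_integral (fun t => - clip n%:R (g t))%R).
  rewrite lee_fin ler_pM2l //.
  under eq_cmean do rewrite -mulN1r.
  rewrite cmeanZ; last exact: (clip_bmf _ lg).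
  rewrite mulN1r lerN2; apply: le_trans (hx n).
  by have := @clip_ge_self n%:R r%:E r0; rewrite lee_fin.
have [h1 [M h2]] := clip_bmf (ler0n R n) lg.
by split; [exact: measurable_funN|exists M => t; rewrite normrN].
Qed.

Lemma usc_open (D : set C) (v : C -> \bar R) z c : open D -> usc_on D v ->
  D z -> v z < c%:E -> \forall y \near z, v y < c%:E.
Proof.
move=> oD [_ usc] Dz vz; have oD' : nbhs z D by apply: open_nbhs_nbhs; split.
have := usc _ _ Dz vz; rewrite near_withinE => hn.
by apply: filterS2 hn oD' => y /[apply].
Qed.

Lemma usc_circle (D : set C) (v : C -> \bar R) (a : C) (r : R) : open D ->
  usc_on D v -> (forall t, D (circle_pt a r t)) ->
  lower_semicontinuous (\- (fun t => v (circle_pt a r t))).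
Proof.
move=> oD usc hD t c; rewrite lteNr -EFinN => h.
have /cont_circle hn' := usc_open oD usc (hD t) h.
exists (circle_pt a r @^-1` [set y | v y < (- c)%:E]) => //.
by move=> s /=; rewrite lteNr -EFinN.
Qed.

Lemma subharmonic_clip (D : set C) (v : C -> \bar R) (m : R) (a : C) (r : R) :
  open D -> subharmonic D v -> (forall z, D z -> v z <= 0) -> (0 <= m)%R ->
  (0 < r)%R -> [set z | (`|z - a| <= r)%R] `<=` D ->
  bounded_mfun (fun t => clip m (v (circle_pt a r t))) /\
  (clip m (v a) <= cmean (fun t => clip m (v (circle_pt a r t))))%R.
Proof.
move=> oD [usc sub] v0 m0 r0 rD.
have hD t : D (circle_pt a r t) by apply: rD; rewrite /= norm_circle gtr0_norm.
have lg := usc_circle oD usc hD.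
split; first exact: clip_bmf.
by apply: emean_clip => //; [move=> t; apply: v0|exact: sub].
Qed.

(** Converse of [subharmonic_clip]: a nonpositive function is tested for subharmonicity on its
    integer truncations, where all means are real. *)
Lemma clip_subharmonic (D : set C) (v : C -> \bar R) :
  open D -> usc_on D v -> (forall z, D z -> v z <= 0) ->
  (forall (n : nat) a (r : R), (0 < r)%R -> [set z | (`|z - a| <= r)%R] `<=` D ->
    (clip n%:R (v a) <= cmean (fun t => clip n%:R (v (circle_pt a r t))))%R) ->
  subharmonic D v.
Proof.
move=> oD usc v0 h; split => // a r r0 rD.
have hD t : D (circle_pt a r t) by apply: rD; rewrite /= norm_circle gtr0_norm.
apply: clip_emean => //.
- by move=> t; apply: v0.
- exact: usc_circle oD usc hD.
- by apply: v0; apply: rD; rewrite /= subrr normr0 ltW.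
- by move=> n; apply: h.
Qed.

Lemma clip_usc (D : set C) (v : C -> \bar R) (m c : R) z : open D -> usc_on D v ->
  (0 <= m)%R -> D z -> (clip m (v z) < c)%R ->
  \forall y \near z, (clip m (v y) < c)%R.
Proof.
move=> oD usc m0 Dz /(clip_lt _ _ m0)[c0|[c1 c2]].
  by near=> y; apply/clip_lt => //; left.
by apply: filterS (usc_open oD usc Dz c2) => y yc; apply/clip_lt => //; right.
Unshelve. all: by end_near. Qed.

End Clip.

(** * Sup-convolution and composition with holomorphic maps *)

Section SupConvolution.
Variable R : realType.
Local Notation C := (Rcomplex R).
Implicit Types (z w x y : C).

Lemma cderivable_affine (h : C -> C) (z z0 d k : C) : cderivable h z ->
  cderivable (fun w => h w - (d * (w - z0) : C) - k) z.
Proof.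
move=> [c hc]; exists (c - d) => e e0; have [dl dl0 hd] := hc _ e0.
exists dl => // w /hd; apply: le_trans; rewrite le_eqVlt; apply/orP; left; apply/eqP.
congr (`|_|); rewrite mulrBl; ring.
Qed.

Lemma sqnormB_circle (g E : C) : `|g - E| ^+ 2 = `|g| ^+ 2 + `|E| ^+ 2
  - 2 * (complex.Re g * complex.Re E + complex.Im g * complex.Im E).
Proof. rewrite !sqnormE !ReImE; ring. Qed.

(** [V] stands for a truncated subharmonic function: bounded everywhere, upper semicontinuous and
    submean on [D]. *)
Variables (D : set C) (V : C -> R) (m M : R).
Hypothesis (Dne : D !=set0) (m0 : 0 <= m) (DM : forall z, D z -> `|z| <= M).
Hypothesis Vbnd : forall z, - m <= V z <= 0.
Hypothesis Vusc : forall z c, D z -> V z < c -> \forall y \near z, V y < c.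
Hypothesis Vsub : forall z r, 0 < r -> [set w | `|w - z| <= r] `<=` D ->
  bounded_mfun (fun t => V (circle_pt z r t)) /\ V z <= cmean (fun t => V (circle_pt z r t)).

(* Being a supremum of functions x |-> V w - n |w - x|^2, the sup-convolution is
   Lipschitz, and it decreases to V as n grows. *)
Definition supconv (n : R) (x : C) := sup [set V w - n * `|w - x| ^+ 2 | w in D].

Let has_sup_sc n x : 0 <= n -> has_sup [set V w - n * `|w - x| ^+ 2 | w in D].
Proof.
move=> n0; split; first by have [w Dw] := Dne; exists (V w - n * `|w - x| ^+ 2), w.
exists 0 => _ [w Dw <-]; have /andP[_ Vw] := Vbnd w.
by have := mulr_ge0 n0 (sqr_ge0 `|w - x|); lra.
Qed.

Let sc_ub n x w : 0 <= n -> D w -> V w - n * `|w - x| ^+ 2 <= supconv n x.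
Proof. by move=> n0 Dw; apply: sup_upper_bound; [exact: has_sup_sc|exists w]. Qed.

Let sc_le n x b : (forall w, D w -> V w - n * `|w - x| ^+ 2 <= b) -> supconv n x <= b.
Proof.
move=> hb; apply: ge_sup => [|_ [w Dw <-]]; last exact: hb.
by have [w Dw] := Dne; exists (V w - n * `|w - x| ^+ 2), w.
Qed.

Let sc_ge n x : 0 <= n -> D x -> V x <= supconv n x.
Proof. by move=> n0 Dx; have := sc_ub x n0 Dx; rewrite subrr normr0 expr0n /= mulr0 subr0. Qed.

Let sc_le0 n x : 0 <= n -> supconv n x <= 0.
Proof.
move=> n0; apply: sc_le => w Dw; have /andP[_ Vw] := Vbnd w.
by have := mulr_ge0 n0 (sqr_ge0 `|w - x|); lra.
Qed.

Let sc_lip n x y : 0 <= n ->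
  supconv n x <= supconv n y + n * (`|x - y| * (2 * M + `|x| + `|y|)).
Proof.
move=> n0; apply: sc_le => w Dw; have := sc_ub y n0 Dw.
suff : n * `|w - y| ^+ 2 - n * `|w - x| ^+ 2 <= n * (`|x - y| * (2 * M + `|x| + `|y|)) by lra.
rewrite -mulrBr ler_wpM2l // subr_sqr.
have h1 : `|w - y| - `|w - x| <= `|x - y|.
  rewrite lerBlDr -(subrKA x) addrC; exact: ler_normD.
have h2 : `|w - y| + `|w - x| <= 2 * M + `|x| + `|y|.
  have := DM Dw; have := ler_normB w y; have := ler_normB w x; lra.
apply: le_trans (_ : `|x - y| * (`|w - y| + `|w - x|) <= _).
  by rewrite ler_wpM2r ?addr_ge0.
by rewrite ler_wpM2l.
Qed.

Let sc_cont n x : 0 <= n -> supconv n @ x --> supconv n x.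
Proof.
move=> n0; apply/contP => e e0.
have M0 : 0 <= M by have [w /DM] := Dne; apply: le_trans.
pose K := n * (2 * M + 2 * `|x| + 1) + 1.
have K0 : 0 < K by rewrite /K ltr_wpDl // mulr_ge0 // !addr_ge0 ?mulr_ge0.
exists (Num.min 1 (e / K)); first by rewrite lt_min ltr01 divr_gt0.
move=> y; rewrite lt_min => /andP[y1 y2]; rewrite ltr_pdivlMr // in y2.
have yx : `|y| <= `|x| + 1.
  by rewrite -(subrK x y) addrC; apply: le_trans (ler_normD _ _) _; rewrite lerD2l ltW.
have bnd : n * (`|y - x| * (2 * M + `|y| + `|x|)) <= `|y - x| * K.
  rewrite mulrCA ler_wpM2l // /K.
  apply: le_trans (_ : n * (2 * M + 2 * `|x| + 1) <= _); last by rewrite lerDl.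
  by rewrite ler_wpM2l //; lra.
have b1 := sc_lip y x n0; have b2 := sc_lip x y n0.
rewrite distrC in b2; rewrite -addrA (addrC `|x|) addrA in b2.
by rewrite ltr_norml; lra.
Qed.

(* If w nearly attains the supremum at h z, test the supremum at h y with
   w + h'(z) (y - z), which runs over a circle about w.  The defect
   h y - h z - h'(z) (y - z) is o(r) and holomorphic, so its circular mean is 0
   and the mean of the quadratic penalty changes by o(r^2) only. *)
Lemma supconv_asub (h : C -> C) (z : C) (r0 n k : R) : 0 < n -> 0 < r0 -> 0 < k ->
  (forall y, `|y - z| < r0 -> cderivable h y) ->
  D (h z) -> (forall w, `|w - h z| < 2 * k -> D w) -> m + 1 <= n * k ^+ 2 ->
  asub (fun y => supconv n (h y)) z.
Proof.
move=> n0 r00 k0 dh Dhz hk mn e e0.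
have n0' := ltW n0.
have [d hd] : cderivable h z by apply: dh; rewrite subrr normr0.
(* The quadratic term n |ht|^2 <= n e1^2 r^2 must stay within e r^2; the cap 1 gives e1^2 <= e1. *)
pose e1 := Num.min 1 (e / n).
have e10 : 0 < e1 by rewrite lt_min ltr01 divr_gt0.
have e1e : n * e1 ^+ 2 <= e.
  rewrite mulrC -ler_pdivlMr //; apply: le_trans (_ : e1 <= _); last by rewrite ge_min lexx orbT.
  by rewrite expr2 ler_piMl ?(ltW e10) // ge_min lexx.
have [dl dl0 hdl] := hd _ e10.
have K0 : 0 < `|d| + 1 by rewrite ltr_wpDl.
exists (Num.min (Num.min dl r0) (k / (`|d| + 1))).
  by rewrite !lt_min dl0 r00 divr_gt0.
move=> r /andP[rpos]; rewrite !lt_min => /andP[/andP[rdl rr0] rk].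
rewrite ltr_pdivlMr // in rk.
have bh : bounded_mfun (fun t => supconv n (h (circle_pt z r t))).
  apply: (@cont_circle_bmf _ (fun y => supconv n (h y))) => t.
  apply: (@continuous_comp _ _ _ h (supconv n)); last exact: sc_cont.
  by apply/cderivable_cont/dh; rewrite norm_circle gtr0_norm.
split => //.
apply/ler_addgt0Pr => eta0 eta00.
pose eta := Num.min eta0 1.
have eta1 : 0 < eta by rewrite lt_min eta00 ltr01.
have [_ [w Dw <-] hw] := sup_adherent eta1 (has_sup_sc (h z) n0').
rewrite -/(supconv n (h z)) in hw.
(* Farther away the penalty n k^2 >= m + 1 would exceed the oscillation of V, at most m, plus eta <=
   1. *)
have wk : `|w - h z| < k.
  have : n * `|w - h z| ^+ 2 < n * k ^+ 2.
    have := sc_ge n0' Dhz; have /andP[+ _] := Vbnd (h z); have /andP[_] := Vbnd w.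
    have : eta <= 1 by rewrite ge_min lexx orbT.
    lra.
  by rewrite ltr_pM2l // ltr_pXn2r ?nnegrE // ltW.
pose rd := r * `|d|.
have rd0 : 0 <= rd by rewrite mulr_ge0 // ltW.
have rdk : rd < k by apply: le_lt_trans rk; rewrite /rd ler_wpM2l ?lerDl // ltW.
pose wt t := w + (d * circle_pt 0 r t : C).
have Dwt t : D (wt t).
  apply: hk; rewrite /wt addrAC; apply: le_lt_trans (ler_normD _ _) _.
  rewrite normCM norm_circle0 gtr0_norm // mulrC -/rd; lra.
have [bV lV] : bounded_mfun (fun t => V (wt t)) /\ V w <= cmean (fun t => V (wt t)).
  have [th thp dE] := polar d.
  have wtE t : wt t = circle_pt w rd (t + th).
    rewrite /wt circle_ptE; congr (_ + _); rewrite {1}dE /rd.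
    by apply: complexP; rewrite !(ReImE, circE) /= ?cosD ?sinD; ring.
  (* When d = 0 the circle about w is a point, and the submean inequality is an equality. *)
  have [rdz|rdn] := eqVneq rd 0.
    have wtw t : wt t = w.
      rewrite wtE rdz /circle_pt scale0r addr0 //.
    under [X in bounded_mfun X]eq_fun do rewrite wtw.
    by under eq_cmean do rewrite wtw; rewrite cmean_cst; split => //; exact: bmf_cst.
  have rdp : 0 < rd by rewrite lt_neqAle eq_sym rdn.
  have [|b l] := @Vsub w rd rdp.
    move=> y /= yw; apply: hk; rewrite -(subrKA w); apply: le_lt_trans (ler_normD _ _) _; lra.
  under [X in bounded_mfun X]eq_fun do rewrite wtE.
  under eq_cmean do rewrite wtE.
  split; first exact: (bmf_shift _ b).
  by rewrite (@cmean_rot _ (fun t => V (circle_pt w rd t))) // => t; rewrite circle_per.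
pose ht y := h y - (d * (y - z) : C) - h z.
have dht y : `|y - z| < r0 -> cderivable ht y by move=> /dh; exact: cderivable_affine.
have rr : 0 < r < r0 by rewrite rpos.
have mre := cmean_holo_Re dht rr; have mim := cmean_holo_Im dht rr.
have htz : ht z = 0 by rewrite /ht subrr mulr0 subr0 subrr.
rewrite htz /= in mre mim.
have cht t : ht @ circle_pt z r t --> ht (circle_pt z r t).
  by apply/cderivable_cont/dht; rewrite norm_circle gtr0_norm.
have bre : bounded_mfun (fun t => complex.Re (ht (circle_pt z r t))).
  apply: (@cont_circle_bmf _ (fun y => complex.Re (ht y))) => t.
  by apply: (@continuous_comp _ _ _ ht (@complex.Re R : C -> R)); [exact: cht|exact: cont_Re].
have bim : bounded_mfun (fun t => complex.Im (ht (circle_pt z r t))).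
  apply: (@cont_circle_bmf _ (fun y => complex.Im (ht y))) => t.
  by apply: (@continuous_comp _ _ _ ht (@complex.Im R : C -> R)); [exact: cht|exact: cont_Im].
pose g := w - h z.
pose cst1 := - (n * `|g| ^+ 2) - n * (e1 ^+ 2 * r ^+ 2).
(* The penalty n |g - ht|^2 expanded: the cross terms are kept because their mean vanishes, and
   |ht|^2 is replaced by its bound e1^2 r^2. *)
pose G t := V (wt t) + (cst1 + (2 * n * complex.Re g * complex.Re (ht (circle_pt z r t))
   + 2 * n * complex.Im g * complex.Im (ht (circle_pt z r t)))).
have b1 : bounded_mfun (fun t => 2 * n * complex.Re g * complex.Re (ht (circle_pt z r t))) by exact: bmfZ.
have b2 : bounded_mfun (fun t => 2 * n * complex.Im g * complex.Im (ht (circle_pt z r t))) by exact: bmfZ.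
have b12 := bmfD b1 b2.
have bc12 := bmfD (bmf_cst cst1) b12.
have bG : bounded_mfun G by exact: bmfD.
have mG : cmean G = cmean (fun t => V (wt t)) + cst1.
  rewrite /G cmeanD // cmeanD //; last exact: bmf_cst.
  have /= c1 := cmeanZ (2 * n * complex.Re g) bre.
  have /= c2 := cmeanZ (2 * n * complex.Im g) bim.
  have /= c12 := cmeanD b1 b2.
  by rewrite c12 c1 c2 mre mim cmean_cst !mulr0 !addr0.
have GF t : G t <= supconv n (h (circle_pt z r t)).
  apply: le_trans (sc_ub _ n0' (Dwt t)).
  have -> : wt t - h (circle_pt z r t) = g - ht (circle_pt z r t).
    rewrite /wt /g /ht [circle_pt z r t - z](_ : _ = circle_pt 0 r t).
      by ring.
    by rewrite circle_ptE addrC addKr.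
  rewrite sqnormB_circle.
  have : `|ht (circle_pt z r t)| ^+ 2 <= e1 ^+ 2 * r ^+ 2.
    rewrite -exprMn ler_pXn2r ?nnegrE ?mulr_ge0 ?(ltW e10) ?(ltW rpos) //.
    have := hdl (circle_pt z r t); rewrite norm_circle gtr0_norm // => /(_ rdl).
    by rewrite /ht addrAC.
  move=> /(ler_wpM2l n0'); rewrite /G /cst1 => hE.
  rewrite mulrBr mulrDr; move: hE.
  move: (complex.Re _) (complex.Im _) (complex.Re _) (complex.Im _) => a1 a2 a3 a4 hE.
  have -> : n * (2 * (a3 * a1 + a4 * a2)) = 2 * n * a3 * a1 + 2 * n * a4 * a2 by ring.
  move: hE; clear; lra.
have := le_cmean bG bh GF; rewrite mG => hh.
have etale : eta <= eta0 by rewrite ge_min lexx.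
have : n * (e1 ^+ 2 * r ^+ 2) <= e * r ^+ 2 by rewrite mulrA ler_wpM2r ?sqr_ge0.
rewrite /cst1 -/g in hh hw *; clear - hh hw etale lV; lra.
Qed.

Lemma supconv_cvg (x : C) : D x -> (fun n : nat => supconv n%:R x) @ \oo --> V x.
Proof.
move=> Dx; apply/cvgrPdist_le => e e0.
have [|d d0 hd] := (near_normP x _).1 (@Vusc x (V x + e) Dx _); first by rewrite ltrDl.
exists (Num.truncn (m / d ^+ 2)).+1 => // n /= hn.
have d2 : 0 < d ^+ 2 by rewrite exprn_gt0.
have nm : m <= n%:R * d ^+ 2.
  by rewrite -ler_pdivrMr //; apply: le_trans (ltW (truncnS_gt _)) _; rewrite ler_nat.
have lo := sc_ge (ler0n R n) Dx.
suff : supconv n%:R x <= V x + e by rewrite ler_norml; lra.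
apply: sc_le => w Dw; have [wd|wd] := ltP `|w - x| d.
  have := hd w wd => /=; have := mulr_ge0 (ler0n R n) (sqr_ge0 `|w - x|); lra.
have : n%:R * d ^+ 2 <= n%:R * `|w - x| ^+ 2.
  by rewrite ler_wpM2l // ler_pXn2r ?nnegrE // ltW.
have /andP[h1 _] := Vbnd x; have /andP[_ h2] := Vbnd w; lra.
Qed.

(** A Lebesgue number for the compact image of the disc inside the open set [D]. The factor 2 leaves
    room in [supconv_asub] for a near-maximizer within k of [h z] and a circle of radius below k
    about it. *)
Lemma clearance (h : C -> C) (c : C) (r : R) : open D ->
  (forall z, `|z - c| <= r -> D (h z) /\ h @ z --> h z) ->
  exists2 k, 0 < k & forall z, `|z - c| <= r -> forall w, `|w - h z| < 2 * k -> D w.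
Proof.
move=> oD hD.
have /compact_near_coveringP := @compact_disc R c r.
move=> /(_ R (0^'+) (fun k z => forall w, `|w - h z| < 2 * k -> D w) _).
case=> [z /= zr|d /= d0 hd].
  have [Dhz ch] := hD _ zr.
  have [d d0 hd] := (near_normP (h z) D).1 (open_nbhs_nbhs (conj oD Dhz)).
  have d2 : 0 < d / 2 by rewrite divr_gt0.
  have [dl dl0 hdl] := (contP h z).1 ch _ d2.
  exists ([set z' | `|z' - z| < dl], [set k | k < d / 4]).
    have h1 : \forall z' \near z, `|z' - z| < dl by apply/near_normP; exists dl.
    have h2 : \forall k \near (0 : R)^'+, k < d / 4.
      by apply: nbhs_right_lt; rewrite divr_gt0.
    by split; [exact: h1|exact: h2].
  move=> [z' k] /= [/hdl hz' hk] w hw; apply: hd.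
  rewrite -(subrKA (h z')); apply: le_lt_trans (ler_normD _ _) _; lra.
exists (d / 2); first by rewrite divr_gt0.
move=> z zr w; apply: (hd (d / 2)) => //=; last by rewrite divr_gt0.
by rewrite sub0r normrN gtr0_norm; lra.
Qed.

(** The clearance [k] is uniform on the disc, so one rank [N] gives m + 1 <= n k^2 at all its
    points. [submean_cont] then applies, and dominated convergence with bound [m] lets n tend to
    infinity. *)
Lemma supconv_submean (h : C -> C) (c : C) (r : R) : open D -> 0 < r ->
  (forall z, `|z - c| <= r -> D (h z) /\ cderivable h z) ->
  bounded_mfun (fun t => V (h (circle_pt c r t))) ->
  V (h c) <= cmean (fun t => V (h (circle_pt c r t))).
Proof.
move=> oD r0 hh bV.
have [|k k0 hk] := @clearance h c r oD.
  by move=> z /hh[? /cderivable_cont].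
have zD t : `|circle_pt c r t - c| <= r by rewrite norm_circle gtr0_norm.
have scc n : (n > 0)%N -> forall z, `|z - c| <= r ->
    (fun y => supconv n%:R (h y)) @ z --> supconv n%:R (h z).
  move=> n0 z /hh[_ dh]; apply: (@continuous_comp _ _ _ h (supconv n%:R)).
    exact: cderivable_cont.
  exact: sc_cont.
have bs n : bounded_mfun (fun t => supconv n.+1%:R (h (circle_pt c r t))).
  by apply: (@cont_circle_bmf _ (fun y => supconv n.+1%:R (h y))) => t; apply: scc.
pose N := (Num.truncn ((m + 1) / k ^+ 2)).
have step n : (N <= n)%N -> V (h c) <= cmean (fun t => supconv n.+1%:R (h (circle_pt c r t))).
  move=> Nn.
  have [Dhc _] : D (h c) /\ cderivable h c by apply: hh; rewrite subrr normr0 ltW.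
  apply: le_trans (sc_ge (ler0n R n.+1) Dhc) _.
  apply: (@submean_cont _ c r (fun y => supconv n.+1%:R (h y))) => //.
    by move=> z zr; apply: scc.
  move=> z zr; have [Dhz _] := hh _ (ltW zr).
  apply: (@supconv_asub h z (r - `|z - c|) n.+1%:R k) => //.
  - by rewrite subr_gt0.
  - move=> y yz; have yr : `|y - c| <= r.
      by rewrite -(subrKA z); apply: le_trans (ler_normD _ _) _; lra.
    by have [] := hh _ yr.
  - exact: hk (ltW zr).
  rewrite -ler_pdivrMr ?exprn_gt0 //; apply: le_trans (ltW (truncnS_gt _)) _.
  by rewrite ler_nat ltnS.
have lim : cmean (fun t => supconv n.+1%:R (h (circle_pt c r t))) @[n --> \oo] -->
    cmean (fun t => V (h (circle_pt c r t))).
  apply: cvgM; first exact: cvg_cst.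
  have mI : measurable (`[0, 2 * pi]%classic : set R) by exact: measurable_itv.
  have [] := @dominated_convergence _ _ _ (@lebesgue_measure R) _ mI
    (fun n t => (supconv n.+1%:R (h (circle_pt c r t)))%:E)
    (fun t => (V (h (circle_pt c r t)))%:E) (fun=> m%:E).
  - by move=> n; apply/measurable_EFinP/measurable_funTS; case: (bs n).
  - by apply/measurable_EFinP/measurable_funTS; case: bV.
  - apply: aeW => t _; apply: cvg_EFin; first by near=> n.
    have [Dt _] := hh _ (zD t).
    by have := supconv_cvg Dt; rewrite -cvg_shiftS.
  - exact: (bmf_int _ _ _ _ (bmf_cst m)).
  - apply: aeW => t n _; rewrite /= lee_fin ler_norml.
    have [Dt _] := hh _ (zD t).
    have := sc_ge (ler0n R n.+1) Dt; have := sc_le0 (h (circle_pt c r t)) (ler0n R n.+1).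
    have /andP[h1 _] := Vbnd (h (circle_pt c r t)); lra.
  move=> _ _ H; rewrite /Rintegral.
  apply: fine_cvg; rewrite fineK; first exact: H.
  exact: (integrable_fin_num _ (bmf_int _ _ _ _ bV)).
rewrite -(cvg_lim _ lim) //; apply: limr_ge; first exact: (cvgP _ lim).
by exists N => // n; exact: step.
Unshelve. all: by end_near. Qed.

End SupConvolution.

Section Composition.
Variable R : realType.
Local Notation C := (Rcomplex R).

Lemma usc_comp (D U : set C) (v : C -> \bar R) (h : C -> C) : open D -> usc_on D v ->
  (forall z, U z -> D (h z) /\ h @ z --> h z) -> usc_on U (v \o h).
Proof.
move=> oD usc hU; split => [z /hU[/usc.1]//|z c /hU[Dhz ch] hc].
rewrite near_withinE.
have Hn : \forall y \near z, (v (h y) < c%:E)%E := ch _ (usc_open oD usc Dhz hc).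
by apply: filterS Hn.
Qed.

Lemma subharmonic_comp (D U : set C) (v : C -> \bar R) (h : C -> C) (M : R) :
  open D -> open U -> (forall z, D z -> `|z| <= M) ->
  subharmonic D v -> (forall z, D z -> (v z <= 0)%E) ->
  (forall z, U z -> D (h z) /\ cderivable h z) -> subharmonic U (v \o h).
Proof.
move=> oD oU DM sv v0 hU.
have uscU : usc_on U (v \o h).
  by apply: (usc_comp oD sv.1) => z /hU[? /cderivable_cont].
apply: clip_subharmonic => //; first by move=> z /hU[/v0].
move=> n a r r0 rU.
have aU : U a by apply: rU; rewrite /= subrr normr0 ltW.
apply: (@supconv_submean _ D (fun z => clip n%:R (v z)) n%:R M) => //.
- by exists (h a); have [] := hU _ aU.
- by move=> z; rewrite clip_ge ?clip_le0.
- by move=> z c; apply: clip_usc => //; case: sv.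
- by move=> z s s0 sD; apply: (subharmonic_clip oD sv v0).
- by move=> z zr; apply: hU; apply: rU.
apply: (@clip_bmf _ n%:R (fun t => (v \o h) (circle_pt a r t))) => //.
by apply: (usc_circle oU uscU) => t; apply: rU; rewrite /= norm_circle gtr0_norm.
Qed.

End Composition.

(** * Logarithmic poles *)

Section Logarithm.
Variable R : realType.
Local Notation C := (Rcomplex R).
Implicit Types (a b z w : C).

(** ln y <= y - 1 at y = 1 / (1 + x) gives ln (1 + x) >= x / (1 + x), which exceeds the left side by
    x^2 (1 + 2 x) / (1 + x). *)
Lemma ln_lower (x : R) : - (1 / 2) <= x -> x - 2 * x ^+ 2 <= ln (1 + x).
Proof.
move=> x2; have x1 : 0 < 1 + x by lra.
have := @le_ln1Dx R ((1 + x)^-1 - 1).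
have -> : 1 + ((1 + x)^-1 - 1) = (1 + x)^-1 by ring.
rewrite lnV ?posrE // => h.
have {}h : 1 - (1 + x)^-1 <= ln (1 + x).
  have : -1 < (1 + x)^-1 - 1 by rewrite ltrBrDl subrr invr_gt0.
  by move=> /h; lra.
apply: le_trans h.
have : 0 <= x ^+ 2 * (1 + x *+ 2) / (1 + x).
  rewrite divr_ge0 ?(ltW x1) // mulr_ge0 ?sqr_ge0 //; lra.
have -> : x ^+ 2 * (1 + x *+ 2) / (1 + x) = 1 - (1 + x)^-1 - (x - 2 * x ^+ 2).
  by field; rewrite gt_eqF.
lra.
Qed.

Lemma ln_half_sq (x : R) : 0 < x -> ln x = 1 / 2 * ln (x ^+ 2).
Proof. by move=> x0; rewrite lnXn //; field. Qed.

(* The product of [|b + r e^(it)|] and [|b - r e^(it)|] is [|b^2 - r^2 e^(2it)|],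
   whose logarithm is [2 ln |b| + O(r^2)] with a first-order term of mean zero. *)
Lemma log_mean b (e : R) : b != 0 -> 0 < e -> exists2 d, 0 < d & forall r, 0 < r < d ->
  bounded_mfun (fun t => ln `|circle_pt b r t|) /\
  `|cmean (fun t => ln `|circle_pt b r t|) - ln `|b| | <= e * r ^+ 2.
Proof.
move=> b0 e0; have nb : 0 < `|b| by rewrite normr_gt0.
pose N := `|b| ^+ 2; have N0 : 0 < N by rewrite exprn_gt0.
(* r < 1 gives r^2 <= r, r < |b| keeps the circle off 0, N / 8 gives q <= 1 / 8, and the last bound
   gives 5 q^2 <= e r^2. *)
exists (Num.min (Num.min 1 `|b|) (Num.min (N / 8) (e * N ^+ 2 / 5))).
  by rewrite !lt_min ltr01 nb !divr_gt0 ?mulr_gt0 ?exprn_gt0.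
move=> r /andP[r0]; rewrite !lt_min => /andP[/andP[r1 rb] /andP[r8 r5]].
pose p := r ^+ 2.
have p0 : 0 < p by rewrite exprn_gt0.
have pr : p <= r by rewrite /p expr2 ler_piMl // ltW.
have c0 t : 0 < `|circle_pt b r t|.
  rewrite normr_gt0; apply/eqP => h.
  by have := norm_circle b r t; rewrite h sub0r normrN gtr0_norm // => h1; rewrite h1 ltxx in rb.
pose A t := ln `|circle_pt b r t|.
have bA : bounded_mfun A.
  apply: (@cont_circle_bmf _ (fun w => ln `|w|)) => t.
  apply: (@continuous_comp _ _ _ (fun w : C => `|w|) (@ln R)); first by apply: cvg_norm; exact: cvg_id.
  exact: continuous_ln.
split => //; rewrite -/A.
have piok : 0 <= (pi : R) <= 2 * pi by have := @pi_gt0 R; lra.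
have pi2ok : 0 <= (pi : R) / 2 <= 2 * pi by have := @pi_gt0 R; lra.
have Aper t : A (t + 2 * pi) = A t by rewrite /A circle_per.
have mA2 : cmean (fun t => A t + A (t + pi)) = 2 * cmean A.
  by rewrite cmeanD // ?cmean_rot //; [rewrite mulr2n mulrDl !mul1r|exact: bmf_shift].
pose T t := complex.Re b * cos t + complex.Im b * sin t.
(* With beta the argument of b, T t = |b| cos (t - beta) and U t = - cos (2 (t - beta)), whose sign
   a quarter turn reverses. *)
pose U t := (N - 2 * T t ^+ 2) / N.
have bT : bounded_mfun T by exact: bmf_trig.
have cT : continuous T.
  move=> t; apply: cvgD; apply: cvgM; try exact: cvg_cst; [exact: continuous_cos|exact: continuous_sin].
have NE : N = complex.Re b ^+ 2 + complex.Im b ^+ 2 by rewrite /N sqnormE.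
have T2 t : T t ^+ 2 <= N.
  rewrite -subr_ge0 (_ : N - _ = (complex.Re b * sin t - complex.Im b * cos t) ^+ 2) ?sqr_ge0 //.
  rewrite /T NE -[complex.Re b ^+ 2]mulr1 -[complex.Im b ^+ 2]mulr1.
  by rewrite -{1 2}(cos2Dsin2 t); ring.
have U1 t : `|U t| <= 1.
  rewrite /U ler_norml ler_pdivrMr // ler_pdivlMr //.
  have := T2 t; have := sqr_ge0 (T t); lra.
have bU : bounded_mfun U.
  apply: cont_bmf; last by exists 1.
  move=> t; apply: cvgM; last exact: cvg_cst.
  apply: cvgB; first exact: cvg_cst.
  by apply: cvgM; [exact: cvg_cst|apply: cvgM; exact: cT].
have mU : cmean U = 0.
  apply: (@cmean_alt _ _ (pi / 2)) => // t; first by rewrite /U /T cosD2pi' sinD2pi'.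
  suff h : N - 2 * T (t + pi / 2) ^+ 2 = - (N - 2 * T t ^+ 2) by rewrite /U h mulNr.
  rewrite /T cosDpihalf sinDpihalf NE (_ : complex.Re b ^+ 2 + complex.Im b ^+ 2 =
    (complex.Re b ^+ 2 + complex.Im b ^+ 2) * (cos t ^+ 2 + sin t ^+ 2)).
    by ring.
  by rewrite cos2Dsin2 mulr1.
pose q := p / N.
have q0 : 0 < q by rewrite divr_gt0.
have q8 : q <= 1 / 8.
  by rewrite /q ler_pdivrMr // mul1r mulrC; apply: le_trans pr (ltW r8).
(* 1 + X t is the squared modulus of 1 - q e^(2i(t - beta)). *)
pose X t := 2 * q * U t + q ^+ 2.
have bX : bounded_mfun X by apply: bmfD; [exact: bmfZ|exact: bmf_cst].
have mX : cmean X = q ^+ 2.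
  have /= h1 := cmeanD (bmfZ (2 * q) bU) (bmf_cst (q ^+ 2)).
  have /= h2 := cmeanZ (2 * q) bU.
  by rewrite /X h1 h2 mU cmean_cst mulr0 add0r.
have q2 : q ^+ 2 <= q * (1 / 8) by rewrite expr2 ler_wpM2l // ltW.
have X3 t : `|X t| <= 3 * q.
  have : `|2 * q * U t| <= 2 * q.
    have q2p : 0 < 2 * q by rewrite mulr_gt0.
    by rewrite normrM (gtr0_norm q2p) ler_piMr ?U1 // ltW.
  have := ler_normD (2 * q * U t) (q ^+ 2); rewrite -/(X t).
  rewrite (ger0_norm (sqr_ge0 q)); lra.
have X1 t : 0 < 1 + X t.
  by have := X3 t; rewrite ler_norml; lra.
have AE t : A t + A (t + pi) = 2 * ln `|b| + 1 / 2 * ln (1 + X t).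
  rewrite /A -lnM ?posrE // ln_half_sq ?mulr_gt0 //.
  have -> : 2 * ln `|b| = 1 / 2 * ln (N ^+ 2).
    by rewrite -ln_half_sq // {1}(ln_half_sq nb); field.
  rewrite -mulrDr -lnM ?posrE ?exprn_gt0 //; congr (_ * ln _).
  rewrite exprMn !sqnorm_circle cosDpi sinDpi -/N -/p.
  rewrite /X /U /q -/(T t) (_ : complex.Re b * - cos t + complex.Im b * - sin t = - T t); last by rewrite /T; ring.
  have -> : 2 * r * T t = 2 * r * T t by [].
  transitivity ((N + p) ^+ 2 - 4 * p * T t ^+ 2); first by rewrite /p; ring.
  by field; rewrite gt_eqF.
have bL : bounded_mfun (fun t => ln (1 + X t)).
  have -> : (fun t => ln (1 + X t)) = fun t => 2 * (A t + A (t + pi) + - (2 * ln `|b|)).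
    by apply/funext => t; rewrite AE; lra.
  by apply: bmfZ; apply: bmfD; [apply: bmfD => //; exact: bmf_shift|exact: bmf_cst].
have m2 : 2 * cmean A = 2 * ln `|b| + 1 / 2 * cmean (fun t => ln (1 + X t)).
  rewrite -mA2; under eq_cmean do rewrite AE.
  have /= h1 := cmeanD (bmf_cst (2 * ln `|b|)) (bmfZ (1 / 2) bL).
  have /= h2 := cmeanZ (1 / 2) bL.
  by rewrite h1 h2 cmean_cst.
have up : cmean (fun t => ln (1 + X t)) <= q ^+ 2.
  rewrite -mX; apply: le_cmean => // t; apply: le_ln1Dx.
  by have := X1 t; lra.
(* 18 is 2 * 3^2, from |X| <= 3 q in [ln_lower]. A quarter of the resulting 17 q^2 is below 5
   q^2. *)
have lo : q ^+ 2 - 18 * q ^+ 2 <= cmean (fun t => ln (1 + X t)).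
  have -> : q ^+ 2 - 18 * q ^+ 2 = cmean (fun t => X t + - (18 * q ^+ 2)).
    have /= h1 := cmeanD bX (bmf_cst (- (18 * q ^+ 2))).
    by rewrite h1 mX cmean_cst.
  apply: le_cmean => //; first by apply: bmfD => //; exact: bmf_cst.
  move=> t; apply: le_trans (ln_lower _); last by have := X3 t; rewrite ler_norml; lra.
  have : X t ^+ 2 <= (3 * q) ^+ 2.
    by rewrite -(real_normK (num_real (X t))) ler_pXn2r ?nnegrE // mulr_ge0 // ltW.
  rewrite exprMn; lra.
have qe : 5 * q ^+ 2 <= e * p.
  rewrite /q expr_div_n expr2 -mulrA mulrCA (mulrC e) ler_pM2l //.
  rewrite mulrA ler_pdivrMr ?exprn_gt0 //.
  have : r * 5 < e * N ^+ 2 by rewrite -ltr_pdivlMr.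
  lra.
rewrite -/p ler_norml; move: up lo m2 qe; clear; lra.
Qed.

(** Both signs serve: [ln] for the competitor [vlog], [- ln] for the comparison in
    [log_pole_bound]. *)
Lemma asub_log a z : z != a -> asub (fun w => ln `|w - a|) z /\ asub (fun w => - ln `|w - a|) z.
Proof.
move=> za; have b0 : z - a != 0 by rewrite subr_eq0.
have cE r t : circle_pt z r t - a = circle_pt (z - a) r t.
  by rewrite circle_ptE [in RHS]circle_ptE addrAC.
split=> e e0; have [d d0 hd] := log_mean b0 e0; exists d => // r /hd[b h].
  under [X in bounded_mfun X]eq_fun do rewrite cE.
  under eq_cmean do rewrite cE.
  by split => //; move: h; rewrite ler_norml; lra.
have E : (fun t => - ln `|circle_pt z r t - a|) = fun t => -1 * ln `|circle_pt (z - a) r t|.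
  by apply/funext => t; rewrite cE mulN1r.
by rewrite E; split; [exact: bmfZ|rewrite cmeanZ //; move: h; rewrite ler_norml; lra].
Qed.

Lemma cvg_dist a z : (fun w : C => `|w - a|) @ z --> `|z - a|.
Proof. by apply: cvg_norm; apply: cvgB; [exact: cvg_id|exact: cvg_cst]. Qed.

Lemma cvg_log a z : z != a -> (fun w : C => ln `|w - a|) @ z --> ln `|z - a|.
Proof.
move=> za; apply: (@continuous_comp _ _ _ (fun w : C => `|w - a|) (@ln R)).
  exact: cvg_dist.
by apply: continuous_ln; rewrite normr_gt0 subr_eq0.
Qed.

(** The maximum is taken inside [ln] to keep its argument positive: outside, the convention
    [ln 0 = 0] would give the wrong value at the pole. *)
Definition tlog a (q m : R) z := ln (Num.max (`|z - a| / q) (expR (- m))).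

Lemma tlogE a q m z : tlog a q m z =
  if `|z - a| / q <= expR (- m) then - m else ln (`|z - a| / q).
Proof. by rewrite /tlog; case: leP => h; rewrite ?expRK. Qed.

Lemma tlog_ge a q m z : - m <= tlog a q m z.
Proof.
rewrite tlogE; case: ifPn => //; rewrite -ltNge => h; rewrite -[X in X <= _]expRK ler_ln ?posrE ?expR_gt0 ?(ltW h) //.
by apply: lt_trans h; rewrite expR_gt0.
Qed.

Lemma tlog_ge_ln a q m z : z != a -> 0 < q -> ln `|z - a| - ln q <= tlog a q m z.
Proof.
move=> za q0; have za' : 0 < `|z - a| by rewrite normr_gt0 subr_eq0.
rewrite -ln_div ?posrE // ler_ln ?posrE ?divr_gt0 // ?lt_max ?divr_gt0 //.
by rewrite le_max lexx.
Qed.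

Lemma tlog_cont a q m z : tlog a q m @ z --> tlog a q m z.
Proof.
apply: (@continuous_comp _ _ _ (fun w : C => Num.max (`|w - a| / q) (expR (- m))) (@ln R)); last first.
  by apply: continuous_ln; rewrite lt_max expR_gt0 orbT.
apply: (@continuous_comp _ _ _ (fun w : C => `|w - a| / q) (fun x => Num.max x (expR (- m)))).
  by apply: cvgM; [exact: cvg_dist|exact: cvg_cst].
apply/contP => e e0; exists e => // y; rewrite !ltr_norml => h.
by case: (leP y (expR (- m))) => h1; case: (leP (`|z - a| / q) (expR (- m))) => h2; lra.
Qed.

(** Where the truncation is active the value is the minimum of [tlog]; elsewhere the logarithm
    equals [tlog] at the centre and lies below it on small circles. *)
Lemma tlog_asub a q m z : 0 < q -> asub (tlog a q m) z.
Proof.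
move=> q0; have bt r : bounded_mfun (fun t => tlog a q m (circle_pt z r t)).
  by apply: (@cont_circle_bmf _ (tlog a q m)) => t; exact: tlog_cont.
have [h|h] := leP (`|z - a| / q) (expR (- m)).
  move=> e e0; exists 1 => // r _; split => //.
  apply: le_trans (_ : - m <= _); last first.
    by rewrite -[leLHS]cmean_cst; apply: le_cmean; [exact: bmf_cst|exact: bt|move=> t; exact: tlog_ge].
  by rewrite tlogE h lerBlDr lerDl mulr_ge0 ?sqr_ge0 // ltW.
have nza : 0 < `|z - a|.
  have : 0 < `|z - a| / q by apply: lt_trans h; rewrite expR_gt0.
  by rewrite pmulr_lgt0 ?invr_gt0.
have za : z != a by rewrite -subr_eq0 -normr_gt0.
move=> e e0; have [d d0 hd] := (asub_log za).1 e e0.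
exists (Num.min d `|z - a|); first by rewrite lt_min d0.
move=> r /andP[r0]; rewrite lt_min => /andP[rd rz].
have /hd[b l] : 0 < r < d by rewrite r0.
split => //; have -> : tlog a q m z = ln `|z - a| - ln q.
  by rewrite tlogE leNgt h /= ln_div ?posrE.
apply: le_trans (_ : cmean (fun t => ln `|circle_pt z r t - a| + - ln q) <= _).
  by rewrite cmeanD ?cmean_cst //; [lra|exact: bmf_cst].
apply: le_cmean; [by apply: bmfD => //; exact: bmf_cst|exact: bt|].
move=> t; apply: tlog_ge_ln => //; apply/eqP => h1.
have := norm_circle z r t; rewrite h1 distrC gtr0_norm // => h2.
by rewrite h2 ltxx in rz.
Qed.

Definition vlog a (q : R) z : \bar R := if z == a then -oo%E else (ln (`|z - a| / q))%:E.

Lemma vlog_lt a q z (c : R) : 0 < q -> (vlog a q z < c%:E)%E <-> `|z - a| < q * expR c.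
Proof.
move=> q0; rewrite /vlog; case: eqVneq => [->|za].
  by rewrite ltNyr subrr normr0; split => // _; rewrite mulr_gt0 ?expR_gt0.
have za' : 0 < `|z - a| by rewrite normr_gt0 subr_eq0.
rewrite lte_fin -[X in _ < X]expRK ltr_ln ?posrE ?divr_gt0 ?expR_gt0 //.
by rewrite ltr_pdivrMr // mulrC.
Qed.

Lemma clip_vlog a q m z : 0 < q -> 0 <= m -> `|z - a| <= q -> clip m (vlog a q z) = tlog a q m z.
Proof.
move=> q0 m0 zq; rewrite /vlog; case: eqVneq => [->|za] /=.
  by rewrite tlogE subrr normr0 mul0r expR_ge0.
have za' : 0 < `|z - a| by rewrite normr_gt0 subr_eq0.
have l0 : ln (`|z - a| / q) <= 0 by rewrite ln_le0 // ler_pdivrMr // mul1r.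
rewrite min_r ?ge_max ?l0 ?oppr_le0 // tlogE; case: leP => h.
  by rewrite max_r // -[leRHS]expRK ler_ln ?posrE ?divr_gt0 ?expR_gt0.
by rewrite max_l // -[leLHS]expRK ler_ln ?posrE ?divr_gt0 ?expR_gt0 // ltW.
Qed.

Lemma vlog_candidate (D : set C) a q : open D -> 0 < q -> (forall z, D z -> `|z - a| < q) ->
  [/\ subharmonic D (vlog a q), forall z, D z -> (vlog a q z < 0)%E & has_log_pole (vlog a q) a].
Proof.
move=> oD q0 Dq.
have neg z : D z -> (vlog a q z < 0)%E.
  by move=> /Dq zq; apply/(vlog_lt _ _ _ q0); rewrite expR0 mulr1.
split => //; last first.
  exists (- ln q); near=> z.
  have za : z != a by near: z; exact: nbhs_dnbhs_neq.
  by rewrite /vlog (negbTE za) lee_fin ln_div ?posrE // normr_gt0 subr_eq0.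
apply: clip_subharmonic => //.
- split => [z _|z c Dz].
    by rewrite /vlog; case: eqVneq => // _; rewrite ltry.
  move=> /(vlog_lt _ _ _ q0) h; rewrite near_withinE.
  have hn : \forall y \near z, `|y - a| < q * expR c.
    by have /cvgr_lt := @cvg_dist a z; apply.
  by apply: filterS hn => y hy _; apply/vlog_lt.
- by move=> z /neg/ltW.
move=> n c r r0 rD; rewrite clip_vlog ?ler0n //; last first.
  by apply/ltW/Dq/rD; rewrite /= subrr normr0 ltW.
have -> : (fun t => clip n%:R (vlog a q (circle_pt c r t))) = fun t => tlog a q n%:R (circle_pt c r t).
  apply/funext => t; rewrite clip_vlog ?ler0n //.
  by apply/ltW/Dq/rD; rewrite /= norm_circle gtr0_norm.
by apply: submean_cont => // z _; [exact: tlog_cont|exact: tlog_asub].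
Unshelve. all: by end_near. Qed.

(** Compare v with (1 - e) ln (|w - a| / r) on the annulus d <= |w - a| <= r. The latter is 0 on the
    outer circle; on the inner one it exceeds ln d + M once d is small, the factor 1 - e giving the
    room. Then e tends to 0. *)
Lemma log_pole_bound (D : set C) (v : C -> \bar R) a r z : open D ->
  subharmonic D v -> (forall w, D w -> (v w <= 0)%E) -> has_log_pole v a ->
  [set w | `|w - a| <= r] `<=` D -> 0 < `|z - a| <= r ->
  (v z <= (ln (`|z - a| / r))%:E)%E.
Proof.
move=> oD sv v0 [M /near_normP[d0 d00 hd0]] rD /andP[za zr].
have r0 : 0 < r by apply: lt_le_trans zr.
have Dz : D z by apply: rD.
pose l := ln `|z - a| - ln r.
have l0 : l <= 0 by rewrite /l subr_le0 ler_ln ?posrE.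
have key e : 0 < e < 1 -> (v z <= ((1 - e) * l)%:E)%E.
  move=> /andP[e0 e1].
  (* The radius d at which ln d + M = (1 - e) (ln d - ln r). *)
  pose B := expR ((- M - (1 - e) * ln r) / e).
  pose d := Num.min (Num.min (d0 / 2) `|z - a|) (Num.min r B).
  have d_gt0 : 0 < d by rewrite /d !lt_min divr_gt0 // za r0 expR_gt0.
  have dd0 : d < d0.
    by apply: le_lt_trans (_ : d0 / 2 < _); [rewrite /d !ge_min lexx|lra].
  have dz : d <= `|z - a| by rewrite /d !ge_min lexx !orbT.
  have dr : d <= r by rewrite /d !ge_min lexx !orbT.
  have dB : ln d <= (- M - (1 - e) * ln r) / e.
    rewrite -[leRHS]expRK ler_ln ?posrE ?expR_gt0 //.
    by rewrite /d !ge_min lexx !orbT.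
  have {dB} dM : ln d + M <= (1 - e) * (ln d - ln r).
    by move: dB; rewrite ler_pdivlMr //; lra.
  (* The truncation level must not spoil the bound ln d + M on the inner circle. *)
  pose m := Num.max 0 (- (ln d + M)).
  have m0 : 0 <= m by rewrite le_max lexx.
  have mM : - m <= ln d + M by rewrite lerNl le_max lexx orbT.
  pose K := [set w : C | `|w - a| <= r] `&` [set w | d <= `|w - a|].
  pose F w := clip m (v w) + ((1 - e) * - ln `|w - a| + (1 - e) * ln r).
  suff : F z <= 0.
    move=> h; apply: le_trans (clip_ge_self m (v0 _ Dz)) _; rewrite lee_fin.
    by move: h; rewrite /F /l; lra.
  have Ka w : K w -> w != a.
    by move=> [_ /= dw]; rewrite -subr_eq0 -normr_gt0; apply: lt_le_trans dw.
  apply: (@maximum_principle _ K F (r + `|a|)).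
  - apply: (@compact_closed_bounded _ _ (r + `|a|)).
      apply: closedI; first exact: closed_disc.
      rewrite -[X in closed X]setCK; apply: open_closedC; rewrite openE => w /= /negP.
      rewrite -ltNge => wd.
      have /cvgr_lt /(_ _ wd) := @cvg_dist a w; apply: filterS => y yd.
      by apply/negP; rewrite -ltNge.
    move=> w [/= wr _]; rewrite -[w](subrK a); apply: le_trans (ler_normD _ _) _.
    by rewrite lerD2r.
  - move=> w [/= wr _]; rewrite -[w](subrK a); apply: le_trans (ler_normD _ _) _.
    by rewrite lerD2r.
  - move=> w c Kw; rewrite /F => hc.
    pose L y := (1 - e) * - ln `|y - a| + (1 - e) * ln r.
    rewrite -/(L w) in hc.
    pose s := (c - (clip m (v w) + L w)) / 2.
    have s0 : 0 < s by rewrite divr_gt0 // subr_gt0.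
    have h1 : \forall y \near w, clip m (v y) < clip m (v w) + s.
      apply: (@clip_usc _ D) => //; [by case: sv|by apply: rD; case: Kw|by rewrite ltrDl].
    have h2 : \forall y \near w, L y < L w + s.
      have : L @ w --> L w.
        apply: cvgD; last exact: cvg_cst.
        apply: cvgM; first exact: cvg_cst.
        by apply: cvgN; apply: cvg_log; exact: Ka.
      by move=> /cvgr_lt; apply; rewrite ltrDl.
    near=> y => _; rewrite -/(L y).
    have y1 : clip m (v y) < clip m (v w) + s by near: y.
    have y2 : L y < L w + s by near: y.
    by rewrite /s in y1 y2; lra.
  - move=> w Kw; have [wr dw] := Kw; rewrite /= in wr dw.
    have Dw : D w by apply: rD.
    have wa := Ka _ Kw.
    have [wr'|wr'] := eqVneq `|w - a| r.
      by left; rewrite /F wr'; have := clip_le0 (v w) m0; lra.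
    have [wd'|wd'] := eqVneq `|w - a| d.
      left; have vw : (v w <= (ln d + M)%:E)%E.
        by have := hd0 w; rewrite wd' dd0 => /(_ isT); apply.
      have := le_clip m0 vw => /= hcl.
      have : clip m (v w) <= ln d + M.
        apply: le_trans hcl _; rewrite ge_min; apply/orP; right.
        by rewrite ge_max lexx mM.
      by rewrite /F wd'; lra.
    right.
    have wr2 : `|w - a| < r by rewrite lt_neqAle wr'.
    have wd2 : d < `|w - a| by rewrite lt_neqAle eq_sym wd'.
    have small s t : 0 < s < Num.min (r - `|w - a|) (`|w - a| - d) -> K (circle_pt w s t).
      rewrite lt_min => /and3P[s0 s1 s2].
      have nc := norm_circle w s t; rewrite gtr0_norm // in nc.
      have n1 : `|circle_pt w s t - a| <= `|circle_pt w s t - w| + `|w - a|.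
        by rewrite -{1}(subrKA w); exact: ler_normD.
      have n2 : `|w - a| <= `|circle_pt w s t - w| + `|circle_pt w s t - a|.
        by rewrite (distrC (circle_pt w s t)) -{1}(subrKA (circle_pt w s t)); exact: ler_normD.
      by split => /=; lra.
    split; last first.
      exists (Num.min (r - `|w - a|) (`|w - a| - d)); first by rewrite lt_min !subr_gt0 wr2.
      by move=> s t hs; exact: small.
    apply: asubD; last first.
      apply: asubD; last exact: asub_cst.
      apply: asubZ; first by lra.
      by case: (asub_log wa).
    move=> eta eta0; have [dl dl0 hdl] := (near_normP w D).1 (open_nbhs_nbhs (conj oD Dw)).
    exists dl => // s /andP[s0 sdl].
    have [|b h] := subharmonic_clip oD sv v0 m0 s0 (a := w).
      by move=> y /= ys; apply: hdl; apply: le_lt_trans sdl.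
    by split => //; apply: le_trans h; rewrite lerBlDr lerDl mulr_ge0 ?sqr_ge0 // ltW.
  - by split.
rewrite ln_div ?posrE // -/l.
have [->|vz] := eqVneq (v z) -oo%E; first exact: leNye.
have : v z \is a fin_num.
  rewrite fin_numE vz /=; apply/eqP => h; have := v0 _ Dz; rewrite h.
  by [].
move=> /fineK <-; rewrite lee_fin; apply/ler_addgt0Pr => eta eta0.
(* Makes - e l <= eta; 1 - l is positive even when l = 0. *)
pose e := Num.min (1 / 2) (eta / (1 - l)).
have l1 : 0 < 1 - l by lra.
have e0 : 0 < e by rewrite lt_min !divr_gt0.
have e1 : e < 1 by apply: le_lt_trans (_ : 1 / 2 < _); [rewrite ge_min lexx|lra].
have /key : 0 < e < 1 by rewrite e0.
have [fz|] := boolP (v z \is a fin_num); last first.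
  rewrite fin_numE vz /= negbK => /eqP h; have := v0 _ Dz; rewrite h; by [].
rewrite -[X in (X <= _)%E](fineK fz) lee_fin => h; apply: le_trans h _.
have : e * (1 - l) <= eta by rewrite -ler_pdivlMr // ge_min lexx orbT.
lra.
Unshelve. all: by end_near. Qed.

End Logarithm.

(** * The complex Green function *)

Section Ereal.
Variable R : realType.
Local Open Scope ereal_scope.
Implicit Types x y : \bar R.

Lemma real_between x y : x < y -> exists c : R, x < c%:E /\ c%:E < y.
Proof.
case: x y => [r| |] [s| |] //; rewrite ?lte_fin => rs.
- by exists ((r + s) / 2)%R; rewrite !lte_fin; lra.
- by exists (r + 1)%R; rewrite lte_fin ltry; split=> //; lra.
- by exists (s - 1)%R; rewrite lte_fin ltNyr; split=> //; lra.
- by exists 0%R; rewrite ltNyr ltry.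
Qed.

Lemma lee_below x y : (forall c : R, c%:E < x -> c%:E <= y) -> x <= y.
Proof.
move=> h; rewrite leNgt; apply/negP => /real_between[c [yc /h cy]].
by move: (lt_le_trans yc cy); rewrite ltxx.
Qed.

Lemma lee_above x y : (forall c : R, y < c%:E -> x <= c%:E) -> x <= y.
Proof.
move=> h; rewrite leNgt; apply/negP => /real_between[c [/h yc cy]].
by move: (le_lt_trans yc cy); rewrite ltxx.
Qed.

Lemma le_limn_einf x (u : (\bar R)^nat) :
  (forall c : R, c%:E < x -> exists n, forall k, (n <= k)%N -> c%:E <= u k) ->
  x <= limn_einf u.
Proof.
move=> h; apply: lee_below => c /h[n hn].
rewrite limn_einf_lim.
have nd : nondecreasing_seq (einfs u) by apply: nondecreasing_einfs.
apply: le_trans (_ : einfs u n <= _).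
  by apply: le_ereal_inf_tmp => _ [k /= nk <-]; exact: hn.
have /cvg_lim -> // := ereal_nondecreasing_cvgn nd.
by apply: ereal_sup_ubound; exists n.
Qed.

Lemma limn_einf_le x (u : (\bar R)^nat) : (forall k, u k <= x) -> limn_einf u <= x.
Proof.
move=> h; rewrite limn_einf_lim.
have nd : nondecreasing_seq (einfs u) by apply: nondecreasing_einfs.
have /cvg_lim -> // := ereal_nondecreasing_cvgn nd.
apply: ge_ereal_sup => _ [n _ <-]; apply: le_trans (h n).
by apply: ereal_inf_lbound; exists n => /=.
Qed.

End Ereal.

Section UscRegularization.
Variables (R : realType) (T : topologicalType) (D : set T).
Local Open Scope ereal_scope.
Implicit Types (f g : T -> \bar R) (x : T).

Lemma usc_reg_ge f x : D x -> f x <= usc_reg D f x.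
Proof.
move=> Dx; apply: le_ereal_inf_tmp => _ [V /= hV <-].
apply: ereal_sup_ubound; exists x => //.
by move: hV => /nbhs_singleton; apply.
Qed.

(** A neighbourhood bounding f near x is also a neighbourhood of each of its interior points, so the
    same bound controls the regularization there. *)
Lemma usc_reg_lt f x y : usc_reg D f x < y ->
  \forall z \near within D (nbhs x), f z < y /\ usc_reg D f z < y.
Proof.
move=> /ereal_inf_lt[_ [V hV <-] hy].
rewrite near_withinE.
have hi : nbhs x (interior [set z | D z -> V z]) by exact: nbhs_interior.
apply: filterS hi => z hz Dz; split.
  apply: le_lt_trans hy; apply: ereal_sup_ubound; exists z => //.
  by move: hz => /nbhs_singleton; apply.
by apply: le_lt_trans hy; apply: ereal_inf_lbound; exists V.
Qed.

Lemma usc_reg_usc f : (forall x, D x -> usc_reg D f x < +oo) -> usc_on D (usc_reg D f).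
Proof.
by move=> h; split => // x c Dx /usc_reg_lt; apply: filterS => z [].
Qed.

Lemma usc_reg_le f x (b : \bar R) :
  (forall c : R, b < c%:E -> \forall z \near within D (nbhs x), f z <= c%:E) ->
  usc_reg D f x <= b.
Proof.
move=> h; apply: lee_above => c /h hc.
apply: le_trans (_ : ereal_sup (f @` [set z | f z <= c%:E]) <= _).
  by apply: ereal_inf_lbound; exists [set z | f z <= c%:E].
by apply: ge_ereal_sup => _ [z zc <-].
Qed.

End UscRegularization.

(** * The Green function belongs to its own class *)

Section Perron.
Variable R : realType.
Local Notation C := (Rcomplex R).
Local Notation mu := (@lebesgue_measure R).
Variables (D : set C) (a : C) (q : R).
Hypotheses (oD : open D) (cD : connected D) (Da : D a).
Hypotheses (q0 : 0 < q) (Dq : forall z, D z -> `|z - a| < q).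

Local Notation gam := (complex_green D a).
Local Notation gams := (usc_reg D gam).

Lemma green_ge (v : C -> \bar R) z : subharmonic D v ->
  (forall w, D w -> (v w < 0)%E) -> has_log_pole v a -> (v z <= gam z)%E.
Proof. by move=> h1 h2 h3; apply: ereal_sup_ubound; exists v. Qed.

Lemma green_le z (b : \bar R) : (forall v, subharmonic D v ->
  (forall w, D w -> (v w < 0)%E) -> has_log_pole v a -> (v z <= b)%E) -> (gam z <= b)%E.
Proof. by move=> h; apply: ge_ereal_sup => _ [v [h1 h2 h3] <-]; exact: h. Qed.

Lemma green_le0 z : D z -> (gam z <= 0)%E.
Proof. by move=> Dz; apply: green_le => v _ h _; exact/ltW/h. Qed.

Lemma green_lower z : D z -> (vlog a q z <= gam z)%E.
Proof. by move=> Dz; have [h1 h2 h3] := vlog_candidate oD q0 Dq; exact: green_ge. Qed.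

Lemma green_upper r z : [set w | `|w - a| <= r] `<=` D -> 0 < `|z - a| <= r ->
  (gam z <= (ln (`|z - a| / r))%:E)%E.
Proof.
move=> rD zr; apply: green_le => v sv v0 pv.
by apply: (log_pole_bound oD sv) => // w /v0/ltW.
Qed.

Lemma green_reg_le0 z : D z -> (gams z <= 0)%E.
Proof.
move=> Dz; apply: usc_reg_le => c c0; rewrite near_withinE; near=> w => Dw.
by apply: le_trans (green_le0 Dw) (ltW c0).
Unshelve. all: by end_near. Qed.

Lemma green_reg_usc : usc_on D gams.
Proof. by apply: usc_reg_usc => z /green_reg_le0 h; apply: le_lt_trans h _. Qed.

Lemma green_reg_upper r z : [set w | `|w - a| <= r] `<=` D -> 0 < `|z - a| < r ->
  (gams z <= (ln (`|z - a| / r))%:E)%E.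
Proof.
move=> rD /andP[z0 zr]; have r0 : 0 < r by apply: lt_trans zr.
have za : z != a by rewrite -subr_eq0 -normr_gt0.
apply: usc_reg_le => c; rewrite lte_fin => hc; rewrite near_withinE.
have h1 : \forall w \near z, ln `|w - a| < c + ln r.
  have /cvgr_lt := cvg_log za; apply.
  by move: hc; rewrite ln_div ?posrE //; lra.
have h2 : \forall w \near z, 0 < `|w - a|.
  by have /cvgr_gt := @cvg_dist _ a z; apply.
have h3 : \forall w \near z, `|w - a| < r.
  by have /cvgr_lt := @cvg_dist _ a z; apply.
near=> w => Dw.
have w1 : ln `|w - a| < c + ln r by near: w.
have w2 : 0 < `|w - a| by near: w.
have w3 : `|w - a| < r by near: w.
apply: le_trans (green_upper rD _) _; first by rewrite w2 ltW.
by rewrite lee_fin ln_div ?posrE //; lra.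
Unshelve. all: by end_near. Qed.

Lemma disc_near (c : C) r : [set w | `|w - c| <= r] `<=` D ->
  exists2 d, 0 < d & forall z, `|z - c| < d -> [set w | `|w - z| <= r] `<=` D.
Proof.
move=> rD; have [k k0 hk] := @clearance _ D id c r oD (fun z zr => conj (rD z zr) cvg_id).
exists k => // z zc w /= wz.
apply: (hk (w - (z - c))).
  by have -> : w - (z - c) - c = w - z by ring.
have -> : w - (w - (z - c)) = z - c by ring.
lra.
Qed.

(** Suppose the mean is below b < [gams c]. Points [zk k] tending to c have [gam (zk k) > b], hence
    a competitor v > b there; the mean of v, and so of [gams], over the circle of radius r about
    [zk k] exceeds b. Upper semicontinuity and Fatou for [- gams] transfer this to the circle about
    c. *)
Lemma green_reg_submean (c : C) r : 0 < r -> [set w | `|w - c| <= r] `<=` D ->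
  (gams c <= ((2 * pi)^-1)%:E *
           \int[mu]_(t in `[0%R, (2 * pi)%R]) gams (circle_pt c r t))%E.
Proof.
move=> r0 rD; have Dc : D c by apply: rD; rewrite /= subrr normr0 ltW.
have p0 := twopi_gt0 R.
have hD z t : [set w | `|w - z| <= r] `<=` D -> D (circle_pt z r t).
  by apply; rewrite /= norm_circle gtr0_norm.
have lsc z : [set w | `|w - z| <= r] `<=` D ->
    lower_semicontinuous (\- (fun t => gams (circle_pt z r t)))%E.
  by move=> zD; apply: (usc_circle oD green_reg_usc) => t; exact: hD.
rewrite leNgt; apply/negP => /real_between[b [b1 b2]].
have [d d0 hd] := disc_near rD.
(* [d] keeps the translated discs in [D]; 1 / (k + 1) forces convergence to c. *)
have pick (k : nat) : exists z, `|z - c| < Num.min d k.+1%:R^-1 /\ (b%:E < gam z)%E.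
  apply: contrapT => hno; move: b2; rewrite ltNge => /negP; apply.
  apply: usc_reg_le => e; rewrite lte_fin => be; rewrite near_withinE.
  apply/near_normP; exists (Num.min d k.+1%:R^-1); first by rewrite lt_min d0 invr_gt0 ltr0n.
  move=> y yc Dy; apply: le_trans (_ : b%:E <= _)%E; last by rewrite lee_fin ltW.
  by rewrite leNgt; apply/negP => hb; apply: hno; exists y.
have [zk hz] := choice pick.
have zD k : [set w | `|w - zk k| <= r] `<=` D.
  by apply: hd; have [] := hz k; rewrite lt_min => /andP[].
pose f k t : \bar R := (- gams (circle_pt (zk k) r t))%E.
have mI : measurable (`[0, 2 * pi]%classic : set R) by exact: measurable_itv.
have mf k : measurable_fun `[0, 2 * pi]%classic (f k).
  by apply: measurable_funTS; apply: lower_semicontinuous_measurable; exact: lsc.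
have f0 k t : `[0, 2 * pi]%classic t -> (0 <= f k t)%E.
  by move=> _; rewrite /f oppe_ge0; apply: green_reg_le0; apply: hD.
have mean_bound k : (\int[mu]_(t in `[0%R, (2 * pi)%R]) f k t <= (2 * pi * - b)%:E)%E.
  have [_ hb] := hz k.
  have [_ [v [sv v0 pv] <-] bv] := ereal_sup_gt hb.
  have := sv.2 (zk k) r r0 (zD k).
  have lv := usc_circle oD sv.1 (fun t => hD (zk k) t (zD k)).
  have vle t : (v (circle_pt (zk k) r t) <= 0)%E by apply/ltW/v0/hD.
  rewrite emeanN // muleN => hv.
  have : (((2 * pi)^-1)%:E * \int[mu]_(t in `[0%R, (2 * pi)%R]) (- v (circle_pt (zk k) r t)) <= (- b)%:E)%E.
    by rewrite EFinN leeNr; apply: le_trans hv; exact: ltW.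
  rewrite -(@lee_pmul2l _ (2 * pi)%:E) ?lte_fin // muleA -EFinM mulfV ?gt_eqF // mul1e -EFinM.
  apply: le_trans; apply: ge0_le_integral.
  - exact: mI.
  - exact: f0.
  - exact: mf.
  - by apply: measurable_funTS; apply: lower_semicontinuous_measurable.
  - move=> t _; rewrite /f leeN2; apply: le_trans (usc_reg_ge gam _); last exact: hD.
    exact: green_ge.
have := fatou mu mI mf f0.
have : (\int[mu]_(t in `[0%R, (2 * pi)%R]) - gams (circle_pt c r t) <=
   \int[mu]_(t in `[0%R, (2 * pi)%R]) limn_einf (f^~ t))%E.
  apply: ge0_le_integral => //.
  - by move=> t _; rewrite oppe_ge0; apply: green_reg_le0; apply: hD.
  - by apply: measurable_funTS; apply: lower_semicontinuous_measurable; exact: lsc.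
  - apply: (eq_measurable_fun (fun t => (- limn_esup (fun k => gams (circle_pt (zk k) r t)))%E)).
      by move=> t _; rewrite /limn_einf; congr (- limn_esup _)%E; apply/funext => k; rewrite /f oppeK.
    apply: measurableT_comp => //; apply: measurable_fun_limn_esup => k.
    have -> : (fun t => gams (circle_pt (zk k) r t)) = (fun t => - f k t)%E.
      by apply/funext => t; rewrite /f oppeK.
    exact: measurableT_comp (mf k).
  move=> t _; apply: le_limn_einf => e; rewrite lteNr -EFinN => he.
  have /near_normP[dl dl0 hdl] := usc_open oD green_reg_usc (hD c t rD) he.
  exists (Num.truncn dl^-1).+1 => k hk.
  rewrite /f leeNr -EFinN; apply/ltW/hdl.
  (* Points of equal angle on the two circles differ by the translation [zk k - c]. *)
  rewrite circle_ptE [X in _ - X]circle_ptE opprD addrACA subrr addr0.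
  have [+ _] := hz k; rewrite lt_min => /andP[_] /lt_trans; apply.
  rewrite invf_plt ?posrE ?ltr0n //; apply: lt_le_trans (truncnS_gt _) _.
  by rewrite ler_nat; apply: leq_trans hk _.
move=> h1 h2; have h3 := limn_einf_le mean_bound.
have h4 := le_trans h1 (le_trans h2 h3).
have gle t : (gams (circle_pt c r t) <= 0)%E by apply: green_reg_le0; apply: hD.
move: b1; rewrite ltNge => /negP; apply.
rewrite emeanN // muleN leeNr -EFinN.
apply: le_trans (_ : (((2 * pi)^-1)%:E * (2 * pi * - b)%:E <= _)%E).
  by rewrite lee_pmul2l // lte_fin invr_gt0.
by rewrite -EFinM lee_fin mulrA mulVf ?mul1r // gt_eqF.
Qed.

Lemma green_reg_subharmonic : subharmonic D gams.
Proof. by split; [exact: green_reg_usc|move=> c r; exact: green_reg_submean]. Qed.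

Lemma inner_disc : exists2 r, 0 < r & [set w | `|w - a| <= r] `<=` D.
Proof.
have [d d0 hd] := (near_normP a D).1 (open_nbhs_nbhs (conj oD Da)).
exists (d / 2); first by rewrite divr_gt0.
by move=> w /= wa; apply: hd; lra.
Qed.

Lemma green_reg_pole : has_log_pole gams a.
Proof.
have [r r0 rD] := inner_disc.
exists (- ln r).
have h : \forall w \near a, `|w - a| < r by apply/near_normP; exists r.
near=> w.
have wa : w != a by near: w; exact: nbhs_dnbhs_neq.
have w0 : 0 < `|w - a| by rewrite normr_gt0 subr_eq0.
rewrite -ln_div ?posrE //; apply: green_reg_upper => //; rewrite w0 /=.
by near: w; exact: cvg_within.
Unshelve. all: by end_near. Qed.

Lemma cmean_lt0 (f : R -> R) (t0 : R) : bounded_mfun f -> (forall t, f t <= 0) ->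
  0 <= t0 <= 2 * pi -> f t0 < 0 ->
  (forall c, f t0 < c -> \forall t \near t0, f t < c) -> cmean f < 0.
Proof.
move=> bf f0 /andP[t00 t01] ft uf.
have p0 := @pi_gt0 R.
have [|d d0 hd] := (near_normP t0 _).1 (uf (f t0 / 2) _); first by lra.
pose l := Num.min (d / 2) pi.
have l0 : 0 < l by rewrite lt_min divr_gt0.
have ld : l < d by apply: le_lt_trans (_ : d / 2 < d); [rewrite ge_min lexx|lra].
have lp : l <= pi by rewrite ge_min lexx orbT.
(* [t0] may be an endpoint, so the interval of length l <= pi is laid on the side of [t0] that stays
   in [0, 2 pi]. *)
have [x [x0 xl hx]] : exists x, [/\ 0 <= x, x + l <= 2 * pi &
    forall t, x <= t <= x + l -> f t <= f t0 / 2].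
  have [tp|tp] := leP t0 pi.
    exists t0; split => //; first by lra.
    by move=> t tx; apply/ltW/hd; rewrite ltr_norml; lra.
  exists (t0 - l); split; [lra|lra|].
  by move=> t tx; apply/ltW/hd; rewrite ltr_norml; lra.
have itv_le y z g : y <= z -> (forall t, y <= t <= z -> f t <= g) ->
    \int[mu]_(t in `[y, z]) f t <= g * (z - y).
  move=> yz hg; have -> : g * (z - y) = \int[mu]_(t in `[y, z]) g.
    rewrite Rintegral_cst //= lebesgue_measure_itv /= lte_fin.
    have [h|h] //= := ltP y z; have -> : z = y by lra.
    by rewrite subrr.
  apply: le_Rintegral; [exact: measurable_itv|exact: bmf_int|exact: (bmf_int _ _ _ _ (bmf_cst g))|].
  by move=> t /=; rewrite in_itv /=; exact: hg.
rewrite /cmean pmulr_rlt0 ?invr_gt0 ?twopi_gt0 //.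
rewrite (@Rintegral_itv_split _ f 0 x (2 * pi)) //; last by lra.
rewrite (@Rintegral_itv_split _ f x (x + l) (2 * pi)) //; last by lra.
have h1 := itv_le 0 x 0 x0 (fun t _ => f0 t).
have h2 := itv_le x (x + l) (f t0 / 2) _ hx.
have h3 := itv_le (x + l) (2 * pi) 0 xl (fun t _ => f0 t).
have {}h2 : \int[mu]_(t in `[x, x + l]) f t <= f t0 / 2 * l.
  by have := h2 _; rewrite addrAC subrr add0r; apply; lra.
have h4 : f t0 / 2 * l < 0 by rewrite pmulr_llt0 //; lra.
rewrite mul0r in h1; rewrite mul0r in h3.
apply: le_lt_trans (lerD h1 (lerD h2 h3)) _.
by rewrite add0r addr0.
Qed.

(** Local strong maximum principle: a nearby point with negative value lies on a circle about z, and
    upper semicontinuity makes the mean over that circle negative, against the submean inequality at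
    z. *)
Lemma green_reg_zero_open z : D z -> gams z = 0%E ->
  \forall w \near z, D w /\ gams w = 0%E.
Proof.
move=> Dz gz.
have [d d0 hd] := (near_normP z D).1 (open_nbhs_nbhs (conj oD Dz)).
apply/near_normP; exists d => // w wd; have Dw := hd _ wd; split => //.
apply/eqP; rewrite eq_le green_reg_le0 //= leNgt; apply/negP => gw.
have wz : w != z by apply/eqP => h; rewrite h gz ltxx in gw.
pose r := `|w - z|; have r0 : 0 < r by rewrite normr_gt0 subr_eq0.
have rD : [set y | `|y - z| <= r] `<=` D.
  by move=> y /= yr; apply: hd; apply: le_lt_trans wd.
have [bc lc] := subharmonic_clip oD green_reg_subharmonic green_reg_le0 ler01 r0 rD.
have [t0 t0p wE] := polar (w - z).
have wE' : circle_pt z r t0 = w by rewrite circle_ptE /r -wE addrC subrK.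
have : cmean (fun t => clip 1 (gams (circle_pt z r t))) < 0.
  apply: (@cmean_lt0 _ t0) => //.
  - by move=> t; exact: clip_le0.
  - rewrite wE'; apply/clip_lt => //; right; split => //; lra.
  - move=> c hc.
    have Dc : D (circle_pt z r t0) by rewrite wE'.
    exact: (cont_circle (clip_usc oD green_reg_usc ler01 Dc hc)).
by move: lc; rewrite gz /= max_l ?min_l ?lexx //; lra.
Qed.

(** The zero set is open in [D], and closed by upper semicontinuity; it misses the points near the
    pole, where [green_reg_upper] is negative. *)
Lemma green_reg_lt0 z : D z -> (gams z < 0)%E.
Proof.
move=> Dz; rewrite lt_neqAle green_reg_le0 // andbT; apply/eqP => gz.
have ZD : [set w | D w /\ gams w = 0%E] = D.
  apply: cD; first by exists z.
    exists [set w | D w /\ gams w = 0%E].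
      by rewrite openE => w [Dw gw]; exact: green_reg_zero_open.
    by apply/seteqP; split => w; [move=> [? ?]|move=> [? []]].
  exists (~` [set w | D w /\ (gams w < 0)%E]).
    apply: open_closedC; rewrite openE => w [Dw gw].
    have h1 := usc_open oD green_reg_usc Dw gw.
    have h2 : nbhs w D by apply: open_nbhs_nbhs.
    by apply: filterS2 h1 h2 => y y1 y2; split.
  apply/seteqP; split => w.
    by move=> [Dw gw]; split => // -[_]; rewrite gw ltxx.
  move=> [Dw hw]; split => //; apply/eqP; rewrite eq_le green_reg_le0 //= leNgt.
  by apply/negP => h; apply: hw.
have [r r0 rD] := inner_disc.
pose w := a + ((r / 2) +i* 0)%C.
have wa : `|w - a| = r / 2.
  have -> : w - a = circle_pt 0 (r / 2) 0.
    by rewrite /w addrC addKr; apply: complexP; rewrite !circE /= ?cos0 ?sin0 add0r ?mulr1 ?mulr0.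
  by rewrite norm_circle0 gtr0_norm // divr_gt0.
have Dw : D w by apply: rD; rewrite /= wa; lra.
have : D w by [].
rewrite -{1}ZD => -[_ gw].
have := @green_reg_upper r w rD; rewrite wa gw => /(_ _).
have -> : (0 < r / 2 < r) by lra.
move=> /(_ isT); rewrite lee_fin leNgt ln_lt0 //; apply/andP; split.
  by rewrite !divr_gt0.
by rewrite ltr_pdivrMr // mul1r; lra.
Qed.

(* The regularization belongs to the class whose supremum it regularizes. *)
Lemma green_regE z : D z -> gams z = gam z.
Proof.
move=> Dz; apply/eqP; rewrite eq_le usc_reg_ge // andbT.
by apply: green_ge; [exact: green_reg_subharmonic|exact: green_reg_lt0|exact: green_reg_pole].
Qed.

Lemma eq_subharmonic (u v : C -> \bar R) : (forall z, D z -> u z = v z) ->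
  subharmonic D u -> subharmonic D v.
Proof.
move=> uv [[u1 u2] u3]; split; first split.
- by move=> z Dz; rewrite -uv // u1.
- move=> z c Dz; rewrite -uv // => /(u2 _ _ Dz); rewrite !near_withinE.
  by apply: filterS => w h Dw; rewrite -uv // h.
move=> c r r0 rD; rewrite -uv; last by apply: rD; rewrite /= subrr normr0 ltW.
have := u3 c r r0 rD; congr (_ <= _ * _)%E; apply: eq_integral => t _.
by rewrite uv //; apply: rD; rewrite /= norm_circle gtr0_norm.
Qed.

Lemma green_subharmonic : subharmonic D gam.
Proof. exact: (eq_subharmonic green_regE green_reg_subharmonic). Qed.

Lemma green_lt0 z : D z -> (gam z < 0)%E.
Proof. by move=> Dz; rewrite -green_regE //; exact: green_reg_lt0. Qed.

End Perron.

(** * Quaternions *)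

Section Reflection.
Variable R : realType.
Local Notation C := (Rcomplex R).
Implicit Types z w : C.

Definition reflect z : C := (complex.Re z +i* - complex.Im z)%C.

Lemma reflectK z : reflect (reflect z) = z.
Proof. by apply: complexP => //=; rewrite opprK. Qed.

Lemma reflectB z w : reflect (z - w) = reflect z - reflect w.
Proof. by apply: complexP; rewrite /= ?ReImE //=; ring. Qed.

Lemma norm_reflect z : `|reflect z| = `|z|.
Proof.
apply/eqP; rewrite -(@eqrXn2 _ 2) //.
by rewrite !sqnormE /= sqrrN.
Qed.

Lemma cvg_reflect z : reflect @ z --> reflect z.
Proof.
by apply/contP => e e0; exists e => // y; rewrite -reflectB norm_reflect.
Qed.

Lemma reflect_circle a r t : reflect (circle_pt a r t) = circle_pt (reflect a) r (2 * pi - t).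
Proof.
have -> : (2 * pi - t : R) = - t + 2 * pi by rewrite addrC.
rewrite circle_per; apply: complexP; rewrite /= !circE /= ?cosN ?sinN //.
by rewrite opprD mulrN.
Qed.

Variable D : set C.
Hypotheses (oD : open D) (rD : forall z, D z -> D (reflect z)).

(** Conjugation is antiholomorphic, hence outside [subharmonic_comp]; but it maps circles to circles
    run backwards, which preserves means. *)
Lemma subharmonic_reflect (v : C -> \bar R) : (forall z, D z -> (v z <= 0)%E) ->
  subharmonic D v -> subharmonic D (v \o reflect).
Proof.
move=> v0 sv; apply: clip_subharmonic => //.
- apply: usc_comp sv.1 _ => // z Dz; split; [exact: rD|exact: cvg_reflect].
- by move=> z /rD /v0.
move=> n c r r0 cD.
have cD' : [set z | `|z - reflect c| <= r] `<=` D.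
  move=> z zr; rewrite -[z]reflectK; apply/rD/cD.
  by rewrite /= -norm_reflect reflectB reflectK.
have [b l] := subharmonic_clip oD sv v0 (ler0n _ n) r0 cD'.
apply: (le_trans l); rewrite -(cmean_refl b) le_eqVlt; apply/orP; left; apply/eqP.
by apply: eq_cmean => t /=; rewrite reflect_circle.
Qed.

(** Composition with this involution, which fixes the pole, permutes the competitors; one inequality
    is enough. *)
Lemma green_reflect a z : reflect a = a -> complex_green D a (reflect z) = complex_green D a z.
Proof.
move=> ra; suff le w : (complex_green D a w <= complex_green D a (reflect w))%E.
  by apply/eqP; rewrite eq_le -{2}[z]reflectK !le.
apply: green_le => v sv v0 [M /near_normP[d d0 hd]].
rewrite -{1}[w]reflectK; apply: (@green_ge _ D a (v \o reflect)).
- by apply: subharmonic_reflect => // z' /v0/ltW.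
- by move=> z' /rD /v0.
exists M; apply/near_normP; exists d => // y yd ya /=.
have e : `|reflect y - a| = `|y - a| by rewrite -[in LHS]ra -reflectB norm_reflect.
rewrite -e; apply: hd; first by rewrite e.
by apply: contra_neq ya => h; rewrite -[y]reflectK h.
Qed.

End Reflection.

(** * Slices and slice coordinates *)

Section QuaternionSlices.
Variable R : realType.
Local Notation C := (Rcomplex R).
Implicit Types (p q I : quat R) (z w : C).

Lemma qnormE q : `|q| ^+ 2 = qsq q.
Proof. by rewrite sqr_sqrtr // qsq_ge0. Qed.

Lemma imag_unitP I : imag_units I <-> qa I = 0 /\ qb I ^+ 2 + qc I ^+ 2 + qd I ^+ 2 = 1.
Proof.
rewrite /imag_units /= expr2; split.
  move=> h; have := congr1 (@qa R) h; have := congr1 (@qb R) h.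
  have := congr1 (@qc R) h; have := congr1 (@qd R) h; case: I {h} => a b c d /= hd hc hb ha.
  have a0 : a = 0.
    apply/eqP; apply: contraT => a0.
    have nz (x : R) : a * x = 0 -> x = 0 by move/eqP; rewrite mulf_eq0 (negbTE a0) => /eqP.
    have b0 : b = 0 by apply: nz; lra.
    have c0 : c = 0 by apply: nz; lra.
    have d0 : d = 0 by apply: nz; lra.
    have := sqr_ge0 a; rewrite b0 c0 d0 in ha; lra.
  by split => //; rewrite a0 in ha; lra.
case: I => a b c d /= [-> h]; apply: quatP => /=; try ring.
by lra.
Qed.

Lemma imag_unit_qi : imag_units (@qi R).
Proof. by apply/imag_unitP; split => //=; ring. Qed.

Lemma imag_unitN I : imag_units I -> imag_units (- I).
Proof. by move=> /imag_unitP[h1 h2]; apply/imag_unitP => /=; rewrite !sqrrN h1 oppr0. Qed.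

Lemma slice_embB I z w : slice_emb I (z - w) = slice_emb I z - slice_emb I w.
Proof. by apply: quatP; rewrite /slice_emb !ReImE /=; ring. Qed.

Lemma norm_slice_emb I z : imag_units I -> `|slice_emb I z| = `|z|.
Proof.
move=> /imag_unitP[h1 h2]; apply/eqP; rewrite -(@eqrXn2 _ 2) //; apply/eqP.
rewrite qnormE sqnormE /qsq /= h1.
transitivity (complex.Re z ^+ 2 + complex.Im z ^+ 2 * (qb I ^+ 2 + qc I ^+ 2 + qd I ^+ 2)); first by ring.
by rewrite h2 mulr1.
Qed.

Lemma cvg_slice_emb I z : imag_units I -> slice_emb I @ z --> slice_emb I z.
Proof.
by move=> uI; apply/contP => e e0; exists e => // y; rewrite -slice_embB norm_slice_emb.
Qed.

Definition slice_coord q : C := (qa q +i* `|qIm q|)%C.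

Lemma slice_coord_emb I z : imag_units I ->
  slice_coord (slice_emb I z) = (complex.Re z +i* `|complex.Im z|)%C.
Proof.
move=> /imag_unitP[h1 h2]; apply: complexP => /=; first by rewrite h1; ring.
apply/eqP; rewrite -(@eqrXn2 _ 2) //; apply/eqP.
rewrite qnormE real_normK ?num_real // /qsq /=.
transitivity (complex.Im z ^+ 2 * (qb I ^+ 2 + qc I ^+ 2 + qd I ^+ 2)); first by ring.
by rewrite h2 mulr1.
Qed.

Definition im_dir q : quat R := `|qIm q|^-1 *: qIm q.

Lemma im_dir_unit q : `|qIm q| != 0 -> imag_units (im_dir q).
Proof.
move=> h; apply/imag_unitP => /=; split; first by rewrite mulr0.
rewrite !exprMn -!mulrDr.
have -> : qb q ^+ 2 + qc q ^+ 2 + qd q ^+ 2 = `|qIm q| ^+ 2.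
  by rewrite qnormE /qsq /=; ring.
by rewrite -exprMn mulVf // expr1n.
Qed.

Lemma slice_coordK q : exists2 I, imag_units I & slice_emb I (slice_coord q) = q.
Proof.
have [h|h] := eqVneq `|qIm q| 0.
  (* A real q lies in every slice; any unit will do. *)
  exists qi; first exact: imag_unit_qi.
  move/normr0_eq0 : (h) => h'; apply: quatP; rewrite /= ?h; first by ring.
  - by rewrite -[RHS]/(qb (qIm q)) h' /=; ring.
  - by rewrite -[RHS]/(qc (qIm q)) h' /=; ring.
  - by rewrite -[RHS]/(qd (qIm q)) h' /=; ring.
exists (im_dir q); first exact: im_dir_unit.
by apply: quatP; rewrite /= ?mulrA ?mulfV //; ring.
Qed.

(** The reverse triangle inequality on imaginary parts. It gives upper semicontinuity of u also
    across the real axis. *)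
Lemma norm_slice_coordB p q : `|slice_coord p - slice_coord q| <= `|p - q|.
Proof.
rewrite -(@ler_pXn2r _ 2) ?nnegrE // sqnormE qnormE !ReImE /=.
have -> : qsq (p - q) = (qa p - qa q) ^+ 2 + `|qIm p - qIm q| ^+ 2.
  by rewrite qnormE /qsq /=; ring.
rewrite lerD2l -[leLHS]real_normK ?num_real // ler_pXn2r ?nnegrE //.
exact: ler_dist_dist.
Qed.

Lemma norm_slice_coord_real q (x : R) : `|slice_coord q - (x +i* 0)%C| = `|q - x%:A|.
Proof.
have [I uI {2}<-] := slice_coordK q.
rewrite -(norm_slice_emb _ uI) slice_embB; congr (`|_ - _|).
by apply: quatP => /=; ring.
Qed.

End QuaternionSlices.

(** * Discs holomorphic for J *)

Section HolomorphicDiscs.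
Variable R : realType.
Local Notation C := (Rcomplex R).
Implicit Types (p q I : quat R).

Definition im_dot p q : R := qb p * qb q + qc p * qc q + qd p * qd q.

Lemma im_dotD I p q : im_dot I (p + q) = im_dot I p + im_dot I q.
Proof. by rewrite /im_dot /=; ring. Qed.

Lemma im_dotZ I (k : R) p : im_dot I (k *: p) = k * im_dot I p.
Proof. by rewrite /im_dot /=; ring. Qed.

Lemma qa_norm q : `|qa q| <= `|q|.
Proof.
rewrite -(@ler_pXn2r _ 2) ?nnegrE // qnormE real_normK ?num_real // /qsq.
by have := sqr_ge0 (qb q); have := sqr_ge0 (qc q); have := sqr_ge0 (qd q); lra.
Qed.

Lemma im_dot_norm I p : imag_units I -> `|im_dot I p| <= `|p|.
Proof.
move=> /imag_unitP[_ h]; rewrite -(@ler_pXn2r _ 2) ?nnegrE // qnormE real_normK ?num_real // -subr_ge0.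
have -> : qsq p - im_dot I p ^+ 2 = qa p ^+ 2 + (qb I * qc p - qc I * qb p) ^+ 2 +
   (qb I * qd p - qd I * qb p) ^+ 2 + (qc I * qd p - qd I * qc p) ^+ 2.
  rewrite -[qsq p]mulr1 /qsq.
  transitivity (qa p ^+ 2 + (qb p ^+ 2 + qc p ^+ 2 + qd p ^+ 2) *
    (qb I ^+ 2 + qc I ^+ 2 + qd I ^+ 2) - im_dot I p ^+ 2); first by rewrite h; ring.
  by rewrite /im_dot; ring.
by rewrite !addr_ge0 ?sqr_ge0.
Qed.

(** Below, the norm dominates the component along [im_dir q]. Above, x - s <= (x^2 - s^2) / (2 s)
    with x = |Im (q + p)| and s = |Im q|. *)
Lemma norm_im_expansion q p : `|qIm q| != 0 ->
  0 <= `|qIm (q + p)| - `|qIm q| - im_dot (im_dir q) p <= `|p| ^+ 2 / (2 * `|qIm q|).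
Proof.
move=> h; have s0 : 0 < `|qIm q| by rewrite lt_neqAle eq_sym h /=.
have E1 : im_dot (im_dir q) q = `|qIm q|.
  apply: (mulfI h); rewrite -expr2 qnormE /qsq /im_dot /im_dir /=.
  transitivity ((`|qIm q| * `|qIm q|^-1) * (qb q ^+ 2 + qc q ^+ 2 + qd q ^+ 2)); first by ring.
  by rewrite mulfV // mul1r; ring.
have E2 : `|qIm (q + p)| ^+ 2 = `|qIm q| ^+ 2 + 2 * `|qIm q| * im_dot (im_dir q) p + `|qIm p| ^+ 2.
  have -> : 2 * `|qIm q| * im_dot (im_dir q) p = 2 * im_dot q p.
    rewrite -mulrA /im_dot /im_dir /=; congr (_ * _).
    transitivity ((`|qIm q| * `|qIm q|^-1) * (qb q * qb p + qc q * qc p + qd q * qd p)); first by ring.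
    by rewrite mulfV // mul1r.
  by rewrite !qnormE /qsq /im_dot /=; ring.
have pp : `|qIm p| ^+ 2 <= `|p| ^+ 2.
  by rewrite !qnormE /qsq /= expr0n /= add0r; have := sqr_ge0 (qa p); lra.
apply/andP; split.
  have := im_dot_norm (qIm (q + p)) (im_dir_unit h).
  have -> : im_dot (im_dir q) (qIm (q + p)) = `|qIm q| + im_dot (im_dir q) p.
    by rewrite -E1 -im_dotD.
  by rewrite ler_norml; lra.
rewrite ler_pdivlMr ?mulr_gt0 //.
move: E2 pp; move: `|qIm (q + p)| `|qIm q| `|qIm p| `|p| (im_dot (im_dir q) p) => x s y z k E2 pp.
have := sqr_ge0 (x - s); lra.
Qed.

(* L_I varies with q, but to first order |Im q| only sees the component of the
   displacement along I = Im q / |Im q|, and J is left multiplication by I. *)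
Lemma J_disc_cderivable (phi : C -> quat R) (z : C) :
  `|qIm (phi z)| != 0 -> differentiable phi z ->
  (forall h : C, 'd phi z (('i%C : C) * h) = Jstr (phi z) ('d phi z h)) ->
  cderivable (slice_coord (R := R) \o phi) z.
Proof.
move=> h dphi Jphi.
have s0 : 0 < `|qIm (phi z)| by rewrite lt_neqAle eq_sym h /=.
pose L : C -> quat R := 'd phi z.
have LD (x y : R) : L (x +i* y)%C = x *: L 1 + y *: L ('i%C : C).
  have -> : (x +i* y)%C = x *: (1 : C) + y *: ('i%C : C) :> C.
    by apply: complexP; rewrite !ReImE /=; ring.
  by rewrite /L linearD !linearZ.
have := Jphi 1; rewrite mulr1 -/(L _) -/(L 1) /Jstr -/(im_dir (phi z)) => Li.
have [I IE uI] : exists2 I, I = im_dir (phi z) & imag_units I.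
  by exists (im_dir (phi z)) => //; exact: im_dir_unit.
rewrite -IE in Li.
have [Ia I1] := (imag_unitP I).1 uI.
(* The projection of [L 1] to the plane of I. As [L i = I * L 1], the projection of [L k] is d k. *)
pose d : C := (qa (L 1) +i* im_dot I (L 1))%C.
have aL (k : C) : qa (L k) = complex.Re (d * k : C).
  case: k => x y; rewrite LD Li ReImE /= Ia /im_dot; ring.
have bL (k : C) : im_dot I (L k) = complex.Im (d * k : C).
  case: k => x y; rewrite LD Li im_dotD !im_dotZ ReImE /=.
  have -> : im_dot I (I * L 1) = qa (L 1) * (qb I ^+ 2 + qc I ^+ 2 + qd I ^+ 2).
    by rewrite /im_dot /= Ia; ring.
  by rewrite I1; ring.
pose K := `|L 1| + `|L ('i%C : C)|.
have K0 : 0 <= K by rewrite addr_ge0.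
have LK (k : C) : `|L k| <= K * `|k|.
  case: k => x y; rewrite LD; apply: le_trans (ler_normD _ _) _.
  rewrite !normrZ mulrDl; apply: lerD; rewrite mulrC ler_wpM2l //.
    exact: (normRe (x +i* y)%C).
  exact: (normIm (x +i* y)%C).
have lin e : 0 < e -> exists2 dl, 0 < dl & forall w : C, `|w - z| < dl ->
    `|phi w - phi z - L (w - z)| <= e * `|w - z|.
  move=> e0; have /eqaddoP /(_ e e0) /near_normP[dl dl0 hdl] := diff_locally dphi.
  exists dl => // w wd; have := hdl (w - z); rewrite subr0 => /(_ wd).
  by rewrite !fctE /= subrK opprD addrA.
exists d => e e0.
pose s := `|qIm (phi z)|.
(* Three shares: the real part, the linear error of the imaginary part, and its quadratic remainder,
   which [d3] controls. *)
have e3 : 0 < e / 3 by rewrite divr_gt0.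
have [d1 d10 h1] := lin _ e3.
have [d2 d20 h2] := lin _ ltr01.
pose d3 := e / 3 * (2 * s) / (K + 1) ^+ 2.
have K1 : 0 < K + 1 by lra.
have d30 : 0 < d3 by rewrite divr_gt0 ?exprn_gt0 // !mulr_gt0.
exists (Num.min d1 (Num.min d2 d3)); first by rewrite !lt_min d10 d20.
move=> w; rewrite !lt_min => /and3P[/h1 w1 /h2 w2 w3].
pose k := w - z; rewrite -/k in w1 w2 w3 *.
pose p := phi w - phi z; rewrite -/p in w1 w2.
pose o := p - L k; rewrite -/o in w1 w2.
have pE : p = L k + o by rewrite /o addrC subrK.
have pK : `|p| <= (K + 1) * `|k|.
  rewrite pE; apply: le_trans (ler_normD _ _) _.
  by rewrite mulrDl; apply: lerD.
have := norm_im_expansion p h; rewrite -IE -/s.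
have -> : phi z + p = phi w by rewrite /p addrC subrK.
move=> /andP[x1 x2].
have pp : `|p| ^+ 2 / (2 * s) <= e / 3 * `|k|.
  rewrite ler_pdivrMr ?mulr_gt0 //.
  apply: le_trans (_ : ((K + 1) * `|k|) ^+ 2 <= _).
    by rewrite ler_pXn2r ?nnegrE // mulr_ge0 // ltW.
  rewrite exprMn expr2 mulrA -mulrA mulrA -mulrA.
  have : (K + 1) ^+ 2 * `|k| <= e / 3 * (2 * s).
    by rewrite mulrC -ler_pdivlMr ?exprn_gt0 // ltW.
  move=> /(ler_wpM2r (normr_ge0 k)); rewrite expr2; lra.
apply: le_trans (norm_le_ReIm _) _.
have -> : complex.Re ((slice_coord (R:=R) \o phi) w - (slice_coord (R:=R) \o phi) z - (d * k : C)) =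
    qa (phi w) - qa (phi z) - qa (L k) by rewrite aL !ReImE.
have -> : complex.Im ((slice_coord (R:=R) \o phi) w - (slice_coord (R:=R) \o phi) z - (d * k : C)) =
    `|qIm (phi w)| - s - im_dot I (L k) by rewrite bL !ReImE.
have y1 : qa (phi w) - qa (phi z) - qa (L k) = qa o by rewrite /o /p /=.
have y2 : im_dot I p = im_dot I (L k) + im_dot I o by rewrite pE im_dotD.
rewrite y1.
have z1 := qa_norm o; have z2 := im_dot_norm o uI.
rewrite y2 in x1 x2.
have : `|(`|qIm (phi w)| - s - im_dot I (L k))| <= `|o| + e / 3 * `|k|.
  rewrite ler_norml in z2; rewrite ler_norml; move: z2 x1 x2 pp; clear; lra.
move: z1 w1; clear; lra.
Qed.

End HolomorphicDiscs.

(** * The symmetric slice domain and its Green function *)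

Section SymmetricDomain.
Variable R : realType.
Local Notation C := (Rcomplex R).
Variables (Omega : set (quat R)) (x0 : R).
Hypotheses (Omega_bounded : bounded_set Omega) (Omega_slice : slice_domain Omega).
Hypotheses (Omega_symmetric : axially_symmetric Omega) (Omega_x0 : Omega x0%:A).

Local Notation D := (slice Omega qi : set C).
Local Notation a := ((x0 +i* 0)%C : C).
Local Notation gam := (complex_green D a).

Lemma sliceE I J : imag_units I -> imag_units J -> slice Omega I = slice Omega J.
Proof.
move=> uI uJ; by apply/seteqP; split => z h; exact: (Omega_symmetric _ h).
Qed.

Lemma open_slice : open D.
Proof.
have [[_ oO _] _ _] := Omega_slice; rewrite openE => z Dz.
have /= := @cvg_slice_emb R qi z (imag_unit_qi R); apply; exact: open_nbhs_nbhs.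
Qed.

Lemma connected_slice : connected D.
Proof. by have [_ _] := Omega_slice; apply; exact: imag_unit_qi. Qed.

Lemma slice_pole : D a.
Proof.
by rewrite /slice /= /slice_emb /= scale0r addr0.
Qed.

Lemma bounded_slice : exists M : R, forall z, D z -> `|z| <= M.
Proof.
have [M [_ hM]] := Omega_bounded; exists (M + 1) => z Dz.
rewrite -(norm_slice_emb z (imag_unit_qi R)); apply: hM => //; lra.
Qed.

(** Conjugating the coordinate amounts to replacing the unit i by - i, and all slices agree. *)
Lemma slice_reflect z : D z -> D (reflect z).
Proof.
move=> Dz; rewrite (sliceE (imag_unit_qi R) (imag_unitN (imag_unit_qi R))).
rewrite /slice /= (_ : slice_emb _ _ = slice_emb qi z) //.
by apply: quatP => /=; ring.
Qed.

Lemma slice_green_reflect z : gam (reflect z) = gam z.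
Proof.
apply: green_reflect; [exact: open_slice|exact: slice_reflect|].
by rewrite /reflect /= oppr0.
Qed.

Lemma slice_green_abs (x y : R) : gam (x +i* `|y|)%C = gam (x +i* y)%C.
Proof.
by case: (ger0P y) => // _; rewrite -[RHS]slice_green_reflect.
Qed.

Lemma slice_coord_mem q : Omega q -> D (slice_coord q).
Proof.
have [I uI qE] := slice_coordK q => Oq.
by rewrite (sliceE (imag_unit_qi R) uI) /slice /= qE.
Qed.

Lemma green_coord_emb I z : imag_units I -> gam (slice_coord (slice_emb I z)) = gam z.
Proof. by move=> uI; rewrite slice_coord_emb // slice_green_abs; case: z. Qed.

Lemma slice_ball : exists2 q : R, 0 < q & forall z, D z -> `|z - a| < q.
Proof.
have [M hM] := bounded_slice; exists (M + `|a| + 1).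
  by have := hM _ slice_pole; have := normr_ge0 a; lra.
move=> z /hM zM; apply: le_lt_trans (ler_normB _ _) _; lra.
Qed.

Lemma green_ne_ninfty z : D z -> z != a -> gam z != -oo%E.
Proof.
move=> Dz za; have [q q0 Dq] := slice_ball.
have := green_lower open_slice q0 Dq Dz; rewrite /vlog (negbTE za) => h.
by apply/eqP => e; rewrite e in h.
Qed.

Lemma green_log_bound : exists M : R, \forall z \near a^',
  (`|gam z - (ln `|z - a|)%:E| <= M%:E)%E.
Proof.
have [q q0 Dq] := slice_ball.
have [d d0 hd] := (near_normP a D).1 (open_nbhs_nbhs (conj open_slice slice_pole)).
have [r rE] : exists r, r = d / 2 by exists (d / 2).
have r0 : 0 < r by rewrite rE divr_gt0.
have rD : [set z | `|z - a| <= r] `<=` D.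
  by move=> z /= zr; apply: hd; apply: le_lt_trans zr _; rewrite rE; lra.
(* [gam z - ln |z - a|] lies between - ln q and - ln r. *)
exists (`|ln q| + `|ln r|); apply/near_normP; exists r => // z zr za.
have za' : 0 < `|z - a| by rewrite normr_gt0 subr_eq0.
have zrr : 0 < `|z - a| <= r by rewrite za' ltW.
have lo := green_lower open_slice q0 Dq (rD _ (ltW zr)).
have up := green_upper open_slice rD zrr.
rewrite /vlog (negbTE za) in lo.
move: lo up; case: (gam z) => [g| |] //; rewrite !lee_fin !ln_div ?posrE // => lo up.
rewrite ler_norml.
have := ler_norm (ln q); have := ler_norm (- ln r); rewrite normrN.
have := normr_ge0 (ln q); have := normr_ge0 (ln r).
move: lo up; clear; lra.
Qed.

Variable u : quat R -> \bar R.
Hypothesis uE : forall q, Omega q -> u q = gam (slice_coord q).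

Lemma ext_usc : usc_on Omega u.
Proof.
have [oO oD] : open Omega /\ open D by split; [case: Omega_slice => -[]|exact: open_slice].
have [[g1 g2] _] := green_subharmonic open_slice connected_slice slice_pole.
split => [p Op|p c Op]; first by rewrite uE // g1 //; exact: slice_coord_mem.
rewrite uE // => /(g2 _ _ (slice_coord_mem Op)); rewrite !near_withinE => h.
have /near_normP[d d0 hd] := h.
apply: (near_normP p (fun y => Omega y -> (u y < c%:E)%E)).2; exists d => // y yd Oy.
rewrite uE //; apply: hd; last exact: slice_coord_mem.
exact: le_lt_trans (norm_slice_coordB _ _) yd.
Qed.

Lemma ext_J_psh : J_plurisubharmonic (Omega `\` real_axis) u.
Proof.
have [M hM] := bounded_slice.
split.
  have [u1 u2] := ext_usc; split => [p [Op _]|p c [Op _]]; first exact: u1.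
  by move=> /(u2 _ _ Op); rewrite !near_withinE; apply: filterS => y h [/h].
move=> phi Jphi phiO.
have gs := green_subharmonic open_slice connected_slice slice_pole.
have oU : open (@unit_disc R).
  rewrite openE => z /= z1; apply/near_normP; exists (1 - `|z|); first by rewrite subr_gt0.
  move=> y yz; rewrite /unit_disc /= -(subrK z y); apply: le_lt_trans (ler_normD _ _) _; lra.
apply: (@eq_subharmonic _ _ (gam \o (slice_coord (R := R) \o phi))).
  move=> z Uz /=; rewrite uE //.
  by have [] : (Omega `\` real_axis) (phi z) by apply: phiO; exists z.
apply: (subharmonic_comp open_slice oU hM gs).
  by move=> z Dz; apply/ltW; apply: (green_lt0 open_slice connected_slice slice_pole).
move=> z Uz; have [Oz nR] : (Omega `\` real_axis) (phi z) by apply: phiO; exists z.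
split; first exact: slice_coord_mem.
have [dphi Jd] := Jphi z Uz; apply: J_disc_cderivable => //.
(* The disc avoids the real axis, so |Im| is nonzero along it, as the expansion of |Im| requires. *)
apply/eqP => /normr0_eq0 h; apply: nR; exists (qa (phi z)) => //.
apply: quatP; rewrite /= ?mulr1 ?mulr0 //.
- by rewrite -[RHS]/(qb (qIm (phi z))) h.
- by rewrite -[RHS]/(qc (qIm (phi z))) h.
- by rewrite -[RHS]/(qd (qIm (phi z))) h.
Qed.

Lemma ext_wsh : wsh Omega x0%:A u.
Proof.
have gs := green_subharmonic open_slice connected_slice slice_pole.
split; [split|..].
- exact: ext_usc.
- have [d d0 hd] := (near_normP a D).1 (open_nbhs_nbhs (conj open_slice slice_pole)).
  (* A real point near the pole but distinct from it, where the lower logarithmic bound is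
     finite. *)
  pose z := ((x0 + d / 2) +i* 0)%C : C.
  have zaE : z - a = ((d / 2) +i* 0)%C.
    by apply: complexP; rewrite ?ReImE /=; ring.
  have nza : `|z - a| = d / 2.
    apply/eqP; rewrite -(@eqrXn2 _ 2) // ?divr_ge0 ?(ltW d0) // zaE sqnormE /=.
    by rewrite expr0n addr0.
  have Dz : D z by apply: hd; rewrite nza; lra.
  exists (slice_emb qi z) => //.
  rewrite uE // green_coord_emb; last exact: imag_unit_qi.
  by apply: green_ne_ninfty => //; rewrite -subr_eq0 -normr_gt0 nza; lra.
- move=> I uI; rewrite (sliceE uI (imag_unit_qi R)).
  apply: eq_subharmonic gs => z Dz /=.
  rewrite uE ?green_coord_emb //.
  by move: Dz; rewrite (sliceE (imag_unit_qi R) uI).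
- move=> p Op; rewrite uE //; apply: (green_lt0 open_slice connected_slice slice_pole).
  exact: slice_coord_mem.
have [M hM] := green_log_bound.
apply: le_lt_trans (ltry M).
have [d d0 hd] := (near_normP _ _).1 hM.
have [[_ oO _] _ _] := Omega_slice.
have [d' d0' hd'] := (near_normP _ _).1 (open_nbhs_nbhs (conj oO Omega_x0)).
have nV : (x0%:A : quat R)^' [set p : quat R | p != x0%:A /\ `|p - x0%:A| < Num.min d d'].
  apply: (near_normP (x0%:A : quat R) (fun p => p != x0%:A -> p != x0%:A /\ `|p - x0%:A| < Num.min d d')).2.
  by exists (Num.min d d') => [|p pd pn]; [rewrite lt_min d0|split].
rewrite limf_esupE; apply: le_trans (ereal_inf_lbound _) _; first exact: (ex_intro2 _ _ _ nV erefl).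
apply: ge_ereal_sup => _ [p [pn pdd] <-].
have {pdd}/andP[pd pd'] : (`|p - x0%:A| < d) && (`|p - x0%:A| < d') by rewrite -lt_min.
have Op : Omega p by apply: hd'.
rewrite uE // -norm_slice_coord_real; apply: hd; first by rewrite norm_slice_coord_real.
by rewrite -subr_eq0 -normr_gt0 norm_slice_coord_real normr_gt0 subr_eq0.
Qed.

Lemma wsh_le_ext v p : wsh Omega x0%:A v -> Omega p -> (v p <= u p)%E.
Proof.
move=> [[_ _ sv] v0 vlim] Op; rewrite uE //.
have [I uI pE] := slice_coordK p.
have -> : v p = (v \o slice_emb I) (slice_coord p) by rewrite /= pE.
apply: green_ge.
- by rewrite (sliceE (imag_unit_qi R) uI); exact: sv.
- by move=> z; rewrite (sliceE (imag_unit_qi R) uI); exact: v0.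
move: vlim; rewrite limf_esupE => /ereal_inf_lt[_ [V Vn <-]] hV.
(* Any real above the supremum over the punctured neighbourhood serves as constant of the
   logarithmic pole on the slice. *)
have [m [hm _]] := real_between hV.
have [d d0 hd] := (near_normP _ _).1 Vn.
exists m; apply/near_normP; exists d => // z zd za.
have za' : `|slice_emb I z - x0%:A| = `|z - a|.
  rewrite -(norm_slice_emb (z - a) uI) slice_embB; congr (`|_ - _|).
  by apply: quatP => /=; ring.
have Vz : V (slice_emb I z).
  apply: hd; first by rewrite za'.
  by rewrite -subr_eq0 -normr_eq0 za' normr_eq0 subr_eq0.
have : (`|v (slice_emb I z) - (ln `|slice_emb I z - x0%:A|)%:E| <= m%:E)%E.
  apply: le_trans (ltW hm); apply: ereal_sup_ubound; by exists (slice_emb I z).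
rewrite za' /=; case: (v _) => [g| |] //=; rewrite ?leNye //.
rewrite !lee_fin ler_norml; lra.
Qed.

Lemma ext_quat_green p : Omega p -> u p = quat_green Omega x0%:A p.
Proof.
move=> Op; apply/eqP; rewrite eq_le; apply/andP; split.
  apply: le_trans (usc_reg_ge _ Op).
  by apply: ereal_sup_ubound; exists u => //; exact: ext_wsh.
apply: usc_reg_le => c uc; have [_ /(_ _ _ Op uc)] := ext_usc.
rewrite !near_withinE; apply: filterS => y hy Oy.
apply: ge_ereal_sup => _ [v vw <-].
exact: le_trans (wsh_le_ext vw Oy) (ltW (hy Oy)).
Qed.

End SymmetricDomain.

Theorem theorem7p12 (R : realType) (Omega : set (quat R)) (x0 : R)
    (Omega_bounded : bounded_set Omega)
    (Omega_slice : slice_domain Omega)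
    (Omega_symmetric : axially_symmetric Omega)
    (Omega_x0 : Omega x0%:A) :
  let Omega_i : set (Rcomplex R) := slice Omega qi in
  let gamma : Rcomplex R -> \bar R :=
    complex_green Omega_i (x0 +i* 0)%C in
  [/\ (* (1) *)
      (forall (x y : R) (I : quat R), imag_units I ->
         Omega (x%:A + y *: I) -> Omega_i (x +i* y)%C) /\
      (forall q : quat R, Omega q ->
         exists! c : \bar R, exists (x y : R) (I : quat R),
           [/\ imag_units I, q = x%:A + y *: I & c = gamma (x +i* y)%C])
    & forall u : quat R -> \bar R,
        (forall (x y : R) (I : quat R), imag_units I ->
           Omega (x%:A + y *: I) -> u (x%:A + y *: I) = gamma (x +i* y)%C) ->
        [/\ (* (2) *)
            J_plurisubharmonic (Omega `\` real_axis) u,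
            wsh Omega x0%:A u
          & (* (3) *)
            forall q : quat R, Omega q -> u q = quat_green Omega x0%:A q]].
Proof.
move=> Omega_i gamma.
have uqi := imag_unit_qi R.
have mem (x y : R) I : imag_units I -> Omega (x%:A + y *: I) -> Omega_i (x +i* y)%C.
  by move=> uI; rewrite /Omega_i (sliceE Omega_symmetric uqi uI).
have coord (x y : R) I : imag_units I -> gamma (x +i* y)%C = gamma (slice_coord (x%:A + y *: I)).
  by move=> uI; exact: esym (green_coord_emb x0 Omega_slice Omega_symmetric (x +i* y)%C uI).
split; first split => // q Oq.
  (* The value is read at the representation with y = |Im q|; [coord] brings every other one to it,
     including all choices of I at real q. *)
  exists (gamma (slice_coord q)); split.
    have [I uI qE] := slice_coordK q.
    by exists (qa q), `|qIm q|, I; split => //; rewrite -[LHS]qE.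
  by move=> c [x [y [I [uI -> ->]]]]; rewrite -coord.
move=> u hu.
have uE q : Omega q -> u q = gamma (slice_coord q).
  have [I uI qE] := slice_coordK q; rewrite -{1 2}qE => Oq.
  exact: (hu _ _ _ uI Oq).
split.
- exact: (ext_J_psh Omega_bounded Omega_slice Omega_symmetric Omega_x0 uE).
- exact: (ext_wsh Omega_bounded Omega_slice Omega_symmetric Omega_x0 uE).
- move=> q Oq.
  exact: (ext_quat_green Omega_bounded Omega_slice Omega_symmetric Omega_x0 uE Oq).
Qed.
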